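(* If $\mathcal P$ is an atomic chiral $4$-polytope with chiral facets and chiral vertex-figures, then its facets and its vertex-figures are atomic chiral polyhedra.
   Context: Abstract polytopes, type $\{p_1,\dots,p_{n-1}\}$, chirality and covering are as usual (a polytope of type $\{p_1,\dots,p_{n-1}\}$ has at least $2p_1\cdots p_{n-1}$ flags; it is tight if it has exactly that many). Facets are the faces of rank $n-1$ (viewed as polytopes via the section below them) and vertex-figures are the sections above a vertex. A tight chiral $4$-polytope is atomic if it does not properly cover any tight chiral polytope. An atomic chiral polyhedron is a tight chiral polyhedron of type $\{p,q\}$ that covers no chiral polyhedron of type $\{p',q\}$ or of type $\{p,q'\}$ with $p'$ a proper divisor of $p$ or $q'$ a proper divisor of $q$. *)

(* Defs.v *)
From mathcomp Require Import all_boot all_fingroup.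
Set Implicit Arguments. Unset Strict Implicit. Unset Printing Implicit Defensive.

(* A "ranked poset": a finite carrier, a (boolean) order relation and a rank
   function.  CONVENTION: ranks are shifted by one, i.e. a face of (usual)
   rank r has [rrk] equal to r+1; so the least face F_{-1} has rrk 0 and the
   greatest face F_n of an n-polytope has rrk n+1. *)
Record Raw := MkRaw {
  carrier : finType;
  rle : rel carrier;
  rrk : carrier -> nat }.

Section Polytopes.
Variable P : Raw.
Local Notation T := (carrier P).
Local Notation le := (@rle P).
Local Notation rk := (@rrk P).

Definition rlt (x y : T) : bool := le x y && (x != y).

Definition flagT (n : nat) := {ffun 'I_n.+2 -> T}.

Definition is_flag n (f : flagT n) : bool :=
  [forall i : 'I_n.+2, rk (f i) == i] &&
  [forall i : 'I_n.+2, forall j : 'I_n.+2, (i <= j) ==> le (f i) (f j)].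

Definition adjacent n (i : 'I_n.+2) (f g : flagT n) : bool :=
  [&& is_flag f, is_flag g, f i != g i &
      [forall j : 'I_n.+2, (j != i) ==> (f j == g j)]].

Definition some_adjacent n (f g : flagT n) : bool :=
  [exists i : 'I_n.+2, adjacent i f g].

Definition is_polytope (n : nat) : Prop :=
  (forall x, le x x) /\
  (forall x y, le x y -> le y x -> x = y) /\
  (forall x y z, le x y -> le y z -> le x z) /\
  (exists m, rk m = 0 /\ forall x, le m x) /\
  (exists M, rk M = n.+1 /\ forall x, le x M) /\
  (* P2: graded by rk (so every maximal chain = flag has n+2 faces) *)
  (forall x y, rlt x y -> rk x < rk y) /\
  (forall x y, rlt x y -> (forall z, ~~ (rlt x z && rlt z y)) ->
       rk y = (rk x).+1) /\
  (forall f g : flagT n, is_flag f -> is_flag g ->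
     exists s : seq (flagT n),
       [/\ @path (flagT n) (@some_adjacent n) f s, @last (flagT n) f s = g &
           @all (flagT n) (fun h => [forall i, (f i == g i) ==> (h i == f i)]) s]) /\
  (forall x y, rlt x y -> rk y = (rk x).+2 ->
     #|[set z | rlt x z && rlt z y]| = 2).

Definition is_aut (g : {perm T}) : Prop := forall x y, le (g x) (g y) = le x y.

Definition aut_flag n (g : {perm T}) (f : flagT n) : flagT n :=
  [ffun i => g (f i)].

Definition same_orbit n (f h : flagT n) : Prop :=
  exists g : {perm T}, is_aut g /\ h = aut_flag g f.

(* chiral: exactly two flag-orbits under the automorphism group, adjacent
   flags lying in different orbits *)
Definition chiral (n : nat) : Prop :=
  is_polytope n /\
  (forall (i : 'I_n.+2) (f h : flagT n), adjacent i f h -> ~ same_orbit f h) /\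
  (forall f1 f2 f3 : flagT n, is_flag f1 -> is_flag f2 -> is_flag f3 ->
     same_orbit f1 f2 \/ same_orbit f1 f3 \/ same_orbit f2 f3).

(* type {p_1,...,p_{n-1}}: for 1 <= j <= n-1, every section G/F with
   rank F = j-2, rank G = j+1 (a polygon) has exactly p_j faces of rank j *)
Definition has_type (n : nat) (ps : seq nat) : Prop :=
  size ps = n.-1 /\
  forall j, 1 <= j <= n.-1 ->
    forall a b, rk a = j.-1 -> rk b = j.+2 -> le a b ->
      #|[set z | [&& le a z, le z b & rk z == j.+1]]| = nth 0 ps j.-1.

Definition num_flags (n : nat) : nat := #|[set f : flagT n | is_flag f]|.

Definition tight (n : nat) : Prop :=
  is_polytope n /\
  exists ps, has_type n ps /\ num_flags n = 2 * \prod_(p <- ps) p.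

End Polytopes.

Definition map_flag (P Q : Raw) (n : nat) (gam : carrier P -> carrier Q)
  (f : flagT P n) : flagT Q n := [ffun i => gam (f i)].

Definition covers (n : nat) (P Q : Raw) : Prop :=
  exists gam : carrier P -> carrier Q,
    (forall x y, @rle P x y -> @rle Q (gam x) (gam y)) /\
    (forall x, @rrk Q (gam x) = @rrk P x) /\
    (forall (i : 'I_n.+2) (f g : flagT P n), adjacent i f g ->
        adjacent i (map_flag gam f) (map_flag gam g)).

Definition isomorphic (P Q : Raw) : Prop :=
  exists gam : carrier P -> carrier Q, bijective gam /\
    forall x y, @rle Q (gam x) (gam y) = @rle P x y.

Definition properly_covers (n : nat) (P Q : Raw) : Prop :=
  covers n P Q /\ ~ isomorphic P Q.

Definition section (P : Raw) (F G : carrier P) : Raw :=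
  @MkRaw {x : carrier P | @rle P F x && @rle P x G}
         (fun x y => @rle P (val x) (val y))
         (fun x => @rrk P (val x) - @rrk P F).

Definition atomic_chiral4 (P : Raw) : Prop :=
  tight P 4 /\ chiral P 4 /\
  forall Q : Raw, tight Q 4 -> chiral Q 4 -> ~ properly_covers 4 P Q.

Definition proper_divisor (d m : nat) : Prop := d %| m /\ d <> m.

Definition atomic_chiral_polyhedron (P : Raw) : Prop :=
  tight P 3 /\ chiral P 3 /\
  exists p q, has_type P 3 [:: p; q] /\
    forall Q : Raw, chiral Q 3 -> covers 3 P Q ->
      ~ (exists p', proper_divisor p' p /\ has_type Q 3 [:: p'; q]) /\
      ~ (exists q', proper_divisor q' q /\ has_type Q 3 [:: p; q']).

(* facets of a 4-polytope: sections F/F_{-1} with F of rank 3 (rrk 4);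
   vertex-figures: sections F_4/v with v of rank 0 (rrk 1) *)
Definition facet_sections (P : Raw) (Prop3 : Raw -> Prop) : Prop :=
  forall F0 F : carrier P, @rrk P F0 = 0 -> @rrk P F = 4 -> Prop3 (section F0 F).

Definition vertex_figures (P : Raw) (Prop3 : Raw -> Prop) : Prop :=
  forall v F5 : carrier P, @rrk P v = 1 -> @rrk P F5 = 5 -> Prop3 (section v F5).

(* Main.v *)
From mathcomp Require Import all_boot all_fingroup all_solvable.
Require Import Defs.
Set Implicit Arguments. Unset Strict Implicit. Unset Printing Implicit Defensive.



(** * Flags of a polytope *)

(** Let [G] be the automorphism group of a tight chiral 4-polytope, and [a], [b], [c] the standard
    rotations at a base flag. They satisfy (ab)^2 = (bc)^2 = (abc)^2 = 1, and tightness says that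
    [G] = <a><b><c> with unique factorization ([rots_triple], [rots_gen]). The base facet has
    rotation group K = <a, b>, the base vertex-figure L = <b, c>. That these sections are chiral
    means that inverting both generators is not well defined on K or on L: [reg a b 1] and
    [reg b c 1] fail ([sec_not_reg]).

    Atomicity becomes a group condition. If U is a nontrivial normal subgroup of [G] inside <a>, <b>
    or <c> that contains none of the generators, then the orbit poset of U is again a tight
    polytope, properly covered by P ([quo_polytope], [quo_tight], [quo_not_iso]). It cannot be
    chiral, so it has a reflection, and inversion of generators is well defined modulo U on both K
    and L ([rots_atomic]). The rest is finite group theory.

    Suppose the facet covers a chiral polyhedron of type {p', q} or {p, q'}. The kernel N of the
    induced map on K is nontrivial, normal in K, lies in <a> or in <b> respectively, and [reg a b N]
    fails ([sec_kernel]). If N lies in <a>, then it is normal in [G], because bc inverts a; it meets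
    L trivially, so regularity of L modulo N would make L regular ([core_a]). If N lies in <b>, take
    <x> of prime order in N. Once c normalizes <x>, this group is normal in [G], and regularity
    modulo <x> passes up to N, a contradiction ([atomic_triple_reg]). For odd order, the structure
    of products of two cyclic groups gives this ([tight_odd_prime], [common_odd_prime]).

    Order two is the hard case: an involution z of <b> centralized by K but not by c
    ([noncentral_absurd]). Then L has a single odd prime divisor s and a normal Sylow s-subgroup
    containing b^2 and c^2 ([noncentral_Sylow]). A Frattini argument shows that y = zb centralizes
    the normal closure of z ([y_cent]). The dihedral group generated by z and bc contains an element
    k of odd order, inverted by z and centralized by y, and its factorization in <c><b> is
    contradictory ([dihedral_factor_absurd]).

    Vertex-figures are handled by the duality sending (a, b, c) to (c^-1, b^-1, a^-1). *)

Section Flags.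
Variables (P : Raw) (n : nat).
Local Notation T := (carrier P).
Local Notation le := (@rle P).
Local Notation rk := (@rrk P).
Local Notation flag := (flagT P n).
Implicit Types (f g h : flag) (x y : T) (i j : 'I_n) (w : seq 'I_n).

Definition fn f (k : nat) : T := f (inord k).

(* Ranks in the usual convention: [i : 'I_n] is the rank of a proper face. *)
Definition idx (i : 'I_n) : 'I_n.+2 := inord i.+1.

Lemma val_idx i : idx i = i.+1 :> nat.
Proof. by rewrite inordK // ltnS ltnW // ltnS. Qed.

Lemma idx_inj : injective idx.
Proof. by move=> i j /(congr1 (@nat_of_ord _)); rewrite !val_idx => -[] /ord_inj. Qed.

Lemma idx_fn f i : f (idx i) = fn f i.+1. Proof. by []. Qed.

Lemma fnE f (k : 'I_n.+2) : fn f k = f k.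
Proof. by rewrite /fn inord_val. Qed.

(** On a flag the default [f] is never taken, since the diamond condition supplies the neighbour;
    totality lets words of adjacencies act by [foldl]. *)
Definition adj i f : flag := odflt f [pick g | adjacent (idx i) f g].
Definition adjw w f : flag := foldl (fun g i => adj i g) f w.

Lemma adjw_cat w w' f : adjw (w ++ w') f = adjw w' (adjw w f).
Proof. by rewrite /adjw foldl_cat. Qed.

Lemma adjacent_sym k f g : adjacent k f g = adjacent k g f.
Proof.
suff imp f' g' : adjacent k f' g' -> adjacent k g' f' by apply/idP/idP; apply: imp.
case/and4P=> ff gf fg /forallP H; apply/and4P; split=> //; first by rewrite eq_sym.
by apply/forallP=> j; rewrite [g' j == _]eq_sym.
Qed.

Hypothesis hP : is_polytope P n.

Lemma le_refl x : le x x. Proof. by case: hP. Qed.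
Lemma le_trans x y z : le x y -> le y z -> le x z.
Proof. by case: hP => _ [_ [H _]]; apply: H. Qed.
Lemma rlt_rk x y : rlt x y -> rk x < rk y.
Proof. by case: hP => _ [_ [_ [_ [_ [H _]]]]]; apply: H. Qed.

Lemma le_rk x y : le x y -> rk x <= rk y.
Proof.
move=> lxy; have [->//|nxy] := eqVneq x y.
by apply/ltnW/rlt_rk; rewrite /rlt lxy.
Qed.

Lemma le_rk_eq x y : le x y -> rk x = rk y -> x = y.
Proof.
move=> lxy e; apply/eqP/idPn=> nxy; have := @rlt_rk x y.
by rewrite /rlt lxy nxy e ltnn => /(_ isT).
Qed.

Lemma rk_le x : rk x <= n.+1.
Proof.
by case: hP => _ [_ [_ [_ [[M [rM leM]] _]]]]; rewrite -[X in _ <= X]rM; apply: le_rk.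
Qed.

Lemma rk0_le x y : rk x = 0 -> le x y.
Proof.
case: hP => _ [_ [_ [[m [rm lem]] _]]] rx.
by rewrite -(le_rk_eq (lem x)) // rm rx.
Qed.

Lemma rkn_le x y : rk x = n.+1 -> le y x.
Proof.
case: hP => _ [_ [_ [_ [[M [rM leM]] _]]]] rx.
by rewrite (le_rk_eq (leM x)) // rM rx.
Qed.

Lemma rank_succ x y : rlt x y -> exists z, [/\ le x z, le z y & rk z = (rk x).+1].
Proof.
have [m] := ubnP (rk y); elim: m y => // m IH y; rewrite ltnS => lem xy.
have [/existsP[w /andP[xw wy]]|nw] := boolP [exists w, rlt x w && rlt w y].
  have [|z [xz zw ez]] := IH w _ xw; first exact: leq_trans (rlt_rk wy) lem.
  by exists z; split=> //; apply: le_trans zw _; case/andP: wy.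
exists y; have /andP[lxy _] := xy; split=> //; first exact: le_refl.
case: hP => _ [_ [_ [_ [_ [_ [H _]]]]]]; apply: H => // z.
by apply: contra nw => H; apply/existsP; exists z.
Qed.

Lemma chain_ex x y : le x y -> exists h : nat -> T,
  [/\ h (rk x) = x, h (rk y) = y,
      forall k, rk x <= k <= rk y -> rk (h k) = k &
      forall k, rk x <= k < rk y -> le (h k) (h k.+1)].
Proof.
have [m] := ubnP (rk y - rk x); elim: m x => // m IH x; rewrite ltnS => lem lxy.
have [exy|nxy] := eqVneq x y.
  exists (fun _ => y); rewrite exy; split=> // k; first by rewrite -eqn_leq => /eqP.
  by move=> _; apply: le_refl.
have ltxy : rlt x y by rewrite /rlt lxy.
have [z [xz zy rz]] := rank_succ ltxy.
have rxy := rlt_rk ltxy.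
have [|h [hz hy hr hl]] := IH z _ zy.
  by rewrite rz; apply: leq_trans lem; rewrite -subn_gt0 in rxy; rewrite subnS prednK.
exists (fun k => if k <= rk x then x else h k); split.
- by rewrite leqnn.
- by rewrite leqNgt rxy.
- move=> k /andP[xk ky]; case: leqP => [kx|kx]; first by apply/eqP; rewrite eqn_leq xk kx.
  by apply: hr; rewrite rz kx.
move=> k /andP[xk ky]; case: (leqP k (rk x)) => [kx|kx]; last first.
  by rewrite (leqNgt k.+1) ltnS (ltnW kx) /=; apply: hl; rewrite rz kx.
have -> : k = rk x by apply/eqP; rewrite eqn_leq xk kx.
by rewrite ltnn -rz hz.
Qed.

Lemma flag_rk f (k : 'I_n.+2) : is_flag f -> rk (f k) = k.
Proof. by case/andP=> /forallP/(_ k)/eqP. Qed.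

Lemma flag_le f (k l : 'I_n.+2) : is_flag f -> k <= l -> le (f k) (f l).
Proof. by case/andP=> _ /forallP/(_ k)/forallP/(_ l)/implyP. Qed.

Lemma fn_rk f k : is_flag f -> k <= n.+1 -> rk (fn f k) = k.
Proof. by move=> ff kn; rewrite /fn flag_rk // inordK. Qed.

Lemma fn_le f k l : is_flag f -> k <= l <= n.+1 -> le (fn f k) (fn f l).
Proof.
move=> ff /andP[kl ln]; rewrite /fn flag_le // !inordK //.
exact: leq_ltn_trans kl _.
Qed.

Lemma flag_intro (h : nat -> T) :
  (forall k, k <= n.+1 -> rk (h k) = k) -> (forall k, k < n.+1 -> le (h k) (h k.+1)) ->
  exists2 f, is_flag f & forall k, k <= n.+1 -> fn f k = h k.
Proof.
move=> hr hl; exists [ffun k : 'I_n.+2 => h k]; last first.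
  by move=> k kn; rewrite /fn ffunE inordK.
apply/andP; split; first by apply/forallP=> k; rewrite ffunE hr // -ltnS.
apply/forallP=> k; apply/forallP=> l; apply/implyP; rewrite !ffunE.
case: l => l /= ln; elim: l ln => [|l IH] ln; first by rewrite leqn0 => /eqP->; apply: le_refl.
rewrite leq_eqVlt => /orP[/eqP->|]; first exact: le_refl.
rewrite ltnS => kl; apply: le_trans (hl l _); last by rewrite -ltnS.
by apply: IH => //; apply: ltnW.
Qed.

Lemma flag_thru x y : le x y ->
  exists f, [/\ is_flag f, fn f (rk x) = x & fn f (rk y) = y].
Proof.
move=> lxy.
case: (hP) => _ [_ [_ [[m [rm lem]] [[M [rM leM]] _]]]].
have [h1 [h1m h1x h1r h1l]] := chain_ex (lem x).
have [h2 [h2x h2y h2r h2l]] := chain_ex lxy.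
have [h3 [h3y h3M h3r h3l]] := chain_ex (leM y).
have rxy := le_rk lxy.
(* Saturated chains from the bottom to x, from x to y and from y to the top are glued along the
   rank. *)
pose h k := if k <= rk x then h1 k else if k <= rk y then h2 k else h3 k.
have [k kn|k kn|f ff fh] := @flag_intro h.
- rewrite /h; case: leqP => kx; first by apply: h1r; rewrite rm kx.
  case: leqP => ky; first by apply: h2r; rewrite ky ltnW.
  by apply: h3r; rewrite rM kn ltnW.
- rewrite /h; case: (ltngtP k (rk x)) => kx.
  + by apply: h1l; rewrite rm kx.
  + case: (ltngtP k (rk y)) => ky.
    * by apply: h2l; rewrite ky ltnW.
    * by apply: h3l; rewrite rM kn ltnW.
    by rewrite ky h2y -{1}h3y; apply: h3l; rewrite rM leqnn -ky kn.
  rewrite kx h1x; case: ltnP => ky; first by rewrite -{1}h2x; apply: h2l; rewrite leqnn.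
  have exy : rk x = rk y by apply/eqP; rewrite eqn_leq rxy ky.
  rewrite (le_rk_eq lxy exy) -{1}h3y; apply: h3l.
  by rewrite leqnn rM -exy -kx.
exists f; split=> //; first by rewrite fh ?rk_le // /h leqnn.
rewrite fh ?rk_le // /h leqnn; case: leqP => // yx.
have exy : rk x = rk y by apply/eqP; rewrite eqn_leq rxy yx.
by rewrite -exy h1x (le_rk_eq lxy exy).
Qed.

Lemma flag_set f (k : 'I_n) z : is_flag f -> rk z = k.+1 ->
  le (fn f k) z -> le z (fn f k.+2) -> is_flag [ffun l => if l == idx k then z else f l].
Proof.
move=> ff rz kz zk.
have [l ln|l ln|g gf ge] := @flag_intro (fun l => if l == k.+1 then z else fn f l).
- by case: eqP => [->|_] //; apply: fn_rk.
- have [->|l1] := eqVneq l k.+1; first by rewrite gtn_eqF.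
  have [[e]|_] := eqVneq l.+1 k.+1; first by rewrite e.
  by apply: fn_le => //; rewrite leqnSn.
suff -> : [ffun l => if l == idx k then z else f l] = g by [].
apply/ffunP=> l; have ln : l <= n.+1 by rewrite -ltnS.
rewrite ffunE -[g l]fnE (ge l ln) fnE.
by rewrite -val_eqE /= val_idx.
Qed.

Lemma adj_ex i f : is_flag f -> exists g, adjacent (idx i) f g.
Proof.
move=> ff; case: (hP) => _ [_ [_ [_ [_ [_ [_ [_ dia]]]]]]].
have i1 : i <= n.+1 by rewrite ltnW // ltnS ltnW.
have i2 : i.+2 <= n.+1 by rewrite ltnS.
have i3 : i.+1 <= n.+1 by rewrite ltnW.
have lt2 k l : k < l <= n.+1 -> rlt (fn f k) (fn f l).
  move=> /andP[kl ln]; rewrite /rlt fn_le ?(ltnW kl) //=.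
  apply/eqP=> /(congr1 rk); rewrite !fn_rk // ?(leq_trans (ltnW kl)) // => e.
  by rewrite e ltnn in kl.
have := dia (fn f i) (fn f i.+2).
have i02 : i < i.+2 <= n.+1 by rewrite i2 andbT ltnW.
have i01 : i < i.+1 <= n.+1 by rewrite i3 andbT.
have i12 : i.+1 < i.+2 <= n.+1 by rewrite i2 andbT.
rewrite !fn_rk // lt2 // => /(_ isT erefl).
set A := [set z | _] => cA.
have fA : fn f i.+1 \in A by rewrite inE !lt2.
have : 0 < #|A :\ fn f i.+1| by move: cA; rewrite (cardsD1 (fn f i.+1)) fA add1n => -[->].
case/card_gt0P=> z; rewrite !inE => /and3P[zn iz zi].
have rz : rk z = i.+1.
  have := rlt_rk iz; have := rlt_rk zi; rewrite !fn_rk // ltnS => a b.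
  by apply/eqP; rewrite eqn_leq a b.
have gf := flag_set ff rz (proj1 (andP iz)) (proj1 (andP zi)).
exists [ffun l => if l == idx i then z else f l]; apply/and4P; split=> //.
  by rewrite ffunE eqxx eq_sym.
by apply/forallP=> j; apply/implyP=> jn; rewrite ffunE (negPf jn).
Qed.

Lemma adj_uniq i f g h : adjacent (idx i) f g -> adjacent (idx i) f h -> g = h.
Proof.
case/and4P=> ff gf fg /forallP eg /and4P[_ hf fh /forallP eh].
have i1 : i <= n.+1 by rewrite ltnW // ltnS ltnW.
have i2 : i.+2 <= n.+1 by rewrite ltnS.
have i3 : i.+1 <= n.+1 by rewrite ltnW.
have e k (g' : flag) : (forall j : 'I_n.+2, (j != idx i) ==> (f j == g' j)) ->
    k <= n.+1 -> k != i.+1 -> fn g' k = fn f k.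
  move=> H kn ki; apply/esym/eqP; apply: (implyP (H (inord k))).
  by rewrite -val_eqE /= val_idx inordK.
case: (hP) => _ [_ [_ [_ [_ [_ [_ [_ dia]]]]]]].
have lt2 (g' : flag) k l : is_flag g' -> k < l <= n.+1 -> rlt (fn g' k) (fn g' l).
  move=> gf' /andP[kl ln]; rewrite /rlt fn_le ?(ltnW kl) //=.
  apply/eqP=> /(congr1 rk); rewrite !fn_rk // ?(leq_trans (ltnW kl)) // => e'.
  by rewrite e' ltnn in kl.
have := dia (fn f i) (fn f i.+2).
have i02 : i < i.+2 <= n.+1 by rewrite i2 andbT ltnW.
have i01 : i < i.+1 <= n.+1 by rewrite i3 andbT.
have i12 : i.+1 < i.+2 <= n.+1 by rewrite i2 andbT.
rewrite !fn_rk // lt2 // => /(_ isT erefl).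
set A := [set z | _] => cA.
have inA (g' : flag) : is_flag g' -> (forall j : 'I_n.+2, (j != idx i) ==> (f j == g' j)) ->
    fn g' i.+1 \in A.
  move=> gf' H; have ei : fn f i = fn g' i by rewrite (e i g') // ltn_eqF.
  have ei2 : fn f i.+2 = fn g' i.+2 by rewrite (e i.+2 g') // gtn_eqF.
  by rewrite inE ei ei2 !lt2.
have fA : fn f i.+1 \in A by apply: inA => // ; apply/forallP; apply/forallP=> j; apply/implyP.
have gA := inA g gf eg; have hA := inA h hf eh.
have c1 : #|A :\ fn f i.+1| = 1 by move: cA; rewrite (cardsD1 (fn f i.+1)) fA add1n => -[->].
have gh : fn g i.+1 = fn h i.+1.
  have /cards1P[z ez] : #|A :\ fn f i.+1| == 1 by rewrite c1.
  have : fn g i.+1 \in A :\ fn f i.+1 by rewrite in_setD1 gA andbT -!idx_fn eq_sym.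
  have : fn h i.+1 \in A :\ fn f i.+1 by rewrite in_setD1 hA andbT -!idx_fn eq_sym.
  by rewrite ez !inE => /eqP-> /eqP->.
apply/ffunP=> j; have [->|jn] := eqVneq j (idx i); first by rewrite !idx_fn.
have /eqP<- := implyP (eg j) jn; exact/eqP/(implyP (eh j) jn).
Qed.

Lemma adjP i f : is_flag f -> adjacent (idx i) f (adj i f).
Proof.
move=> ff; rewrite /adj; case: pickP => [g //|H].
by have [g] := adj_ex i ff; rewrite H.
Qed.

Lemma adj_eq i f g : adjacent (idx i) f g -> adj i f = g.
Proof. by move=> fg; apply: adj_uniq (fg); apply: adjP; case/and4P: fg. Qed.

Lemma adj_flag i f : is_flag f -> is_flag (adj i f).
Proof. by move=> ff; have /and4P[] := adjP i ff. Qed.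

Lemma adjw_flag w f : is_flag f -> is_flag (adjw w f).
Proof. by elim: w f => //= i w IH f ff; apply: IH; apply: adj_flag. Qed.

Lemma adjK i f : is_flag f -> adj i (adj i f) = f.
Proof. by move=> ff; apply: adj_eq; rewrite adjacent_sym; apply: adjP. Qed.

Lemma adj_out i f k : is_flag f -> k != idx i -> adj i f k = f k.
Proof.
by move=> ff ki; have /and4P[_ _ _ /forallP/(_ k)/implyP/(_ ki)/eqP] := adjP i ff.
Qed.

Lemma adj_neq i f : is_flag f -> adj i f (idx i) != f (idx i).
Proof. by move=> ff; have /and4P[_ _ H _] := adjP i ff; rewrite eq_sym. Qed.

Lemma adjw_out w f k : is_flag f -> (forall i, i \in w -> k != idx i) ->
  adjw w f k = f k.
Proof.
elim: w f => //= i w IH f ff H; rewrite IH ?adj_flag //.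
  by apply: adj_out => //; apply: H; rewrite mem_head.
by move=> j jw; apply: H; rewrite inE jw orbT.
Qed.

Lemma adjw_rev w f : is_flag f -> adjw (rev w) (adjw w f) = f.
Proof.
elim: w f => //= i w IH f ff; rewrite rev_cons -cats1 adjw_cat IH ?adj_flag //=.
exact: adjK.
Qed.

(** The new face of rank i only has to fit between faces of ranks i-1 and i+1, and these are not
    changed by the adjacency j. *)
Lemma adj_comm i j f : is_flag f -> i.+1 < j -> adj i (adj j f) = adj j (adj i f).
Proof.
move=> ff ij; pose g := adj j f.
have gf : is_flag g by apply: adj_flag.
have idij : idx i != idx j by rewrite -val_eqE /= !val_idx eqSS ltn_eqF // ltnW.
have g_fn k : k <= n.+1 -> k != j.+1 -> fn g k = fn f k.
  by move=> kn kj; apply: adj_out => //; rewrite -val_eqE /= val_idx inordK.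
have f'f : is_flag (adj i f) by apply: adj_flag.
have f'_fn k : k <= n.+1 -> k != i.+1 -> fn (adj i f) k = fn f k.
  by move=> kn kj; apply: adj_out => //; rewrite -val_eqE /= val_idx inordK.
have i1 : i <= n.+1 by rewrite ltnW // ltnS ltnW.
have i2 : i.+2 <= n.+1 by rewrite ltnS.
have i3 : i.+1 <= n.+1 by rewrite ltnW.
pose z := adj i f (idx i); pose h := [ffun l => if l == idx i then z else g l].
have hf : is_flag h.
  apply: flag_set => //; first by rewrite flag_rk ?val_idx.
    rewrite g_fn //; last by rewrite ltn_eqF // ltnS ltnW // ltnW.
    rewrite -[fn f i]f'_fn ?ltn_eqF // /z idx_fn; apply: fn_le => //.
    by rewrite leqnSn.
  rewrite g_fn //; last by rewrite ltn_eqF.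
  rewrite -[fn f _]f'_fn ?gtn_eqF // /z idx_fn; apply: fn_le => //.
  by rewrite leqnSn.
have gh : adjacent (idx i) g h.
  apply/and4P; split=> //; first by rewrite ffunE eqxx /z eq_sym (adj_out _ idij) // adj_neq.
  by apply/forallP=> k; apply/implyP=> ki; rewrite ffunE (negPf ki).
have f'h : adjacent (idx j) (adj i f) h.
  apply/and4P; split=> //.
    have idji : idx j != idx i by rewrite eq_sym.
    by rewrite ffunE (negPf idji) (adj_out ff idji) eq_sym; apply: adj_neq.
  apply/forallP=> k; apply/implyP=> kj; rewrite ffunE; have [->//|ki] := eqVneq k (idx i).
  by rewrite !adj_out.
by rewrite (adj_eq gh) (adj_eq f'h).
Qed.

Lemma adjacent_idx (k : 'I_n.+2) f g : adjacent k f g -> exists i, k = idx i.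
Proof.
case/and4P=> ff gf fg _.
have [k0|k0] := posnP k.
  case/eqP: fg; apply: le_rk_eq; last by rewrite !flag_rk.
  by apply: rk0_le; rewrite flag_rk.
have [kn|kn] := leqP n.+1 k.
  have ek : nat_of_ord k = n.+1 by apply/eqP; rewrite eqn_leq kn -ltnS ltn_ord.
  case/eqP: fg; apply: le_rk_eq; last by rewrite !flag_rk.
  by apply: rkn_le; rewrite flag_rk.
have kn' : k.-1 < n by rewrite -ltnS prednK.
by exists (Ordinal kn'); apply: ord_inj; rewrite val_idx /= prednK.
Qed.

(** Strong flag-connectivity turned into words. The restriction on the letters holds because every
    flag of the connecting path keeps the common faces; it is what makes faces recoverable from
    words later. *)
Lemma flag_conn f g : is_flag f -> is_flag g ->
  exists2 w, adjw w f = g & forall i, i \in w -> f (idx i) != g (idx i).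
Proof.
move=> ff gf.
case: (hP) => _ [_ [_ [_ [_ [_ [_ [conn _]]]]]]].
have [s [ps ls /allP al]] := conn f g ff gf.
have : forall h, is_flag h -> (forall k, f k = g k -> h k = f k) ->
  path (@some_adjacent P n) h s -> last h s = g ->
  exists2 w, adjw w h = g & forall i, i \in w -> f (idx i) != g (idx i).
  elim: s al {ps ls} => [|h' s IH] al h hf hk /=; first by move=> _ ->; exists [::].
  case/andP=> /existsP[k hh'] ps ls.
  have [i ei] := adjacent_idx hh'; rewrite ei in hh'.
  have h'k : forall k, f k = g k -> h' k = f k.
    move=> l /eqP fg; have /forallP/(_ l)/implyP/(_ fg)/eqP // := al h' (mem_head _ _).
  have h'f : is_flag h' by case/and4P: hh'.
  have [|w ew wi] := IH _ h' h'f h'k ps ls; first by move=> u us; apply: al; rewrite inE us orbT.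
  exists (i :: w); first by rewrite /= (adj_eq hh').
  move=> j; rewrite inE => /orP[/eqP->|]; last exact: wi.
  by case/and4P: hh' => _ _ + _; apply: contra => /eqP fg; rewrite hk // h'k.
by apply.
Qed.

End Flags.

Import GroupScope.

(** * Tight pairs of generators *)

(** The rotation group of a tight polyhedron with its standard generators: the last two conditions
    say that <b><c> is a group of order |b||c|. *)
Definition tight_pair (gT : finGroupType) (b c : gT) : Prop :=
  [/\ (b * c) ^+ 2 = 1, <[b]> :&: <[c]> = 1 & commute <[b]> <[c]>].

Lemma coprime_exp1 (gT : finGroupType) (u : gT) m n : coprime m n -> u ^+ m = 1 -> u ^+ n = 1 -> u = 1.
Proof.
move=> cmn /eqP; rewrite -order_dvdn => um /eqP; rewrite -order_dvdn => un.
apply/eqP; rewrite -order_eq1 -dvdn1 -(eqP (_ : coprime m n)) //.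
by rewrite dvdn_gcd um.
Qed.

Section TightPair.
Variable gT : finGroupType.
Implicit Types b c x y u : gT.

Lemma sqr1_inv x : x ^+ 2 = 1 -> x^-1 = x.
Proof. by move=> x2; apply: (mulgI x); rewrite mulgV -expg2 x2. Qed.

Lemma tight_pair_sym b c : tight_pair b c -> tight_pair c b.
Proof.
case=> bc2 tI cm; split; last by [].
  by rewrite -[c * b](mulKg b) [b * (c * b)]mulgA -conjgE -conjXg bc2 conj1g.
by rewrite setIC.
Qed.

Lemma tight_joinE b c : tight_pair b c -> <[b]> <*> <[c]> = <[b]> * <[c]>.
Proof. by case=> _ _ /comm_joingE. Qed.

Lemma tight_card b c : tight_pair b c -> #|<[b]> <*> <[c]>| = (#[b] * #[c])%N.
Proof. by move=> tp; rewrite tight_joinE //; case: tp => _ tI _; rewrite TI_cardMg. Qed.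

Lemma order_prime_sub (H : {group gT}) : H :!=: 1 ->
  exists2 x, x \in H & prime #[x].
Proof.
move=> ntH; have /pdivP[p p_pr pH]: 1 < #|H| by rewrite cardG_gt1.
by have [x xH ox] := Cauchy p_pr pH; exists x; rewrite ?ox.
Qed.

Lemma cycle_sub_norm b (H K : {group gT}) : H \subset K -> K \subset <[b]> ->
  'N(K) \subset 'N(H).
Proof.
move=> sHK sKb; apply: char_norms; rewrite sub_cyclic_char //.
exact: cyclicS sKb (cycle_cyclic b).
Qed.

Lemma join_normP b c (H : {group gT}) : H \subset <[b]> -> c \in 'N(H) ->
  <[b]> <*> <[c]> \subset 'N(H).
Proof.
move=> sHb cN; rewrite join_subG !cycle_subG cN andbT.
by rewrite -cycle_subG; apply: sub_abelian_norm => //; apply: cycle_abelian.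
Qed.

(** The intersection of <b> with its conjugate by the involution t = bc is normalized by b and t,
    hence by everything. Were it trivial, <b><b>^t would be so large as to fill the group, and
    writing t itself in this form would put t, hence c, into <b>. *)
Lemma tight_core_le b c : tight_pair b c -> #[c] <= #[b] -> b != 1 ->
  exists x, [/\ x \in <[b]>, prime #[x] & <[b]> <*> <[c]> \subset 'N(<[x]>)].
Proof.
move=> tp leq nb; have [bc2 tI cm] := tp; set t := b * c in bc2.
have tV : t^-1 = t := sqr1_inv bc2.
pose B := <[b]> :&: <[b]> :^ t.
have BN : t \in 'N(B).
  by apply/normP; rewrite /B conjIg -conjsgM -expg2 bc2 conjsg1 setIC.
have BNL : <[b]> <*> <[c]> \subset 'N(B).
  apply: (@join_normP b c [group of <[b]> :&: <[b]> :^ t]); first exact: subsetIl.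
  have -> : c = b^-1 * t by rewrite mulKg.
  rewrite groupM // groupV -cycle_subG.
  by apply: sub_abelian_norm (cycle_abelian b) (subsetIl _ _).
have ntB : B != 1.
  apply/eqP => B1.
  have eLc : #|<[b]> * <[b]> :^ t| = (#[b] * #[b])%N.
    by rewrite TI_cardMg // cardJg.
  have sbL : <[b]> * <[b]> :^ t \subset <[b]> <*> <[c]>.
    rewrite -[<[b]> <*> <[c]>]mulGid mulgSS ?joing_subl //.
    rewrite -(conjGid (_ : t \in <[b]> <*> <[c]>)) ?conjSg ?joing_subl //.
    by rewrite groupM // mem_gen // inE cycle_id ?orbT.
  have eL : <[b]> * <[b]> :^ t = <[b]> <*> <[c]>.
    by apply/eqP; rewrite eqEcard sbL eLc tight_card //= leq_mul2l leq orbT.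
  have : t \in <[b]> * <[b]> :^ t.
    by rewrite eL groupM // mem_gen // inE cycle_id ?orbT.
  case/mulsgP=> x _ xb /imsetP[y yb ->] et.
  (* Here t = x (t y t), so x t y = 1. *)
  have tb : t \in <[b]>.
    suff -> : t = x^-1 * y^-1 by rewrite groupM ?groupV.
    have e1 : x * t * y = 1.
      by apply: (mulIg t); rewrite mul1g [RHS]et conjgE tV !mulgA.
    by apply: (mulIg y); rewrite mulgKV; apply: (mulgI x); rewrite mulgV mulgA.
  have : c \in <[b]> :&: <[c]>.
    by rewrite inE cycle_id andbT -(mulKg b c) groupM // groupV cycle_id.
  rewrite tI => /set1P c1; have : #[b] * #[b] <= #[b] * #[c].
    by rewrite -eLc eL tight_card.
  by rewrite leq_pmul2l ?order_gt0 // c1 order1 leqNgt order_gt1 nb.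
have [x xB px] := @order_prime_sub [group of <[b]> :&: <[b]> :^ t] ntB.
exists x; split=> //; first by case/setIP: xB.
apply: subset_trans BNL _.
apply: (@cycle_sub_norm b <[x]> [group of <[b]> :&: <[b]> :^ t]).
  by rewrite cycle_subG.
exact: subsetIl.
Qed.

Lemma tight_core b c : tight_pair b c -> <[b]> <*> <[c]> != 1 ->
  exists x, [/\ x \in <[b]> \/ x \in <[c]>, prime #[x]
              & <[b]> <*> <[c]> \subset 'N(<[x]>)].
Proof.
move=> tp nt.
have [le|/ltnW le] := leqP #[c] #[b].
  have nb : b != 1.
    apply: contraNneq nt => b1; move: le; rewrite b1 order1 leqNgt order_gt1 negbK.
    by move/eqP->; rewrite cycle1 joing1G.
  by have [x [? ? ?]] := tight_core_le tp le nb; exists x; split; auto.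
have nc : c != 1.
  apply: contraNneq nt => c1; move: le; rewrite c1 order1 leqNgt order_gt1 negbK.
  by move/eqP->; rewrite cycle1 joing1G.
have [x [? ? ?]] := tight_core_le (tight_pair_sym tp) le nc.
by exists x; split; auto; rewrite joingC.
Qed.

(* [b] fixes [U] pointwise, so [c] acts on [U] as the involution [b * c]. *)
Lemma tight_sqr_cent b c x y : tight_pair b c -> x \in <[b]> ->
  <[b]> <*> <[c]> \subset 'N(<[x]>) -> y \in <[c]> -> commute x (y ^+ 2).
Proof.
case=> bc2 _ _ xb nL /cycleP[i ->]; rewrite -expgM mulnC expgM; apply: commuteX.
have t2 : (b * c) * (b * c) = 1 by rewrite -expg2.
have xt : x ^ (b * c) \in <[b]>.
  apply: (subsetP (_ : <[x]> \subset _)); first by rewrite cycle_subG.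
  by rewrite memJ_norm ?cycle_id // (subsetP nL) // groupM // mem_gen // inE
             cycle_id ?orbT.
have cb u : u \in <[b]> -> u ^ b = u.
  move=> ux; apply/conjg_fixP/commgP.
  exact: (centsP (cycle_abelian b)) ux _ (cycle_id b).
have xc : x ^ c = x ^ (b * c) by rewrite conjgM cb.
have: x ^ (c ^+ 2) = x.
  by rewrite expg2 conjgM xc -{1}(cb _ xt) -conjgM -conjgM mulgA -mulgA t2 conjg1.
by move/conjg_fixP/commgP.
Qed.

Lemma odd_sqr y : odd #[y] -> (y ^+ (#[y].+1)./2) ^+ 2 = y.
Proof.
move=> oy; rewrite -expgM muln2 -[(_./2).*2]/(0 + _)%N.
have -> : 0%N = odd (#[y].+1) by rewrite /= oy.
by rewrite odd_double_half expgS expg_order mulg1.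
Qed.

Lemma tight_quo b c (U : {group gT}) : tight_pair b c -> U \subset <[b]> ->
  <[b]> <*> <[c]> \subset 'N(U) ->
  tight_pair (coset U b) (coset U c) /\
  <[coset U b]> <*> <[coset U c]> = (<[b]> <*> <[c]>) / U.
Proof.
case=> bc2 tI cm sUb; rewrite join_subG !cycle_subG => /andP[bN cN].
rewrite -!quotient_cycle //; split; last by rewrite quotientY ?cycle_subG.
split; first by rewrite -morphM // -morphX ?groupM // bc2 morph1.
  by rewrite -quotient_cycle // -quotient_cycle // -quotientGI // tI quotient1.
rewrite /commute -!quotient_cycle //.
by rewrite -quotientMl ?cycle_subG // cm quotientMl ?cycle_subG.
Qed.

(** Lifts a normal subgroup of order s from the quotient by <x>. A generator chosen of order s is a
    square, so it commutes with x by [tight_sqr_cent]; then <x> and <y> commute and have coprime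
    orders, so <y> is characteristic in their product. *)
Lemma tight_odd_prime_step b c x s : tight_pair b c -> x \in <[b]> -> prime #[x] ->
  <[b]> <*> <[c]> \subset 'N(<[x]>) -> prime s -> odd s -> s != #[x] ->
  forall z, (z \in <[coset <[x]> b]> \/ z \in <[coset <[x]> c]>) -> #[z] = s ->
  (<[b]> <*> <[c]>) / <[x]> \subset 'N(<[z]>) ->
  exists y, [/\ y \in <[b]> \/ y \in <[c]>, #[y] = s
              & <[b]> <*> <[c]> \subset 'N(<[y]>)].
Proof.
move=> tp xb px nL ps os nsx z zbc oz nz; set U := <[x]> in nL *.
have nbc: (b \in 'N(U)) /\ (c \in 'N(U)).
  by move: nL; rewrite join_subG !cycle_subG => /andP[].
have [bN cN] := nbc.
have cop : coprime #[x] s by rewrite prime_coprime // dvdn_prime2 // eq_sym.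
have [y' y'N [y'bc ez]] : exists2 y', y' \in 'N(U) &
    (y' \in <[b]> \/ y' \in <[c]>) /\ z = coset U y'.
  case: zbc => /cycleP[i ->].
    exists (b ^+ i); first by rewrite groupX.
    by rewrite morphX //; split => //; left; rewrite mem_cycle.
  exists (c ^+ i); first by rewrite groupX.
  by rewrite morphX //; split => //; right; rewrite mem_cycle.
pose y := y' ^+ #[x].
have ybc : y \in <[b]> \/ y \in <[c]> by case: y'bc => ?; [left|right]; rewrite groupX.
have yN : y \in 'N(U) by rewrite groupX.
have zs : coset U y = z ^+ #[x] by rewrite ez morphX.
have ys : y ^+ s = 1.
  rewrite /y -expgM mulnC expgM.
  have : y' ^+ s \in U.
    by apply: coset_idr; rewrite ?groupX // morphX //= -ez -oz expg_order.
  by case/cycleP=> i ->; rewrite -expgM mulnC expgM expg_order expg1n.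
have yn1 : y != 1.
  apply: contraTneq ps => y1; move: zs; rewrite y1 morph1 => /esym zx.
  have z1 : z = 1 by apply: (coprime_exp1 cop zx); rewrite -oz expg_order.
  by rewrite -oz z1 order1.
have oy : #[y] = s.
  have : #[y] %| s by rewrite order_dvdn ys.
  by case/primeP: ps => _ H /H/orP[|/eqP //]; rewrite order_eq1 (negPf yn1).
have cxy : commute x y.
  case: ybc => [yb|yc]; first exact: (centsP (cycle_abelian b)).
  rewrite -[y]odd_sqr ?oy //; apply: (tight_sqr_cent tp) => //.
  by rewrite groupX.
have gz : <[z]> = <[coset U y]>.
  rewrite zs; apply/eqP; rewrite eq_sym eqEcard cycle_subG mem_cycle /=.
  rewrite -[#|<[z]>|]/#[z] -[#|_|]/#[z ^+ #[x]] orderXgcd oz gcdnC.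
  by rewrite (eqP cop) divn1.
exists y; split=> //; apply/subsetP=> l lL; rewrite inE -cycleJ cycle_subG.
have lN := subsetP nL l lL.
have : coset U (y ^ l) \in <[z]>.
  rewrite morphJ // memJ_norm ?gz ?cycle_id // -gz.
  by rewrite (subsetP nz) // mem_quotient.
rewrite gz => /cycleP[i]; rewrite -morphX // => e.
(* The error term u lies in <x> and commutes with y, so its order divides both |x| and s. *)
have [u ux yl] : exists2 u, u \in U & y ^ l = u * y ^+ i.
  exists (y ^ l * (y ^+ i)^-1); last by rewrite mulgKV.
  apply: coset_idr; first by rewrite groupM ?groupV ?groupX ?groupJ.
  by rewrite morphM ?groupV ?groupX ?groupJ // morphV ?groupX //= e mulgV.
have cuy : commute u (y ^+ i).
  by case/cycleP: ux => k ->; apply: commuteX2.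
have us : u ^+ s = 1.
  have := congr1 (fun v => v ^+ s) yl; rewrite -conjXg ys conj1g expgMn //.
  by rewrite -expgM mulnC expgM ys expg1n mulg1.
have ux1 : u ^+ #[x] = 1.
  by case/cycleP: ux => k ->; rewrite -expgM mulnC expgM expg_order expg1n.
by rewrite yl (coprime_exp1 cop ux1 us) mul1g mem_cycle.
Qed.

End TightPair.

(** Induction on the order: [tight_core] provides a normal subgroup of prime order in <b> or <c>,
    and the quotient by it is again a tight pair. The predicate ranges over all group types because
    the quotient changes the type. *)
Lemma tight_ind (P : forall gT : finGroupType, gT -> gT -> Prop) :
  (forall (gT : finGroupType) (b c : gT), P gT c b -> P gT b c) ->
  (forall (gT : finGroupType) (b c : gT), tight_pair b c -> <[b]> <*> <[c]> = 1 -> P gT b c) ->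
  (forall (gT : finGroupType) (b c x : gT), tight_pair b c -> x \in <[b]> -> prime #[x] ->
     <[b]> <*> <[c]> \subset 'N(<[x]>) ->
     P _ (coset <[x]> b) (coset <[x]> c) -> P gT b c) ->
  forall (gT : finGroupType) (b c : gT), tight_pair b c -> P gT b c.
Proof.
move=> Psym P1 Pstep gT b c.
have [n] := ubnP #|<[b]> <*> <[c]>|; elim: n gT b c => // n IH gT b c; rewrite ltnS.
move=> len tp; have [/eqP e1|nt] := boolP (<[b]> <*> <[c]> == 1); first exact: P1.
have step (b' c' x : gT) : tight_pair b' c' -> x \in <[b']> -> prime #[x] ->
     <[b']> <*> <[c']> \subset 'N(<[x]>) -> #|<[b']> <*> <[c']>| <= n -> P gT b' c'.
  move=> tp' xb px nL len'; have sxb : <[x]> \subset <[b']> by rewrite cycle_subG.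
  have [tpq eq] := tight_quo tp' sxb nL.
  apply: (Pstep _ _ _ x) => //; apply: IH => //; rewrite eq.
  apply: leq_trans len'; rewrite ltn_quotient // ?(subset_trans sxb) ?joing_subl //.
  by rewrite cycle_eq1 -order_gt1 prime_gt1.
have [x [[xb|xc] px nL]] := tight_core tp nt; first exact: (step b c x).
by apply/Psym/(step c b x) => //; rewrite 1?joingC //; apply: tight_pair_sym.
Qed.

(** By [tight_ind]: either s is the order of the subgroup factored out, or s still divides the order
    of the quotient and [tight_odd_prime_step] lifts. *)
Lemma tight_odd_prime (gT : finGroupType) (b c : gT) s : tight_pair b c ->
  prime s -> odd s -> s %| #|<[b]> <*> <[c]>| ->
  exists y, [/\ y \in <[b]> \/ y \in <[c]>, #[y] = s
              & <[b]> <*> <[c]> \subset 'N(<[y]>)].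
Proof.
move=> tp ps os; move: tp.
apply: (@tight_ind (fun gT b c => s %| #|<[b]> <*> <[c]>| ->
  exists y : gT, [/\ y \in <[b]> \/ y \in <[c]>, #[y] = s
              & <[b]> <*> <[c]> \subset 'N(<[y]>)])) => {gT b c} [gT b c IH|gT b c tp ->|gT b c x tp xb px nL IH].
- by rewrite joingC => /IH[y [ybc oy nL]]; exists y; split=> //; case: ybc; auto.
- by rewrite cards1 dvdn1 => /eqP s1; rewrite s1 in ps.
move=> sL; have sxb : <[x]> \subset <[b]> by rewrite cycle_subG.
have [esx|nsx] := eqVneq s #[x]; first by exists x; split; auto.
have [tpq eq] := tight_quo tp sxb nL.
case: IH => [|z [zbc oz nz]].
  have : s %| #|<[x]>| * #|<[b]> <*> <[c]> : <[x]>|.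
    by rewrite Lagrange // (subset_trans sxb) ?joing_subl.
  rewrite eq card_quotient //= Gauss_dvdr //.
  by rewrite prime_coprime // dvdn_prime2.
by apply: (tight_odd_prime_step tp xb px nL ps os nsx zbc oz); rewrite -eq.
Qed.

(* [x] acts on a chain of normal subgroups of prime order, trivially on each factor. *)
Lemma tight_sqr_cent_odd (gT : finGroupType) (b c : gT) : tight_pair b c ->
  forall (M : {group gT}) y, M <| <[b]> <*> <[c]> -> odd #|M| ->
  y \in <[b]> \/ y \in <[c]> -> (y ^+ 2) ^+ 2 = 1 -> y ^+ 2 \in 'C(M).
Proof.
apply: (@tight_ind (fun gT b c => forall (M : {group gT}) y,
  M <| <[b]> <*> <[c]> -> odd #|M| ->
  y \in <[b]> \/ y \in <[c]> -> (y ^+ 2) ^+ 2 = 1 -> y ^+ 2 \in 'C(M)))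
  => {gT b c} [gT b c IH|gT b c tp L1|gT b c x tp xb px nL IH] M y nM oM ybc y4.
- by apply: IH; rewrite 1?joingC //; case: ybc; auto.
- suff -> : y = 1 by rewrite expg1n group1.
  apply/set1gP; rewrite -L1.
  by case: ybc => yb; rewrite mem_gen // inE yb ?orbT.
have sxb : <[x]> \subset <[b]> by rewrite cycle_subG.
have [tpq eq] := tight_quo tp sxb nL.
set U := <[x]> in nL IH tpq eq sxb.
have yL : y \in <[b]> <*> <[c]> by case: ybc => yb; rewrite mem_gen // inE yb ?orbT.
have yN : y \in 'N(U) by apply: (subsetP nL).
have bN : b \in 'N(U) by move: nL; rewrite join_subG !cycle_subG => /andP[].
have cN : c \in 'N(U) by move: nL; rewrite join_subG !cycle_subG => /andP[].
have sML := normal_sub nM.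
have : coset U y ^+ 2 \in 'C(M / U).
  apply: IH.
  - by rewrite eq quotient_normal.
  - by rewrite (dvdn_odd _ oM) // dvdn_quotient.
  - by rewrite -!quotient_cycle //; case: ybc => ?; [left|right]; rewrite mem_quotient.
  by rewrite -!morphX ?groupX //= y4 morph1.
rewrite -morphX //= => cy.
have cxy : commute x (y ^+ 2).
  case: ybc => [yb|yc]; last exact: (tight_sqr_cent tp).
  by apply: (centsP (cycle_abelian b)) => //; rewrite groupX.
apply/centP=> m mM; apply/commgP/eqP; set z := y ^+ 2 in cxy cy y4 *.
have zL : z \in <[b]> <*> <[c]> by rewrite groupX.
have zN : z \in 'N(U) by rewrite groupX.
have mN : m \in 'N(U) by rewrite (subsetP nL) // (subsetP sML).
have zmU : [~ z, m] \in U.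
  apply: coset_idr; first by rewrite groupR.
  rewrite morphR //; apply/eqP/commgP.
  by apply: (centP cy); rewrite mem_quotient.
have zmM : [~ z, m] \in M.
  rewrite commgEr groupM // memJ_norm ?groupV //.
  by rewrite (subsetP (normal_norm nM)).
have zu : z ^ [~ z, m] = z.
  apply/conjg_fixP/commgP; case/cycleP: zmU => k ->.
  by apply: commuteX; apply: commute_sym.
have u2 : [~ z, m] ^+ 2 = 1.
  set u := [~ z, m] in zu *.
  have zm : z ^ m = z * u by rewrite conjg_mulR.
  have := congr1 (fun v => v ^+ 2) zm; rewrite -conjXg y4 conj1g expgMn ?y4 ?mul1g //.
  by apply/commgP/conjg_fixP.
have := order_dvdG zmM; move/dvdn_odd => /(_ oM) ou.
apply/eqP; rewrite -order_eq1; have : #[[~ z, m]] %| 2 by rewrite order_dvdn u2.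
by case/primeP: (isT : prime 2) => _ H /H/orP[//|/eqP e]; rewrite e in ou.
Qed.

(** Pull back the normal Sylow subgroup of the quotient by <x>. If |x| = s the preimage is already
    Sylow; if |x| = 2, a Sylow s-subgroup has index 2 in the preimage, so it is characteristic
    there. *)
Lemma tight_normal_Sylow (gT : finGroupType) (b c : gT) s : tight_pair b c ->
  prime s -> odd s -> [pred p | (p == 2) || (p == s)].-group (<[b]> <*> <[c]>) ->
  exists2 M : {group gT}, M <| <[b]> <*> <[c]> & s.-Sylow(<[b]> <*> <[c]>) M.
Proof.
move=> tp ps os; move: tp.
pose pi := [pred p | (p == 2) || (p == s)].
apply: (@tight_ind (fun gT b c => pi.-group (<[b]> <*> <[c]>) ->
  exists2 M : {group gT}, M <| <[b]> <*> <[c]> & s.-Sylow(<[b]> <*> <[c]>) M))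
  => {gT b c} [gT b c IH|gT b c tp L1|gT b c x tp xb px nL IH] piL.
- by rewrite joingC; apply: IH; rewrite joingC.
- exists 1%G; first by rewrite L1.
  by rewrite L1 pHallE sub1G cards1 partn1.
have sxb : <[x]> \subset <[b]> by rewrite cycle_subG.
have [tpq eq] := tight_quo tp sxb nL.
set U := <[x]> in nL IH tpq eq sxb; set L := <[b]> <*> <[c]> in piL nL IH eq *.
have sUL : U \subset L by rewrite (subset_trans sxb) ?joing_subl.
have nUL : U <| L by rewrite /normal sUL.
case: IH => [|Mq nMq sylMq]; first by rewrite eq quotient_pgroup.
rewrite eq in nMq sylMq.
have [M eM sUM nML] := inv_quotientN nUL nMq.
have cardL : #|L| = (#[x] * #|L / U|)%N.
  by rewrite card_quotient // -(Lagrange sUL).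
have cardM : #|M| = (#[x] * #|Mq|)%N.
  rewrite eM card_quotient ?(subset_trans (normal_sub nML)) //.
  by rewrite -(Lagrange sUM).
have [esx|nsx] := eqVneq s #[x].
  exists M => //; rewrite -(@pquotient_pHall s _ L M <[x]>%G) -?eM //.
    by rewrite /pgroup -[#|_|]/#[x] -esx pnat_id.
  exact: normalS sUM (normal_sub nML) nUL.
have ox : #[x] = 2.
  have : #[x] \in pi.
    have := pgroupP piL _ px; apply; rewrite cardL dvdn_mulr //.
  by rewrite inE eq_sym [_ == s]eq_sym (negPf nsx) orbF => /eqP.
have [Ps sylP] := Sylow_exists s M.
have s2 : partn 2 s = 1%N.
  by rewrite part_p'nat // pnatE // !inE; apply: contraTneq os => <-.
have cMq : #|Mq| = partn #|L / U| s := card_Hall sylMq.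
have cP : #|Ps| = #|Mq|.
  rewrite (card_Hall sylP) cardM ox partnM ?cardG_gt0 // s2 mul1n.
  by rewrite part_pnat_id // cMq part_pnat.
have nPM : Ps <| M.
  apply: index2_normal (pHall_sub sylP) _.
  by rewrite -divgS ?(pHall_sub sylP) // cP cardM ox mulnK ?cardG_gt0.
have chP : Ps \char M by rewrite -(normal_Hall_pcore sylP nPM) pcore_char.
exists Ps; first exact: char_normal_trans chP nML.
rewrite pHallE (subset_trans (pHall_sub sylP)) ?normal_sub //= cP cMq.
by rewrite cardL ox partnM ?cardG_gt0 // s2 mul1n.
Qed.

(** * Mirror images of group words *)

(* A letter [(i, e)] stands for the first ([i = true]) or second generator,
   inverted when [e = true]. *)
Definition letter_val (gT : finGroupType) (a b : gT) (l : bool * bool) : gT :=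
  let x := if l.1 then a else b in if l.2 then x^-1 else x.

Definition ev (gT : finGroupType) (a b : gT) (w : seq (bool * bool)) : gT :=
  foldr (fun l x => letter_val a b l * x) 1 w.

(* For a rotation group with generators [a], [b], conjugation by a reflection would
   invert both; [reg a b N] says that this is well defined modulo [N]. *)
Definition reg (gT : finGroupType) (a b : gT) (N : {set gT}) : Prop :=
  forall w, ev a b w \in N -> ev a^-1 b^-1 w \in N.

Section Words.
Variable gT : finGroupType.
Implicit Types (a b x : gT) (N : {group gT}).

Lemma ev_cat a b w w' : ev a b (w ++ w') = ev a b w * ev a b w'.
Proof. by elim: w => [|l w IH] /=; rewrite ?mul1g // IH mulgA. Qed.

Lemma ev_nseq a b l i : ev a b (nseq i l) = letter_val a b l ^+ i.
Proof. by elim: i => //= i ->; rewrite expgS. Qed.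

Lemma letter_mem a b l : letter_val a b l \in <[a]> <*> <[b]>.
Proof.
by case: l => [[] []]; rewrite /letter_val /= ?groupV mem_gen // inE cycle_id ?orbT.
Qed.

Lemma ev_mem a b w : ev a b w \in <[a]> <*> <[b]>.
Proof. by elim: w => [|l w IH] /=; rewrite ?group1 // groupM ?letter_mem. Qed.

Lemma ev_conj a b x w : ev (a ^ x) (b ^ x) w = ev a b w ^ x.
Proof.
elim: w => [|[i e] w IH] /=; first by rewrite conj1g.
by rewrite IH conjMg; congr (_ * _); case: i e => [] []; rewrite /letter_val //= conjVg.
Qed.

Definition word_flip := map (fun l : bool * bool => (~~ l.1, ~~ l.2)).

Lemma ev_flip a b w : ev b^-1 a^-1 (word_flip w) = ev a b w.
Proof.
elim: w => [|[i e] w IH] //=; rewrite IH; congr (_ * _).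
by case: i e => [] []; rewrite /letter_val //= invgK.
Qed.

(** Duality for words: exchanging the generators and inverting them, as happens when the polytope is
    turned upside down. *)
Lemma reg_flip a b (N : {set gT}) : reg b^-1 a^-1 N -> reg a b N.
Proof.
move=> rN w; rewrite -ev_flip => /rN; rewrite !invgK.
by rewrite -[X in ev b X]invgK -[X in ev X _]invgK ev_flip.
Qed.

(** A word with value b^i in N is corrected by the word b^-i to one with value 1, to which
    regularity modulo U applies; the correction itself stays in N after inversion. *)
Lemma reg_mono a b (U N : {group gT}) : U \subset N -> N \subset <[b]> ->
  reg a b U -> reg a b N.
Proof.
move=> sUN sNb rU w wN; have /cycleP[i ei] := subsetP sNb _ wN.
have := rU (w ++ nseq i (false, true)).
rewrite !ev_cat !ev_nseq /letter_val /= invgK ei expgVn mulgV group1 => /(_ isT).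
by move/(subsetP sUN); rewrite groupMr // -ei.
Qed.

Lemma reg_sub1 a b N : N :&: (<[a]> <*> <[b]>) = 1 -> reg a b N -> reg a b 1.
Proof.
move=> tI rN w /set1gP ew; rewrite -tI inE rN ?ew ?group1 //=.
by rewrite -(cycleV a) -(cycleV b) ev_mem.
Qed.

Lemma regI a b (N1 N2 : {group gT}) : N1 :&: N2 = 1 ->
  reg a b N1 -> reg a b N2 -> reg a b 1.
Proof. by move=> tI r1 r2 w /set1gP ew; rewrite -tI inE r1 ?r2 // ew group1. Qed.

Lemma reg_conj a b x : a ^ x = a^-1 -> b ^ x = b^-1 -> reg a b 1.
Proof. by move=> ea eb w /set1gP ew; rewrite -ea -eb ev_conj ew conj1g group1. Qed.

(** With a^2 = 1 the group is dihedral, and conjugation by [a] inverts both generators. *)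
Lemma reg_invol1 a b : (a * b) ^+ 2 = 1 -> a ^+ 2 = 1 -> reg a b 1.
Proof.
move=> /sqr1_inv ab2 /sqr1_inv aV; apply: (@reg_conj _ _ a); rewrite conjgE aV.
  by rewrite -{1}aV mulKg.
by move: ab2; rewrite invMg aV mulgA => <-; rewrite -{2}aV mulgK.
Qed.

Lemma reg_invol2 a b : (a * b) ^+ 2 = 1 -> b ^+ 2 = 1 -> reg a b 1.
Proof.
move=> ab2 b2; apply: reg_flip; apply: reg_invol1.
  by rewrite -invMg expVgn ab2 invg1.
by rewrite expVgn b2 invg1.
Qed.

End Words.

(** * Tight triples *)

(** The rotation group of a tight 4-polytope: the standard relations, the intersection property, and
    tightness as an upper bound on the order. The matching lower bound comes from the trivial
    intersections. *)
Definition tight_triple (gT : finGroupType) (a b c : gT) : Prop :=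
  [/\ (a * b) ^+ 2 = 1, (b * c) ^+ 2 = 1 & (a * b * c) ^+ 2 = 1] /\
  [/\ <[a]> :&: (<[b]> <*> <[c]>) = 1, (<[a]> <*> <[b]>) :&: <[c]> = 1
    & #|<[a]> <*> <[b]> <*> <[c]>| <= #[a] * #[b] * #[c]].

Section TightTriple.
Variable gT : finGroupType.
Implicit Types a b c : gT.

Lemma tight_triple_sym a b c : tight_triple a b c -> tight_triple c^-1 b^-1 a^-1.
Proof.
case=> [[ab2 bc2 abc2] [aL Kc le]]; split.
  by rewrite -!invMg !expVgn mulgA ab2 bc2 abc2 !invg1.
rewrite !cycleV !orderV setIC (joingC <[b]>) Kc setIC (joingC <[c]>) aL; split=> //.
rewrite joingC joingA.
by rewrite mulnC (mulnC #[c]) mulnA.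
Qed.

Variables a b c : gT.
Hypothesis tt : tight_triple a b c.
Let K := <[a]> <*> <[b]>.
Let L := <[b]> <*> <[c]>.
Let G := <[a]> <*> <[b]> <*> <[c]>.

Lemma triple_TIab : <[a]> :&: <[b]> = 1.
Proof.
case: tt => _ [aL _ _]; apply/trivgP; rewrite /= -aL.
by rewrite setIS // joing_subl.
Qed.

Lemma triple_TIbc : <[b]> :&: <[c]> = 1.
Proof.
case: tt => _ [_ Kc _]; apply/trivgP; rewrite /= -Kc.
by rewrite setSI // joing_subr.
Qed.

(** Squeezed: |K||c| is at most the order of the whole group, hence at most |a||b||c|. *)
Lemma triple_cardK : #|K| = (#[a] * #[b])%N.
Proof.
case: tt => _ [_ Kc le]; apply/eqP; rewrite eqn_leq; apply/andP; split.
  rewrite -(leq_pmul2r (order_gt0 c)); apply: leq_trans le.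
  by rewrite -TI_cardMg // subset_leq_card // mulG_subG joing_subl joing_subr.
rewrite -TI_cardMg ?triple_TIab // subset_leq_card //.
by rewrite mulG_subG joing_subl joing_subr.
Qed.

Lemma triple_tpK : tight_pair a b.
Proof.
have [[ab2 _ _] _] := tt; split=> //; first exact: triple_TIab.
have e : <[a]> * <[b]> = K.
  apply/eqP; rewrite eqEcard mulG_subG joing_subl joing_subr /=.
  by rewrite triple_cardK TI_cardMg ?triple_TIab.
by apply/comm_group_setP; rewrite e groupP.
Qed.

Lemma triple_GE : G = K * <[c]>.
Proof.
case: tt => _ [_ Kc le]; apply/esym/eqP; rewrite eqEcard mulG_subG joing_subl.
by rewrite joing_subr /= TI_cardMg // triple_cardK.
Qed.

Lemma triple_card : #|G| = (#[a] * #[b] * #[c])%N.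
Proof. by case: tt => _ [_ Kc le]; rewrite triple_GE TI_cardMg // triple_cardK. Qed.

End TightTriple.

Lemma triple_tpL (gT : finGroupType) (a b c : gT) : tight_triple a b c -> tight_pair b c.
Proof.
move=> tt; have [[_ bc2 _] _] := tt.
have [_ tI cm] := tight_pair_sym (triple_tpK (tight_triple_sym tt)).
by rewrite !cycleV in tI cm; split.
Qed.

(** What atomicity leaves in the group. The subgroups U are those whose quotient is still a tight
    polytope: placed in one cyclic factor, they keep the triple tight, and since they miss the
    generators no rotation collapses. *)
Definition atomic_triple (gT : finGroupType) (a b c : gT) : Prop :=
  [/\ tight_triple a b c, ~ reg a b 1, ~ reg b c 1 &
   forall U : {group gT}, U :!=: 1 -> <[a]> <*> <[b]> <*> <[c]> \subset 'N(U) ->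
     [|| U \subset <[a]>, U \subset <[b]> | U \subset <[c]>] ->
     a \notin U -> b \notin U -> c \notin U -> reg a b U /\ reg b c U].

Lemma atomic_triple_sym (gT : finGroupType) (a b c : gT) :
  atomic_triple a b c -> atomic_triple c^-1 b^-1 a^-1.
Proof.
case=> tt nK nL at_; split; first exact: tight_triple_sym.
- by move/reg_flip.
- by move/reg_flip.
move=> U ntU; rewrite !cycleV !groupV => nU sU cU bU aU.
have [] := at_ U ntU => //.
- by rewrite -joingA joingC [<[b]> <*> _]joingC.
- by case/or3P: sU => ->; rewrite ?orbT.
by move=> r1 r2; split; apply: reg_flip; rewrite !invgK.
Qed.

(** * Normal subgroups contained in one cyclic factor *)

Section Core.
Variable gT : finGroupType.
Implicit Types a b c : gT.

Lemma triple_invA a b c : tight_triple a b c -> a ^ (b * c) = a^-1.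
Proof.
case=> [[_ /sqr1_inv + /sqr1_inv]] + _; rewrite -mulgA; move: (b * c) => t t2.
by rewrite invMg conjgE => <-; rewrite t2 -{1}t2 mulKg.
Qed.

Lemma triple_neq1 a b c : atomic_triple a b c -> [/\ a != 1, b != 1 & c != 1].
Proof.
case=> [[[ab2 bc2 _] _] nK nL _]; split; apply/eqP=> e1.
- by apply: nK; apply: reg_invol1 => //; rewrite e1 expg1n.
- by apply: nK; apply: reg_invol2 => //; rewrite e1 expg1n.
by apply: nL; apply: reg_invol2 => //; rewrite e1 expg1n.
Qed.

(** From (ab)^2 = 1 one gets b^2 = (a a^(b^-1))^-1, which lies in <a> when b normalizes it. *)
Lemma cycle_norm_sqr a b : (a * b) ^+ 2 = 1 -> <[a]> :&: <[b]> = 1 ->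
  b \in 'N(<[a]>) -> b ^+ 2 = 1.
Proof.
move=> ab2 tI bN; apply/set1gP; rewrite -tI inE [_ \in <[b]>]groupX ?cycle_id // andbT.
have -> : b ^+ 2 = (a * a ^ b^-1)^-1.
  apply: (mulgI (a * a ^ b^-1)); rewrite mulgV conjgE invgK expg2 !mulgA mulgKV.
  by rewrite -ab2 expg2 !mulgA.
by rewrite groupV groupM ?cycle_id // memJ_norm ?groupV // cycle_id.
Qed.

(** Since bc inverts a, it normalizes every subgroup of <a>; so N is normal in the whole group. As N
    meets <b, c> trivially, regularity of the pair (b, c) modulo N would be regularity outright. If
    a were in N, b would normalize <a> and b^2 = 1 would make the pair (a, b) regular. *)
Lemma core_a a b c (N : {group gT}) : atomic_triple a b c ->
  N \subset <[a]> -> b \in 'N(N) -> N :=: 1.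
Proof.
move=> at_ sNa bN; apply/eqP/idPn => ntN.
have [tt nK nL at4] := at_; have [a1 b1 c1] := triple_neq1 at_.
have [[ab2 _ _] [aL Kc _]] := tt.
have tN : b * c \in 'N(N).
  apply: (subsetP (cycle_sub_norm sNa (subxx _))).
  by rewrite inE -cycleJ (triple_invA tt) cycleV.
have cN : c \in 'N(N) by rewrite -(mulKg b c) groupM // groupV.
have aN : a \in 'N(N).
  rewrite -cycle_subG; apply: sub_abelian_norm sNa; exact: cycle_abelian.
have NL : N :&: (<[b]> <*> <[c]>) = 1.
  by apply/trivgP; rewrite /= -aL setSI.
have bNn : b \notin N.
  apply: contra b1 => bn; apply/eqP/set1gP; rewrite -NL inE bn /=.
  by rewrite mem_gen // inE cycle_id.
have cNn : c \notin N.
  apply: contra c1 => cn; apply/eqP/set1gP; rewrite -NL inE cn /=.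
  by rewrite mem_gen // inE cycle_id orbT.
have aNn : a \notin N.
  apply/negP=> an; apply: nK; apply: reg_invol2 => //.
  apply: (cycle_norm_sqr ab2 (triple_TIab tt)).
  suff -> : <[a]> = N by [].
  by apply/eqP; rewrite eqEsubset sNa cycle_subG an.
have [||_] := at4 N ntN _ _ aNn bNn cNn.
- by rewrite !join_subG !cycle_subG aN bN.
- by rewrite sNa.
by move=> /(reg_sub1 NL).
Qed.

Lemma core_c a b c (N : {group gT}) : atomic_triple a b c ->
  N \subset <[c]> -> b \in 'N(N) -> N :=: 1.
Proof.
move=> /atomic_triple_sym at_ sNc bN; apply: (core_a at_).
  by rewrite cycleV.
by rewrite groupV.
Qed.

Lemma core_b a b c (U : {group gT}) : atomic_triple a b c -> U :!=: 1 ->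
  U \subset <[b]> -> a \in 'N(U) -> c \in 'N(U) -> reg a b U /\ reg b c U.
Proof.
move=> at_ ntU sUb aN cN.
have [tt nK nL at4] := at_; have [a1 b1 c1] := triple_neq1 at_.
have [[ab2 bc2 _] _] := tt.
apply: at4 => //; last 3 first.
- apply: contra a1 => an; apply/eqP/set1gP; rewrite -(triple_TIab tt) inE cycle_id.
  exact: (subsetP sUb).
- apply/negP=> bn; apply: nL; apply: reg_invol2 => //.
  apply: (cycle_norm_sqr bc2 (triple_TIbc tt)).
  suff -> : <[b]> = U by [].
  by apply/eqP; rewrite eqEsubset sUb cycle_subG bn.
- apply: contra c1 => cn; apply/eqP/set1gP; rewrite -(triple_TIbc tt) inE cycle_id.
  by rewrite andbT; apply: (subsetP sUb).
- rewrite !join_subG !cycle_subG aN cN andbT /= -cycle_subG.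
  apply: sub_abelian_norm sUb; exact: cycle_abelian.
by rewrite sUb orbT.
Qed.

Lemma cycle_order_eq b (x y : gT) : x \in <[b]> -> y \in <[b]> -> #[x] = #[y] ->
  <[x]> = <[y]>.
Proof.
move=> xb yb e; apply/eqP.
have := @eq_subG_cyclic _ <[b]>%G <[x]>%G <[y]>%G (cycle_cyclic b).
by rewrite !cycle_subG xb yb /= => -> //; rewrite -[#|_|]/#[x] e.
Qed.

Lemma order2_norm (x y : gT) : #[x] = 2 -> y \in 'N(<[x]>) -> commute y x.
Proof.
move=> ox yN; apply/commute_sym/commgP/conjg_fixP.
have : x ^ y \in <[x]> by rewrite memJ_norm ?cycle_id.
rewrite cycle2g // !inE => /orP[|/eqP //]; rewrite conjg_eq1 => /eqP x1.
by rewrite x1 order1 in ox.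
Qed.

(** [tight_odd_prime] gives a subgroup of order s normal in <b, c>, and [core_c] keeps it out of
    <c>. So s divides |b|, and dually there is one in <b> normal in <a, b>. Both coincide, as <b> is
    cyclic. *)
Lemma common_odd_prime a b c s : atomic_triple a b c -> prime s -> odd s ->
  s %| #|<[b]> <*> <[c]>| ->
  exists y, [/\ y \in <[b]>, #[y] = s, a \in 'N(<[y]>) & c \in 'N(<[y]>)].
Proof.
move=> at_ ps os sL; have [tt _ _ _] := at_.
have [y [ybc oy]] := tight_odd_prime (triple_tpL tt) ps os sL.
rewrite join_subG !cycle_subG => /andP[bN cN].
case: ybc => [yb|yc]; last first.
  have := @core_c a b c <[y]>%G at_; rewrite cycle_subG => /(_ yc bN) /eqP.
  by rewrite cycle_eq1 -order_eq1 oy; case: eqP ps => // ->.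
exists y; split=> //.
have sK : s %| #|<[a]> <*> <[b]>|.
  rewrite (triple_cardK tt) dvdn_mull // -oy order_dvdG //.
have [x [xab ox]] := tight_odd_prime (triple_tpK tt) ps os sK.
rewrite join_subG !cycle_subG => /andP[aN' bN'].
case: xab => [xa|xb]; last by rewrite -(cycle_order_eq xb yb) ?ox ?oy.
have := @core_a a b c <[x]>%G at_; rewrite cycle_subG => /(_ xa bN') /eqP.
by rewrite cycle_eq1 -order_eq1 ox; case: eqP ps => // ->.
Qed.

End Core.

(** * Involutions acting on elements of odd order *)

Section InvolutionCase.
Variable gT : finGroupType.
Implicit Types a b c x y z g : gT.

(** g^2 centralizes a, and g is a power of g^2. *)
Lemma odd_order_inv_sqr a g : a ^ g = a^-1 -> odd #[g] -> a ^+ 2 = 1.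
Proof.
move=> ag og; have ag2 : commute a (g ^+ 2).
  by apply/commgP/conjg_fixP; rewrite expg2 conjgM ag conjVg ag invgK.
have cag : commute a g.
  by rewrite -(odd_sqr og) -expgM mulnC expgM; apply: commuteX.
have : a ^ g = a by apply/conjg_fixP/commgP.
by rewrite ag expg2 => {1}<-; rewrite mulVg.
Qed.

(** If y^i = y^e then e^2 = 1 modulo a power of s, and the odd prime s cannot divide both e-1 and
    e+1. *)
Lemma invol_pgroup_dichotomy s y i : prime s -> odd s -> s.-elt y -> i ^+ 2 = 1 ->
  y ^ i \in <[y]> -> y ^ i = y \/ y ^ i = y^-1.
Proof.
move=> ps os sy i2 /cyclePmin[e0 _ e0E].
(* A positive exponent keeps the truncated subtraction e - 1 honest. *)
have [e e_gt0 yi] : exists2 e, 0 < e & y ^ i = y ^+ e.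
  exists (e0 + #[y])%N; first by rewrite addn_gt0 order_gt0 orbT.
  by rewrite expgD expg_order mulg1.
have : y ^+ (e * e) = y.
  by rewrite expgM -yi -conjXg -yi -conjgM -expg2 i2 conjg1.
rewrite -[in RHS](expg1 y) => /eqP; rewrite eq_expg_mod_order eqn_mod_dvd; last first.
  by rewrite muln_gt0 e_gt0.
have -> : (e * e - 1 = (e - 1) * (e + 1))%N by rewrite -subn_sqr !mulnn exp1n.
have /p_natP[v ov] : s.-nat #[y] by [].
rewrite ov => dv; have [se|se] := boolP (s %| e + 1); last first.
  left; move: dv; rewrite Gauss_dvdl; last first.
    by rewrite coprimeXl // prime_coprime.
  rewrite -eqn_mod_dvd // -ov -eq_expg_mod_order expg1 yi.
  by move/eqP.
right; move: dv; rewrite Gauss_dvdr; last first.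
  rewrite coprimeXl // prime_coprime //; apply: contraL os => se1.
  have : s %| (e + 1) - (e - 1) by rewrite dvdn_sub.
  have -> : (e + 1 - (e - 1) = 2)%N.
    by case: e e_gt0 {yi se se1} => // e _; rewrite subn1 addn1 -[e.+2]addn2 addKn.
  by rewrite dvdn_prime2 // => /eqP->.
by rewrite -ov order_dvdn addn1 expgSr -yi -eq_invg_mul => /eqP e1;
  rewrite -[LHS]invgK e1.
Qed.

(* The dichotomy comes from the 2-part of the pair modulo the normal 2-complement. *)
Lemma tight_quo_invol b c (M : {group gT}) (x : coset_of M) : tight_pair b c ->
  M <| <[b]> <*> <[c]> -> odd #|M| -> 2.-group ((<[b]> <*> <[c]>) / M) ->
  x \in <[coset M b]> -> #[x] = 2 -> (<[b]> <*> <[c]>) / M \subset 'N(<[x]>) ->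
  (exists z, [/\ z \in <[b]>, #[z] = 2 & commute z c]) \/
  (b ^+ 2 \in M /\ c ^+ 2 \in M).
Proof.
move=> tp nM oM L2 xb ox nx; have nML := normal_norm nM.
have bL : b \in <[b]> <*> <[c]> by rewrite mem_gen // inE cycle_id.
have cL : c \in <[b]> <*> <[c]> by rewrite mem_gen // inE cycle_id orbT.
have bN := subsetP nML _ bL; have cN := subsetP nML _ cL.
have ob : #[coset M b] %| #[b] by rewrite order_dvdn -morphX //= expg_order morph1.
have /p_natP[k ok] : 2.-nat #[coset M b].
  by apply: mem_p_elt L2 _; rewrite mem_quotient.
have xcb : commute x (coset M c).
  by apply/commute_sym/order2_norm => //; apply: (subsetP nx); rewrite mem_quotient.
case: k ok => [|[|k]] ok.
- move: xb ox; rewrite expn0 in ok.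
  by move/eqP: ok; rewrite order_eq1 => /eqP->; rewrite cycle1 => /set1P->; rewrite order1.
- right; rewrite expn1 in ok.
  have b2 : b ^+ 2 \in M.
    by apply: coset_idr; rewrite ?groupX // morphX //= -ok expg_order.
  split=> //.
  have eb : coset M b = x.
    move: xb; rewrite cycle2g // !inE => /orP[/eqP x1|/eqP //].
    by rewrite x1 order1 in ox.
  apply: coset_idr; rewrite ?groupX // morphX //=.
  have [bc2 _ _] := tp; have := congr1 (coset M) bc2.
  rewrite morphX ?groupM // morphM // morph1 /= eb expgMn // -eb -morphX //=.
  by rewrite (coset_id b2) mul1g.
left; have d4 : 4 %| #[b] by apply: dvdn_trans ob; rewrite ok !expnS mulnA dvdn_mulr.
(* z is the square of an element of order 4, so [tight_sqr_cent_odd] applies; then [z, c] lies in M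
   and squares to 1, while |M| is odd. *)
pose y := b ^+ (#[b] %/ 4); have oy : #[y] = 4.
  by rewrite orderXdiv ?dvdn_div // -{1}(divnK d4) mulKn // divn_gt0 // dvdn_leq.
pose z := y ^+ 2; have yb : y \in <[b]> by rewrite mem_cycle.
have zb : z \in <[b]> by rewrite groupX.
have oz : #[z] = 2 by rewrite orderXdiv ?oy.
exists z; split=> //.
have zM : z \in 'C(M).
  apply: (tight_sqr_cent_odd tp) => //; first by left.
  by rewrite -/z -oz expg_order.
have zN : z \in 'N(M) by rewrite groupX ?groupX.
have ex : x = coset M z.
  have zn1 : coset M z != 1.
    apply/eqP=> /(coset_idr zN) /order_dvdG; rewrite oz => /dvdn_odd /(_ oM) //.
  have ocz : #[coset M z] = 2.
    have : #[coset M z] %| 2 by rewrite order_dvdn -morphX //= -oz expg_order morph1.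
    case/primeP: (isT : prime 2) => _ H /H/orP[|/eqP //].
    by rewrite order_eq1 (negPf zn1).
  have zcb : coset M z \in <[coset M b]>.
    by rewrite /z /y -expgM morphX // mem_cycle.
  have := cycle_order_eq xb zcb; rewrite ox ocz => /(_ erefl) e.
  have : coset M z \in <[x]> by rewrite e cycle_id.
  by rewrite cycle2g // !inE (negPf zn1) => /eqP.
rewrite ex in xcb.
have zcM : [~ z, c] \in M.
  by apply: coset_idr; rewrite ?groupR // morphR //; apply/eqP/commgP.
have cz : commute z [~ z, c] by apply: (centP zM).
apply/commgP/eqP.
have z2 : z ^+ 2 = 1 by rewrite -oz expg_order.
have m2 : [~ z, c] ^+ 2 = 1.
  have := congr1 (fun v => v ^+ 2) (conjg_mulR z c).
  by rewrite -conjXg z2 conj1g expgMn // z2 mul1g.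
apply: (@coprime_exp1 _ _ 2 #|M|) => //; first by rewrite coprime2n.
by apply/eqP; rewrite -order_dvdn order_dvdG.
Qed.

End InvolutionCase.

Lemma invol_mul_conjl (gT : finGroupType) (z t : gT) : z ^+ 2 = 1 -> t ^+ 2 = 1 ->
  (z * t) ^ z = (z * t)^-1.
Proof. by move=> /sqr1_inv zV /sqr1_inv tV; rewrite conjgE -mulgA mulKg invMg tV zV. Qed.

Lemma invol_mul_sqr (gT : finGroupType) (z t : gT) : t ^+ 2 = 1 ->
  (z * t) ^+ 2 = z * z ^ t.
Proof. by move=> /sqr1_inv tV; rewrite expg2 conjgE tV !mulgA. Qed.

(** The final contradiction of the involution case, isolated from its setting. Factoring k in <c><b>
    and separating what z inverts from what z centralizes forces i to normalize <y>, and both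
    possible actions of i on y are impossible. *)
Lemma dihedral_factor_absurd (gT : finGroupType) (b c y z k i : gT) s (M : {group gT}) :
  prime s -> odd s -> s.-group M -> y \in M -> k \in M -> i \notin M -> c ^+ 2 \in M ->
  c = y^-1 * (k * i) -> b = z * y -> commute y z -> commute y k -> commute k i ->
  commute i z -> k ^ z = k^-1 -> i ^+ 2 = 1 -> z ^+ 2 = 1 -> k != 1 ->
  <[k]> :&: <[c]> = 1 -> k \in <[c]> * <[b]> ->
  (forall x, x \in <[c]> -> x != 1 -> b \notin 'N(<[x]>)) -> False.
Proof.
move=> ps os sM yM kM iM c2M cE bE cyz cyk cki ciz k_z i2 z2 k1 kc1 kcb ncb.
have elM x : x \in M -> s.-elt x by apply: mem_p_elt sM.
have oddM x : x \in M -> odd #[x].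
  by move/elM/p_natP=> [m ->]; rewrite oddX os orbT.
have sqrk d : d \in <[k]> -> d ^+ 2 = 1 -> d = 1.
  move=> dk d2; apply: (coprime_exp1 _ d2 (_ : d ^+ #[k] = 1)).
    by rewrite coprime2n oddM.
  by apply/eqP; rewrite -order_dvdn order_dvdG.
have iV := sqr1_inv i2.
pose d := y^-1 * i.
have ckyV : commute k y^-1 by apply/commuteV/commute_sym.
have ckd : commute k d by apply: commuteM.
have cd : c = k * d by rewrite cE /d !mulgA ckyV.
have czd : commute z d.
  by apply: commuteM; [apply/commuteV/commute_sym | apply: commute_sym].
(* With c = k d and b = z y, both products of commuting elements, k = c^l b^j reads k = k^l rho
   z^j. *)
case/mulsgP: kcb => _ _ /cycleP[l ->] /cycleP[j ->] ek.
pose rho := d ^+ l * y ^+ j.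
have czy : commute z y by apply: commute_sym.
have ek2 : k = k ^+ l * (rho * z ^+ j).
  rewrite {1}ek cd (expgMn l ckd) bE (expgMn j czy) /rho -!mulgA; congr (_ * (_ * _)).
  exact: commuteX2.
have ckyy : commute k y by apply: commute_sym.
have czr : commute z (rho * z ^+ j) .
  by apply: commuteM; [apply: commuteM; apply: commuteX | apply: commuteX].
have ckr : commute k rho by apply: commuteM; apply: commuteX.
(* As a power of k, e is inverted by z; as rho z^j it commutes with z. Having odd order, it is
   trivial. *)
pose e := (k ^+ l)^-1 * k.
have ee : e = rho * z ^+ j by rewrite /e {2}ek2 mulKg.
have ekk : e \in <[k]> by rewrite groupM ?groupV ?mem_cycle ?cycle_id.
have e1 : e = 1.
  apply: sqrk => //.
  have e_z : e ^ z = e^-1.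
    by case/cycleP: ekk => m ->; rewrite conjXg k_z expVgn.
  have : e ^ z = e by apply/conjg_fixP/commgP; rewrite ee; apply: commute_sym.
  by rewrite e_z expg2 => {1}<-; rewrite mulVg.
have mul1_inv (u v : gT) : u * v = 1 -> u = v^-1.
  by move/eqP; rewrite -eq_invg_mul => /eqP <-; rewrite invgK.
have kl : k ^+ l = k by apply: invg_inj; apply: mul1_inv.
have rz : rho = (z ^+ j)^-1 by apply: mul1_inv; rewrite -ee.
have jev : ~~ odd j.
  apply/negP=> oj; case/negP: k1; apply/eqP/sqrk; first exact: cycle_id.
  have zj : z ^+ j = z by rewrite -(odd_double_half j) oj expgS -mul2n expgM z2 expg1n mulg1.
  have : k ^ z = k.
    by apply/conjg_fixP/commgP; move: ckr; rewrite rz zj (sqr1_inv z2).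
  by rewrite k_z expg2 => {1}<-; rewrite mulVg.
have zj : z ^+ j = 1.
  by rewrite -(odd_double_half j) (negPf jev) add0n -mul2n expgM z2 expg1n.
have rho1 : rho = 1 by rewrite rz zj invg1.
have sl : coprime s l.
  rewrite prime_coprime //; apply/negP=> sl.
  have sk : s %| #[k].
    have /p_natP[[|m] om] := elM _ kM; last by rewrite om expnS dvdn_mulr.
    by case/negP: k1; rewrite -order_eq1 om.
  have : k ^+ l == k ^+ 1 by rewrite kl expg1.
  rewrite eq_expg_mod_order => /eqP/(congr1 (modn^~ s)); rewrite !modn_dvdm //.
  by rewrite (eqP sl) modn_small ?prime_gt1.
have ckc : commute k c by rewrite cd; apply: commuteM.
have dE : d = k^-1 * c by rewrite cd mulKg.
have d2M : d ^+ 2 \in M.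
  rewrite dE expgMn; last by apply/commute_sym/commuteV/commute_sym.
  by rewrite groupM // groupX // groupV.
(* Here d^l = y^-j, and raising the s-element d^2 to a power l prime to s does not shrink the group
   it generates. *)
have d2y : d ^+ 2 \in <[y]>.
  have /p_natP[m om] := elM _ d2M.
  have g2 : d ^+ 2 \in <[(d ^+ 2) ^+ l]>.
    suff <- : <[d ^+ 2]> = <[(d ^+ 2) ^+ l]> by rewrite cycle_id.
    by apply/eqP; rewrite -/(generator _ _) generator_coprime om coprimeXl.
  apply: subsetP g2; rewrite cycle_subG -expgM mulnC expgM groupX //.
  have -> : d ^+ l = (y ^+ j)^-1 by apply: mul1_inv.
  by rewrite groupV mem_cycle.
have d2E : d ^+ 2 = y^-1 * (y^-1) ^ i by rewrite /d expg2 conjgE iV !mulgA.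
have yiy : y ^ i \in <[y]>.
  rewrite -groupV -conjVg -(mulKg y^-1 (_ ^ _)) -d2E.
  by rewrite groupM // invgK cycle_id.
(* If i centralizes y, then c = (k y^-1) i is a product of commuting factors of odd order and of
   order 2; so i is a power of c, and b centralizes it, against [ncb]. *)
case: (invol_pgroup_dichotomy ps os (elM _ yM) i2 yiy) => yi.
  have ciy : commute i y by apply/commute_sym/commgP/conjg_fixP.
  have i1 : i != 1 by apply: contraNneq iM => ->.
  have kyM : k * y^-1 \in M by rewrite groupM ?groupV.
  have ic : i \in <[c]>.
    have <- : c ^+ #[k * y^-1] = i; last by rewrite mem_cycle.
    have -> : c = (k * y^-1) * i by rewrite cd /d mulgA.
    rewrite expgMn; last first.
      by apply/commute_sym/commuteM; [exact: commute_sym | apply: commuteV].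
    rewrite expg_order mul1g -(odd_double_half #[_]) oddM //.
    by rewrite expgS -mul2n expgM i2 expg1n mulg1.
  case/negP: (ncb i ic i1); apply: (subsetP (cent_sub _)); rewrite cent_cycle.
  by apply/cent1P; rewrite bE; apply: commute_sym; apply: commuteM.
(* If i inverts y, then d^2 = 1 and c^2 = k^2 lies in the trivial intersection of <k> and <c>. *)
case/negP: k1; apply/eqP/sqrk; first exact: cycle_id.
apply/set1gP; rewrite -kc1 inE groupX ?cycle_id //=.
suff <- : c ^+ 2 = k ^+ 2 by rewrite groupX ?cycle_id.
by rewrite cd expgMn // d2E conjVg yi invgK mulVg mulg1.
Qed.

(** * An involution of <b> that commutes with a but not with c *)

Section NoncentralInvolution.
Variable gT : finGroupType.
Variables a b c z : gT.
Hypothesis at_ : atomic_triple a b c.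
Hypothesis zb : z \in <[b]>.
Hypothesis oz : #[z] = 2.
Hypothesis caz : commute a z.
Hypothesis ncz : ~ commute c z.

Let K := (<[a]> <*> <[b]>)%G.
Let L := (<[b]> <*> <[c]>)%G.
Let G := (<[a]> <*> <[b]> <*> <[c]>)%G.

Let tt : tight_triple a b c. Proof. by case: at_. Qed.
Let tpK : tight_pair a b := triple_tpK tt.
Let tpL : tight_pair b c := triple_tpL tt.
Let bL : b \in L. Proof. by rewrite mem_gen // inE cycle_id. Qed.
Let cL : c \in L. Proof. by rewrite mem_gen // inE cycle_id orbT. Qed.
Let aK : a \in K. Proof. by rewrite mem_gen // inE cycle_id. Qed.
Let bK : b \in K. Proof. by rewrite mem_gen // inE cycle_id orbT. Qed.
Let KG : K \subset G. Proof. exact: joing_subl. Qed.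
Let LG : L \subset G.
Proof.
rewrite join_subG joing_subr andbT.
by apply: subset_trans (joing_subl _ _); exact: joing_subr.
Qed.
Let cbz : commute b z. Proof. exact: (centsP (cycle_abelian b)) (cycle_id b) _ zb. Qed.
Let z2 : z ^+ 2 = 1. Proof. by rewrite -oz expg_order. Qed.
Let zV : z^-1 = z. Proof. exact: sqr1_inv z2. Qed.

Lemma no_normal_c (x : gT) : x \in <[c]> -> x != 1 -> b \notin 'N(<[x]>).
Proof.
move=> xc x1; apply/negP=> bN; have := @core_c _ a b c <[x]>%G at_.
by rewrite cycle_subG => /(_ xc bN) /eqP; rewrite cycle_eq1 (negPf x1).
Qed.

Lemma noncentral_Sylow : exists s (M : {group gT}),
  [/\ prime s, odd s, M <| L, s.-Sylow(L) M & b ^+ 2 \in M /\ c ^+ 2 \in M].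
Proof.
have [tt' nK nL _] := at_; have [a1 b1 c1] := triple_neq1 at_.
have ntL : <[b]> <*> <[c]> != 1.
  apply: contra b1 => /eqP L1; apply/eqP/set1gP; rewrite -L1; exact: bL.
have cN2 (x : gT) : x \in <[b]> -> #[x] = 2 -> c \notin 'N(<[x]>).
  move=> xb ox; apply/negP=> cN; apply: ncz; apply: order2_norm => //.
  by rewrite (cycle_order_eq zb xb) ?oz ?ox.
(* A subgroup of prime order normal in L cannot lie in <c>; and with order 2 it would be <z>, which
   c does not normalize. *)
have [s ps [os sL]] : exists2 s, prime s & odd s /\ s %| #|L|.
  have [x [xbc px]] := tight_core tpL ntL; rewrite join_subG !cycle_subG => /andP[bN cN].
  have x1 : x != 1 by rewrite -order_gt1 prime_gt1.
  case: xbc => [xb|xc]; last by have := no_normal_c xc x1; rewrite bN.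
  exists #[x] => //; split.
    case: (even_prime px) => // x2; by have := cN2 x xb x2; rewrite cN.
  by rewrite order_dvdG // (subsetP (joing_subl _ _)).
have [y [yb oy aNy cNy]] := common_odd_prime at_ ps os sL.
have ryr p (x : gT) : prime p -> x \in <[b]> -> #[x] = p -> a \in 'N(<[x]>) ->
    c \in 'N(<[x]>) -> reg a b <[x]>.
  move=> pp xb ox aN cN.
  have [||//] := @core_b _ a b c <[x]>%G at_ _ _ aN cN; last by rewrite cycle_subG.
  by rewrite /= cycle_eq1 -order_gt1 ox prime_gt1.
(* A second odd prime would give two normal subgroups of coprime orders inside <b>, and [regI] would
   make the pair (a, b) regular. *)
have piL : [pred p | (p == 2) || (p == s)].-group L.
  apply/pgroupP=> p pp pL; rewrite inE; apply/norP=> [[p2 pns]].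
  have op : odd p by case: (even_prime pp) p2 => // ->.
  have [x [xb ox aNx cNx]] := common_odd_prime at_ pp op pL.
  apply: nK; apply: (@regI _ a b <[x]>%G <[y]>%G); last 2 first.
  - exact: ryr pp xb ox aNx cNx.
  - exact: ryr ps yb oy aNy cNy.
  apply: coprime_TIg; rewrite -[#|<[x]>|]/#[x] -[#|<[y]>|]/#[y] ox oy.
  by rewrite prime_coprime // dvdn_prime2.
have [M nM sylM] := tight_normal_Sylow tpL ps os piL.
exists s, M; split=> //.
have oM : odd #|M|.
  have /p_natP[k ->] : s.-nat #|M| by have := pHall_pgroup sylM.
  by rewrite oddX os orbT.
have nML := normal_norm nM.
have bN := subsetP nML _ bL; have cN := subsetP nML _ cL.
have L2 : 2.-group (L / M).
  apply/pgroupP=> p pp; rewrite card_quotient // -(divgS (normal_sub nM)) => pd.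
  have pL : p %| #|L| by apply: dvdn_trans pd _; rewrite dvdn_div // cardSg ?normal_sub.
  have := pgroupP piL _ pp pL; rewrite !inE => /orP[//|/eqP eps].
  have /and3P[_ _ s'LM] := sylM.
  have := pnat_dvd pd; rewrite divgS ?normal_sub // => /(_ _ s'LM).
  by rewrite pnatE // !inE eps eqxx.
have ex (x : gT) : x \in L -> (coset M x) ^+ (partn #[x] s^') = 1.
  move=> xL; have xN := subsetP nML _ xL.
  rewrite -morphX //= coset_id // (mem_normal_Hall sylM) ?groupX //.
  rewrite /p_elt; apply: (pnat_dvd (n := partn #[x] s)); last by rewrite part_pnat.
  by rewrite order_dvdn -expgM mulnC partnC // expg_order.
(* M need not lie in a cyclic factor, so the intersection is shown trivial by counting: |L/M| is the
   product of the s'-parts of |b| and |c|, and these bound the orders of the images. *)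
have tpq : tight_pair (coset M b) (coset M c).
  have [bc2 tI cm] := tpL.
  split; first by rewrite -morphM // -morphX ?groupM // bc2 morph1.
    apply/eqP; rewrite trivg_card_le1.
    have pos n : 0 < partn n s^' by apply: part_gt0.
    have leb (x : gT) : x \in L -> #|<[coset M x]>| <= partn #[x] s^'.
      by move=> xL; rewrite dvdn_leq // order_dvdn ex.
    rewrite -(leq_pmul2l (_ : 0 < partn #[b] s^' * partn #[c] s^')) ?muln_gt0 ?pos //.
    have cLM : #|<[coset M b]> * <[coset M c]>| = (partn #[b] s^' * partn #[c] s^')%N.
      rewrite -!quotient_cycle // -quotientMl ?cycle_subG // -tight_joinE //.
      rewrite card_quotient // -divgS ?normal_sub // (card_Hall sylM).
      rewrite -partnM ?order_gt0 // -(tight_card tpL).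
      by rewrite -{1}(partnC s (cardG_gt0 L)) mulKn // part_gt0.
    by rewrite -cLM -mul_cardG muln1 cLM leq_mul ?leb.
  by rewrite /commute -!quotient_cycle // -quotientMl ?cycle_subG // cm quotientMl ?cycle_subG.
have eq : <[coset M b]> <*> <[coset M c]> = L / M.
  by rewrite -!quotient_cycle // quotientY ?cycle_subG.
have ntq : <[coset M b]> <*> <[coset M c]> != 1.
  rewrite eq; apply/eqP=> /trivgP; rewrite quotient_sub1 // => sLM.
  have : z \in M by rewrite (subsetP sLM) // (subsetP (joing_subl _ _)).
  by move/order_dvdG/dvdn_odd => /(_ oM); rewrite oz.
(* Whichever factor contains x, [tight_quo_invol] applies. Its first alternative would make z
   commute with c, or would give an involution of <c> centralized by b. *)
have [x [xbc px nx]] := tight_core tpq ntq.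
have ox : #[x] = 2.
  have xL : x \in L / M.
    by rewrite -eq; case: xbc => xb; rewrite mem_gen // inE xb ?orbT.
  have /pgroupP := mem_p_elt L2 xL => /(_ _ px).
  by rewrite -[#|_|]/#[x] dvdnn => /(_ isT); rewrite inE => /eqP.
rewrite eq in nx; case: xbc => [xb|xc].
  case: (tight_quo_invol tpL nM oM L2 xb ox nx) => // [[y' [yb' oy' cy']]].
  case: ncz; apply/commute_sym; have : z \in <[y']> by rewrite (cycle_order_eq yb' zb) ?cycle_id ?oz.
  by rewrite cycle2g // !inE => /orP[|] /eqP-> //;
     apply/commute_sym/commute1.
have [] := tight_quo_invol (tight_pair_sym tpL) _ oM _ xc ox; rewrite 1?joingC //.
  case=> y' [yc oy' cy']; have := no_normal_c yc.
  rewrite -order_gt1 oy' => /(_ isT) /negP[].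
  apply: (subsetP (cent_sub _)); rewrite cent_cycle; apply/cent1P.
  exact: commute_sym.
by case.
Qed.

(** z is an odd power of b, so zb is a power of b^2. If c were in M, then z(bc) would have odd
    order; it inverts a, because z centralizes a and bc inverts it. That forces a^2 = 1. *)
Lemma c_notin_Sylow s (M : {group gT}) : prime s -> odd s -> M <| L -> odd #|M| ->
  b ^+ 2 \in M -> z * b \in M /\ c \notin M.
Proof.
move=> ps os nM oM b2M.
have zM : z \notin M.
  by apply/negP=> /order_dvdG/dvdn_odd /(_ oM); rewrite oz.
have zbM : z * b \in M.
  case/cycleP: zb zM => i ->; rewrite -expgSr -(odd_double_half i) -mul2n.
  case: (odd i); rewrite /= ?add1n ?add0n => zM; last first.
    by case/negP: zM; rewrite expgM groupX.
  by rewrite -[(_ * _).+2]add2n expgD expgM groupM // groupX.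
split=> //; apply/negP=> cM.
have [[ab2 _ _] _] := tt; have [_ nK _ _] := at_; apply: nK; apply: reg_invol1 => //.
apply: (@odd_order_inv_sqr _ a (z * (b * c))).
  by rewrite conjgM [a ^ z](_ : _ = a) ?(triple_invA tt) //; apply/conjg_fixP/commgP.
have : z * (b * c) \in M by rewrite mulgA groupM.
by move/order_dvdG/dvdn_odd => /(_ oM).
Qed.

(** [A] is normal in K; [J] is the largest normal subgroup of [G] inside L; [Q] is the normal
    closure of z and [C] its centralizer. The aim is c in JC, then y in C. *)
Let tau := a * b.
Let A := [group of <[b]> :&: <[b]> :^ tau].
Let J := gcore L G.
Let Q := <<z ^: G>>%G.
Let C := 'C_G(Q)%G.

Let tau2 : tau ^+ 2 = 1. Proof. by case: tt => [[]]. Qed.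
Let GKc : G = K * <[c]> :> {set gT}. Proof. exact: triple_GE tt. Qed.
Let LE : L = <[b]> * <[c]> :> {set gT}. Proof. exact: tight_joinE. Qed.
Let LE' : L = <[c]> * <[b]> :> {set gT}. Proof. by rewrite LE; case: tpL. Qed.
Let tauK : tau \in K. Proof. by rewrite groupM. Qed.

Let c_tau : c ^ tau = c^-1.
Proof.
have := triple_invA (tight_triple_sym tt).
by rewrite -invMg (sqr1_inv tau2) conjVg invgK => {2}<-; rewrite invgK.
Qed.

Let KL : K :&: L = <[b]>.
Proof.
apply/eqP; rewrite eqEsubset subsetI joing_subr joing_subl !andbT.
apply/subsetP=> x /setIP[xK]; rewrite LE => /mulsgP[u v ub vc ex].
suff v1 : v = 1 by rewrite ex v1 mulg1.
have [_ [_ Kc _]] := tt; apply/set1gP; rewrite -Kc inE vc andbT.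
rewrite -[v](mulKg u) -ex groupM ?groupV //.
by apply: (subsetP (joing_subr _ _)).
Qed.

Let KNA : K \subset 'N(A).
Proof.
have tN : tau \in 'N(A).
  by apply/normP; rewrite conjIg -conjsgM -expg2 tau2 conjsg1 setIC.
have bN : b \in 'N(A).
  by rewrite -cycle_subG; apply: sub_abelian_norm (cycle_abelian b) (subsetIl _ _).
rewrite join_subG !cycle_subG bN andbT.
by rewrite -[a](mulgK b) groupM ?groupV.
Qed.

Let zA : z \in A.
Proof.
rewrite inE zb mem_conjg [z ^ _](_ : _ = z) //.
by apply/conjg_fixP/commgP/commuteV/commuteM; apply: commute_sym.
Qed.

Let GNJ : G \subset 'N(J). Proof. exact: gcore_norm. Qed.
Let JL : J \subset L. Proof. exact: gcore_sub. Qed.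

Let AJ : A \subset J.
Proof.
apply/bigcapsP=> g gG; rewrite -sub_conjgV.
have : g^-1 \in G by rewrite groupV.
rewrite GKc => /mulsgP[k v kK vc ->]; rewrite conjsgM (normP (subsetP KNA _ kK)).
apply: subset_trans (_ : L :^ v \subset _).
  by rewrite conjSg (subset_trans (subsetIl _ _)) ?joing_subl.
by rewrite conjGid // (subsetP (joing_subr _ _)).
Qed.

(** tau normalizes J and inverts c, so u^tau lies in both K and L, whose intersection is <b>. *)
Let J_factor u v : u \in <[b]> -> v \in <[c]> -> u * v \in J -> u \in A /\ v \in J.
Proof.
move=> ub vc uvJ.
have tG : tau \in G := subsetP KG _ tauK.
have uvt : (u * v) ^ tau \in L.
  by apply: (subsetP JL); rewrite memJ_norm // (subsetP GNJ).
have vt : v ^ tau \in L.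
  case/cycleP: vc => i ->; rewrite conjXg c_tau; apply: groupX; rewrite groupV; exact: cL.
have uA : u \in A.
  rewrite inE ub mem_conjg -[tau^-1]/(tau^-1) (sqr1_inv tau2) -KL inE.
  have uK : u \in K by apply: (subsetP (joing_subr _ _)).
  rewrite groupJ //= -(mulgK (v ^ tau) (u ^ tau)) -conjMg.
  exact: groupM uvt (groupVr vt).
split=> //; rewrite -(mulKg u v) groupM // groupV.
exact: (subsetP AJ).
Qed.

Let classz g : g \in G -> exists2 v, v \in <[c]> & z ^ g = z ^ v.
Proof.
rewrite GKc => /mulsgP[k v kK vc ->]; exists v => //; rewrite conjgM.
suff -> : z ^ k = z by [].
apply/conjg_fixP/commgP; apply: (centP (_ : z \in 'C(K))) => //.
by rewrite centY !cent_cycle inE; apply/andP; split; apply/cent1P.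
Qed.

Let zQ : z \in Q. Proof. by rewrite mem_gen // class_refl. Qed.
Let GNQ : G \subset 'N(Q). Proof. exact: norms_gen (class_norm _ _). Qed.
Let GNC : G \subset 'N(C). Proof. by rewrite normsI ?normG ?norms_cent. Qed.
Let zJ : z \in J. Proof. exact: subsetP AJ _ zA. Qed.
Let QJ : Q \subset J.
Proof.
rewrite gen_subG; apply/subsetP=> _ /imsetP[g gG ->].
by rewrite memJ_norm // (subsetP GNJ).
Qed.

(** K centralizes z, so the conjugates of z are the z^v with v in <c>, and e commutes with v. *)
Let c_cent e : e \in <[c]> -> commute e z -> e \in C.
Proof.
move=> ec cez; rewrite inE (subsetP LG) ?(subsetP (joing_subr _ _)) //=.
rewrite cent_gen; apply/centP=> _ /imsetP[g gG ->].
have [v vc ->] := classz gG; rewrite /commute.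
have ev : e ^ v = e.
  by apply/conjg_fixP/commgP; apply: (centsP (cycle_abelian c)).
by rewrite -{1 2}ev -!conjMg cez.
Qed.

Let L_split g : g \in L -> commute g z ->
  exists u v, [/\ u \in <[b]>, v \in <[c]>, v \in C & g = u * v].
Proof.
rewrite LE => /mulsgP[u v ub vc ->] cuv; exists u, v; split=> //.
apply: c_cent => //.
have cuz : commute u z by apply: (centsP (cycle_abelian b)).
by rewrite -(mulKg u v); apply/commute_sym/commuteM; apply: commute_sym => //;
   apply/commute_sym/commuteV/commute_sym.
Qed.

Let L_split' g : g \in L -> commute g z ->
  exists u v, [/\ u \in <[b]>, v \in <[c]>, v \in C & g = v * u].
Proof.
rewrite LE' => /mulsgP[v u vc ub ->] cuv; exists u, v; split=> //.
apply: c_cent => //.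
have cuz : commute u z by apply: (centsP (cycle_abelian b)).
by rewrite -(mulgK u v); apply/commute_sym/commuteM; apply: commute_sym => //;
   apply/commute_sym/commuteV/commute_sym.
Qed.

Section WithSylow.
Variables (s : nat) (M : {group gT}).
Hypotheses (ps : prime s) (os : odd s) (nM : M <| L) (sylM : s.-Sylow(L) M).
Hypotheses (b2M : b ^+ 2 \in M) (c2M : c ^+ 2 \in M).

Let oM : odd #|M|.
Proof.
have /p_natP[k ->] : s.-nat #|M| by have := pHall_pgroup sylM.
by rewrite oddX os orbT.
Qed.
Let zbM : z * b \in M. Proof. by case: (c_notin_Sylow ps os nM oM b2M). Qed.
Let cM : c \notin M. Proof. by case: (c_notin_Sylow ps os nM oM b2M). Qed.
Let y := z * b.
Let bE : b = z * y. Proof. by rewrite /y mulgA -expg2 z2 mul1g. Qed.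
Let cyz : commute y z. Proof. by apply/commute_sym/commuteM => //; apply: commute_sym. Qed.
Let yb : y \in <[b]>. Proof. by rewrite groupM ?cycle_id. Qed.
Let oy : odd #[y]. Proof. by have /order_dvdG/dvdn_odd/(_ oM) := zbM. Qed.
Let elM x : x \in M -> s.-elt x.
Proof. by move=> xM; apply: mem_p_elt (pHall_pgroup sylM) xM. Qed.

(** Modulo M, z agrees with b, and b, c, bc all square to 1, hence commute. *)
Let zcM : z ^ c \in M <*> <[z]>.
Proof.
have nML := normal_norm nM.
have bN := subsetP nML _ bL; have cN := subsetP nML _ cL.
have zN : z \in 'N(M) by case/cycleP: zb => i ->; rewrite groupX.
have cb2 : coset M b ^+ 2 = 1 by rewrite -morphX //= coset_id.
have cc2 : coset M c ^+ 2 = 1 by rewrite -morphX //= coset_id.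
have cz : coset M z = coset M b.
  have := coset_id zbM; rewrite morphM //= => /eqP; rewrite -eq_invg_mul => /eqP <-.
  by apply/esym/sqr1_inv; rewrite -morphX //= z2 morph1.
have : coset M (z ^ c) = coset M z.
  rewrite morphJ //= cz; apply/conjg_fixP/commgP.
  have [bc2 _ _] := tpL; have := congr1 (coset M) bc2.
  rewrite morphX ?groupM // morphM // morph1 /= => /sqr1_inv; rewrite invMg.
  by rewrite (sqr1_inv cb2) (sqr1_inv cc2).
move=> e; rewrite -(mulgKV z (z ^ c)) groupM ?mem_gen ?inE ?cycle_id ?orbT //.
apply/orP; left; apply: coset_idr; first by rewrite groupM ?groupV ?groupJ.
by rewrite morphM ?groupV ?groupJ // morphV //= e mulgV.
Qed.

Let QM : Q \subset M <*> <[z]>.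
Proof.
rewrite gen_subG; apply/subsetP=> _ /imsetP[g gG ->].
have [_ /cycleP[i ->] ->] := classz gG.
have cN : c \in 'N(M <*> <[z]>).
  rewrite inE conjYg (normP (subsetP (normal_norm nM) _ cL)) -cycleJ join_subG.
  by rewrite joing_subl cycle_subG zcM.
by rewrite memJ_norm ?groupX // mem_gen // inE cycle_id orbT.
Qed.

(** Q lies in M<z>, whose order divides 2|M| with |M| odd. *)
Let sylQ x : x \in Q -> #[x] = 2 -> 2.-Sylow(Q) <[x]>.
Proof.
move=> xQ ox; rewrite pHallE cycle_subG xQ -[#|<[x]>|]/#[x] ox /=.
have zN : <[z]> \subset 'N(M).
  by rewrite cycle_subG (subsetP (normal_norm nM)) // (subsetP (joing_subl _ _)).
have cQ : #|Q| %| 2 * #|M|.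
  apply: dvdn_trans (cardSg QM) _; rewrite /= norm_joinEr // -oz mulnC.
  by rewrite -[#[z]]/#|<[z]>| mul_cardG dvdn_mulr.
have d2 : 2 %| #|Q| by rewrite -ox order_dvdG.
rewrite eqn_dvd; apply/andP; split.
  by rewrite -[X in X %| _](_ : partn 2 2 = 2) ?partn_dvd // part_pnat_id.
have := partn_dvd 2 (_ : 0 < 2 * #|M|) cQ; rewrite muln_gt0 cardG_gt0 => /(_ isT).
rewrite partnM ?cardG_gt0 // [X in (_ * X)%N]part_p'nat ?muln1.
  by rewrite [X in _ %| X]part_pnat_id.
by rewrite -odd_2'nat.
Qed.

(* Frattini argument: [z ^ c] is conjugate to [z] inside [Q], a subgroup of [J]. *)
Let c_in_JC : c \in J <*> C.
Proof.
have zcQ : z ^ c \in Q by rewrite memJ_norm // (subsetP GNQ) // (subsetP LG) ?cL.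
have [x xQ e] := Sylow_trans (sylQ zQ oz) (sylQ zcQ (etrans (orderJ _ _) oz)).
have zcx : z ^ c = z ^ x.
  have : z ^ c \in <[z ^ x]> by rewrite cycleJ -e cycle_id.
  rewrite cycle2g ?orderJ // !inE => /orP[|/eqP //].
  by rewrite conjg_eq1 -order_eq1 oz.
have xL : x \in L := subsetP JL _ (subsetP QJ _ xQ).
have cxL : c * x^-1 \in L by rewrite groupM ?groupV.
have cxz : commute (c * x^-1) z.
  by apply/commute_sym/commgP/conjg_fixP; rewrite conjgM zcx -conjgM mulgV conjg1.
have [u [v [ub vc vC e2]]] := L_split cxL cxz.
have vG : v \in G by case/setIP: vC.
have : u^-1 * (c * v^-1) \in J.
  have -> : u^-1 * (c * v^-1) = x ^ v^-1.
    have -> : c = u * v * x by rewrite -e2 mulgKV.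
    by rewrite conjgE invgK !mulgA mulVg mul1g.
  by rewrite memJ_norm ?(subsetP QJ) // groupV (subsetP GNJ).
case/(J_factor (groupVr ub) (groupM (cycle_id c) (groupVr vc)))=> _ cvJ.
by rewrite -(mulgKV v c) groupM // mem_gen // inE ?cvJ ?vC ?orbT.
Qed.

Let y_in_JC : y \in J <*> C.
Proof.
have GN : G \subset 'N(J <*> C) by rewrite normsY.
have b2 : b ^+ 2 \in J <*> C.
  have bG : b \in G := subsetP LG _ bL.
  have cb : c ^ b^-1 \in J <*> C by rewrite memJ_norm // groupV (subsetP GN).
  have -> : b ^+ 2 = (c ^ b^-1)^-1 * c^-1; last by rewrite groupM ?groupV.
  have [bc2 _ _] := tpL.
  apply: (mulgI (c ^ b^-1)); rewrite mulKVg; apply: (mulIg c); rewrite mulVg.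
  by rewrite conjgE invgK expg2 !mulgA mulgKV -bc2 expg2 !mulgA.
have y2 : y ^+ 2 = b ^+ 2 by rewrite /y expgMn ?z2 ?mul1g //; apply: commute_sym.
by rewrite -(odd_sqr oy) -expgM mulnC expgM y2 groupX.
Qed.

(** Factor the J-part of y as u w and its C-part as e v, with u, v in <b> and w, e in <c>. The
    middle product w e lies in both <b> and <c>, so it vanishes. *)
Lemma y_split : exists u v, [/\ u \in A, v \in <[b]>, v \in C & y = u * v].
Proof.
have CN : C \subset 'N(J) by rewrite (subset_trans _ GNJ) // subsetIl.
have := y_in_JC; rewrite norm_joinEr // => /mulsgP[j g jJ gC ey].
have gL : g \in L.
  rewrite -(mulKg j g) -ey; apply: groupM; last exact: (subsetP (joing_subl _ _)).
  by rewrite groupV; apply: (subsetP JL).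
have cgz : commute g z by case/setIP: gC => _ /centP; apply.
have [v [e [vb ec eC eg]]] := L_split' gL cgz.
have : j \in L := subsetP JL _ jJ.
rewrite LE => /mulsgP[u w ub wc ej].
have [uA wJ] : u \in A /\ w \in J by apply: J_factor => //; rewrite -ej.
have we : w * e = u^-1 * y * v^-1.
  by rewrite ey ej eg !mulgA mulVg mul1g mulgK.
have we1 : w * e = 1.
  apply/set1gP; rewrite -(triple_TIbc tt); apply/setIP; split; last exact: groupM.
  by rewrite we; apply: groupM (groupM (groupVr ub) yb) (groupVr vb).
exists u, v; split=> //.
  by rewrite -(mulKg e v) -eg groupM ?groupV.
by rewrite ey ej eg -!mulgA (mulgA w) we1 mul1g.
Qed.

(** One of the two factors of y from [y_split] already generates the s-group <y>. If it were the one
    in A, then b would be in A, so a would normalize <b>, giving a^2 = 1. So it is the one in C. *)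
Lemma y_cent : y \in C.
Proof.
have [u [v [uA vb vC ey]]] := y_split.
have ub : u \in <[b]> by case/setIP: uA.
(* b = zy with z of order 2 and y of odd order, so the even exponent |y|+1 kills z and fixes y. *)
have yk (x : gT) : x \in <[b]> -> exists m, x ^+ #[y].+1 = y ^+ m.
  case/cycleP=> m ->; exists m; rewrite -expgM mulnC expgM; congr (_ ^+ m).
  rewrite [in LHS]bE expgMn; last exact: commute_sym.
  have -> : z ^+ #[y].+1 = 1.
    by apply/eqP; rewrite -order_dvdn oz dvdn2 /= oy.
  by rewrite mul1g expgS expg_order mulg1.
have [i ui] := yk u ub; have [j vj] := yk v vb.
have yij : y = y ^+ (i + j).
  rewrite expgD -ui -vj -expgMn -?ey ?expgS ?expg_order ?mulg1 //.
  exact: (centsP (cycle_abelian b)).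
have [y1|ny1] := eqVneq y 1; first by rewrite y1 group1.
have /p_natP[k ok] := elM zbM; rewrite -/y in ok.
have sy : s %| #[y].
  by rewrite ok; case: k ok => [|k _]; [rewrite expn0 => /eqP; rewrite order_eq1 (negPf ny1) | rewrite expnS dvdn_mulr].
have gen (m : nat) (H : {group gT}) : ~~ (s %| m) -> y ^+ m \in H -> y \in H.
  move=> sm ymH; have : y \in <[y ^+ m]>.
    suff <- : <[y]> = <[y ^+ m]> by rewrite cycle_id.
    by apply/eqP; rewrite -/(generator _ _) generator_coprime ok coprimeXl // prime_coprime.
  by move: ymH; rewrite -cycle_subG => /subsetP; apply.
have [si|si] := boolP (s %| i); last first.
  have yA : y \in A by apply: (gen i) => //; rewrite -ui groupX.
  have bA : b \in A by rewrite bE groupM.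
  have [[ab2 _ _] _] := tt; have [_ nK _ _] := at_; case: nK; apply: reg_invol1 => //.
  have [ba2 tI _] := tight_pair_sym tpK; apply: (cycle_norm_sqr ba2 tI).
  suff <- : A = <[b]> :> {set gT} by apply: (subsetP KNA).
  by apply/eqP; rewrite eqEsubset subsetIl cycle_subG.
apply: (gen j); last by rewrite -vj groupX.
apply/negP=> sj; have : y ^+ (i + j) == y ^+ 1 by rewrite -yij expg1.
rewrite eq_expg_mod_order => /eqP/(congr1 (modn^~ s)); rewrite !modn_dvdm //.
by rewrite -modnDm (eqP si) (eqP sj) mod0n modn_small ?prime_gt1.
Qed.

(** z and t are involutions, so z inverts g = zt. Since n = |g^2| is odd, g = k i with k of odd
    order, i^2 = 1, and both powers of g. *)
Let t := b * c.
Let g := z * t.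
Let n := #[g ^+ 2].
Let i := g ^+ n.
Let k := g ^+ n.+1.

Let t2 : t ^+ 2 = 1. Proof. by case: tpL. Qed.
Let tV : t^-1 = t. Proof. exact: sqr1_inv. Qed.
Let gE : g = y * c. Proof. by rewrite /g /y mulgA. Qed.
Let cE : c = y^-1 * g. Proof. by rewrite gE mulKg. Qed.
Let g_z : g ^ z = g^-1.
Proof. exact: invol_mul_conjl. Qed.
Let cN : c \in 'N(M). Proof. exact: (subsetP (normal_norm nM) _ cL). Qed.
Let g2M : g ^+ 2 \in M.
Proof.
have -> : g ^+ 2 = y * (y ^ c^-1 * c ^+ 2).
  by rewrite gE conjgE invgK !expg2 !mulgA mulgKV.
by rewrite groupM ?zbM // groupM // memJ_norm ?groupV ?zbM.
Qed.
Let on : odd n. Proof. by have /order_dvdG/dvdn_odd/(_ oM) := g2M. Qed.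
Let i2 : i ^+ 2 = 1. Proof. by rewrite /i -expgM mulnC expgM expg_order. Qed.
Let iV : i^-1 = i. Proof. exact: sqr1_inv. Qed.
Let gki : g = k * i. Proof. by rewrite -iV /k /i expgS mulgK. Qed.
Let kM : k \in M.
Proof.
rewrite /k -(odd_double_half n) on add1n -[(_.*2).+2]/(_.+1).*2 -muln2 mulnC expgM.
by rewrite groupX.
Qed.
Let kQ : k \in Q.
Proof.
have tG : t \in G by rewrite (subsetP LG) // groupM.
have g2Q : g ^+ 2 \in Q.
  have -> : g ^+ 2 = z * z ^ t by rewrite invol_mul_sqr.
  by rewrite groupM // memJ_norm // (subsetP GNQ).
rewrite /k -(odd_double_half n) on add1n -[(_.*2).+2]/(_.+1).*2 -muln2 mulnC expgM.
by rewrite groupX.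
Qed.
Let iM : i \notin M.
Proof.
apply/negP=> iM; case/negP: cM; rewrite cE gki groupM ?groupV ?zbM // groupM //.
Qed.
Let k_z : k ^ z = k^-1. Proof. by rewrite /k conjXg g_z expVgn. Qed.
Let i_z : commute i z.
Proof. by apply/commgP/conjg_fixP; rewrite /i conjXg g_z expVgn iV. Qed.
Let cki : commute k i. Proof. by apply: commuteX2. Qed.
Let cyk : commute y k.
Proof. by have /setIP[_ /centP] := y_cent; apply. Qed.
Let k_b : k ^ b = k^-1.
Proof.
rewrite bE conjgM k_z conjVg; congr (_^-1); apply/conjg_fixP/commgP.
exact: commute_sym.
Qed.
Let ok : odd #[k]. Proof. by have /order_dvdG/dvdn_odd/(_ oM) := kM. Qed.
Let sqrk d : d \in <[k]> -> d ^+ 2 = 1 -> d = 1.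
Proof.
move=> dk d2; apply: (coprime_exp1 _ d2 (_ : d ^+ #[k] = 1)).
  by rewrite coprime2n.
by apply/eqP; rewrite -order_dvdn order_dvdG.
Qed.
Let k1 : k != 1.
Proof.
apply/eqP=> k1; apply: ncz; apply: commute_sym.
have gi : g = i by rewrite gki k1 mul1g.
have czt : commute z t.
  have := i2; rewrite -gi => /sqr1_inv; rewrite /g invMg tV zV => e.
  exact: esym.
have -> : c = b^-1 * t by rewrite mulKg.
by apply: commuteM => //; apply: commuteV; apply: commute_sym.
Qed.
Let kc1 : <[k]> :&: <[c]> = 1.
Proof.
apply: (core_c at_); first exact: subsetIr.
apply: (subsetP (@cycle_sub_norm _ k [group of <[k]> :&: <[c]>] <[k]>%G _ _)) => //.
  exact: subsetIl.
by rewrite inE -cycleJ k_b cycleV.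
Qed.

Lemma noncentral_absurd_Sylow : False.
Proof.
apply: (@dihedral_factor_absurd _ b c y z k i s M) => //.
- exact: pHall_pgroup sylM.
- by rewrite {1}cE gki.
- by rewrite -LE'; apply: (subsetP (normal_sub nM)).
exact: no_normal_c.
Qed.

End WithSylow.

Lemma noncentral_absurd : False.
Proof.
have [s [M [ps os nM sylM [b2 c2]]]] := noncentral_Sylow.
exact: (noncentral_absurd_Sylow ps os nM sylM b2 c2).
Qed.

End NoncentralInvolution.

(** It is enough that c normalizes a subgroup <x> of prime order in N: then [core_b] gives
    regularity modulo <x>, and [reg_mono] modulo N. Order 2 is [noncentral_absurd], odd order is
    [common_odd_prime]. *)
Theorem atomic_triple_reg (gT : finGroupType) (a b c : gT) (N : {group gT}) :
  atomic_triple a b c -> N \subset <[b]> -> a \in 'N(N) -> N :!=: 1 -> reg a b N.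
Proof.
move=> at_ sNb aN ntN; have [tt _ _ _] := at_.
have [x xN px] := order_prime_sub ntN.
have xb := subsetP sNb _ xN.
have sxN : <[x]> \subset N by rewrite cycle_subG.
have aNx : a \in 'N(<[x]>).
  exact: (subsetP (@cycle_sub_norm _ b <[x]>%G N sxN sNb)).
have x1 : <[x]> != 1 by rewrite cycle_eq1 -order_gt1 prime_gt1.
suff cN : c \in 'N(<[x]>).
  apply: (@reg_mono _ a b <[x]>%G N) => //.
  by have [|//] := @core_b _ a b c <[x]>%G at_ x1 _ aNx cN; rewrite cycle_subG.
case: (even_prime px) => [x2|ox].
  apply: (subsetP (cent_sub _)); rewrite cent_cycle; apply/cent1P/eqP/idPn=> /eqP ncx.
  apply: (@noncentral_absurd _ a b c x at_ xb x2); first exact: order2_norm.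
  by move=> cx; apply: ncx; apply: commute_sym.
have [|y [yb oy _ cNy]] := common_odd_prime at_ px ox.
  by rewrite order_dvdG // (subsetP (joing_subl _ _)).
by rewrite (cycle_order_eq xb yb).
Qed.

(** A face of P is the rank-k face of [adjw w f0] for some w and goes to the rank-k face of
    [adjw w g0]. This is well defined because two flags sharing a face are joined by a word avoiding
    its rank. *)
Lemma lift_map (P Q : Raw) n (f0 : flagT P n) (g0 : flagT Q n) :
  is_polytope P n -> is_polytope Q n -> is_flag f0 -> is_flag g0 ->
  (forall w w', adjw w f0 = adjw w' f0 -> adjw w g0 = adjw w' g0) ->
  exists gam : carrier P -> carrier Q,
    (forall w k, gam (adjw w f0 k) = adjw w g0 k) /\
    (forall x y, rle x y -> rle (gam x) (gam y)).
Proof.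
move=> hP hQ ff gf H.
have key w w' k : adjw w f0 k = adjw w' f0 k -> adjw w g0 k = adjw w' g0 k.
  move=> e; have [u eu ui] := flag_conn hP (adjw_flag hP w ff) (adjw_flag hP w' ff).
  have <- : adjw (w ++ u) g0 = adjw w' g0 by apply: H; rewrite adjw_cat.
  rewrite adjw_cat; apply/esym/(adjw_out hQ); first exact: adjw_flag.
  move=> i /ui.
  by apply: contra => /eqP <-; rewrite e.
have ex x : exists w, adjw w f0 (inord (rrk x)) = x.
  have [f [hf e _]] := flag_thru hP (le_refl hP x).
  by have [w ew _] := flag_conn hP ff hf; exists w; rewrite ew.
have [W eW] := fin_all_exists ex.
exists (fun x => adjw (W x) g0 (inord (rrk x))).
have gw w k : adjw (W (adjw w f0 k)) g0 (inord (rrk (adjw w f0 k))) = adjw w g0 k.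
  by rewrite flag_rk ?adjw_flag // inord_val; apply: key; rewrite -{2}(eW (adjw w f0 k))
     flag_rk ?adjw_flag // inord_val.
split=> // x y lxy.
have [f [hf ex' ey']] := flag_thru hP lxy.
have [w ew _] := flag_conn hP ff hf.
rewrite /fn -ew in ex' ey'.
have gx := gw w (inord (rrk x)); have gy := gw w (inord (rrk y)).
rewrite ex' in gx; rewrite ey' in gy; rewrite gx gy.
apply: flag_le; first exact: adjw_flag.
by rewrite !inordK ?ltnS ?(rk_le hP) // (le_rk hP).
Qed.

(** * Automorphisms and their free action on flags *)

Section Automorphisms.
Variables (P : Raw) (n : nat).
Local Notation T := (carrier P).
Local Notation le := (@rle P).
Local Notation rk := (@rrk P).
Local Notation flag := (flagT P n).
Implicit Types (f h : flag) (x y : T) (i j : 'I_n) (w : seq 'I_n) (g : {perm T}).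
Hypothesis hP : is_polytope P n.

Definition autS := [set g : {perm T} | [forall x, forall y, le (g x) (g y) == le x y]].

Lemma autP g : reflect (is_aut g) (g \in autS).
Proof.
rewrite inE; apply: (iffP forallP) => [H x y|H x].
  by have /forallP/(_ y)/eqP := H x.
by apply/forallP=> y; rewrite H.
Qed.

Lemma autS_group : group_set autS.
Proof.
apply/group_setP; split; first by apply/autP=> x y; rewrite !perm1.
by move=> g h /autP gA /autP hA; apply/autP=> x y; rewrite !permM hA gA.
Qed.
Canonical autG := Group autS_group.

Lemma aut_rk_le g x : is_aut g -> rk x <= rk (g x).
Proof.
move=> gA; have [m] := ubnP (rk x); elim: m x => // m IH x; rewrite ltnS => xm.
have [->//|x0] := posnP (rk x).
have [f [ff fx _]] := flag_thru hP (le_refl hP x).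
pose y := fn f (rk x).-1.
have ry : rk y = (rk x).-1 by rewrite fn_rk // (leq_trans (leq_pred _)) ?(rk_le hP).
have lyx : le y x by rewrite -[X in le _ X]fx fn_le ?leq_pred ?(rk_le hP).
have := IH y; rewrite ry prednK // => /(_ xm) ryg.
rewrite -(prednK x0) -ry; apply: leq_ltn_trans (_ : rk (g y) < _); first by rewrite ry.
apply: (rlt_rk hP); rewrite /rlt gA lyx (inj_eq perm_inj).
by apply/eqP=> e; move: ry; rewrite e => /eqP; rewrite gtn_eqF // ltn_predL.
Qed.

Lemma aut_rk g x : is_aut g -> rk (g x) = rk x.
Proof.
move=> gA; apply/eqP; rewrite eqn_leq (aut_rk_le _ gA) andbT.
have gVA : is_aut g^-1 by apply/autP; rewrite groupV; apply/autP.
by have := aut_rk_le (g x) gVA; rewrite permK.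
Qed.

Lemma aut_is_flag g f : is_aut g -> is_flag f -> is_flag (aut_flag g f).
Proof.
move=> gA ff; apply/andP; split; apply/forallP=> k.
  by rewrite ffunE (aut_rk _ gA) flag_rk.
by apply/forallP=> l; apply/implyP=> kl; rewrite !ffunE gA flag_le.
Qed.

Lemma aut_adj g f i : is_aut g -> is_flag f ->
  aut_flag g (adj i f) = adj i (aut_flag g f).
Proof.
move=> gA ff; apply/esym; apply: adj_eq => //.
have /and4P[_ af fn /forallP fe] := adjP hP i ff.
apply/and4P; split; rewrite ?aut_is_flag //.
  by rewrite !ffunE (inj_eq perm_inj).
by apply/forallP=> j; apply/implyP=> ji; rewrite !ffunE (eqP (implyP (fe j) ji)).
Qed.

Lemma aut_adjw g f w : is_aut g -> is_flag f ->
  aut_flag g (adjw w f) = adjw w (aut_flag g f).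
Proof.
by move=> gA; elim: w f => //= i w IH f ff; rewrite IH ?adj_flag // aut_adj.
Qed.

Lemma aut_flag1 f : aut_flag 1 f = f.
Proof. by apply/ffunP=> k; rewrite ffunE perm1. Qed.

Lemma aut_flagM g (h : {perm T}) f : aut_flag (g * h) f = aut_flag h (aut_flag g f).
Proof. by apply/ffunP=> k; rewrite !ffunE permM. Qed.

Lemma aut_free g f : is_aut g -> is_flag f -> aut_flag g f = f -> g = 1.
Proof.
move=> gA ff e; apply/permP=> x; rewrite perm1.
have [h [hf hx _]] := flag_thru hP (le_refl hP x).
have [w ew _] := flag_conn hP ff hf.
have : aut_flag g h = h by rewrite -ew aut_adjw // e.
by move=> /ffunP/(_ (inord (rk x))); rewrite ffunE -/(fn h _) hx.
Qed.

Lemma aut_inj g (h : {perm T}) f : g \in autG -> h \in autG -> is_flag f ->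
  aut_flag g f = aut_flag h f -> g = h.
Proof.
move=> gA hA ff e; apply: (mulIg h^-1); rewrite mulgV.
apply: (@aut_free _ f) => //; first by apply/autP; rewrite groupM ?groupV.
by rewrite aut_flagM e -aut_flagM mulgV aut_flag1.
Qed.

Lemma same_orbitP f h : same_orbit f h <-> exists2 g, g \in autG & aut_flag g f = h.
Proof.
split=> [[g [gA e]]|[g /autP gA e]]; exists g; rewrite ?e //.
by apply/autP.
Qed.

Lemma same_orbit_refl f : same_orbit f f.
Proof. by apply/same_orbitP; exists 1; rewrite ?group1 ?aut_flag1. Qed.

Lemma same_orbit_sym f h : same_orbit f h -> same_orbit h f.
Proof.
case/same_orbitP=> g gA <-; apply/same_orbitP; exists g^-1; rewrite ?groupV //.
by rewrite -aut_flagM mulgV aut_flag1.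
Qed.

Lemma same_orbit_trans f h (k : flag) : same_orbit f h -> same_orbit h k -> same_orbit f k.
Proof.
case/same_orbitP=> g gA <- /same_orbitP[g' gA' <-]; apply/same_orbitP.
by exists (g * g'); rewrite ?groupM // aut_flagM.
Qed.

Lemma same_orbit_adj f h i : is_flag f -> same_orbit f h ->
  same_orbit (adj i f) (adj i h).
Proof.
move=> ff /same_orbitP[g gA <-]; apply/same_orbitP; exists g => //.
by rewrite aut_adj //; apply/autP.
Qed.

(** [lift_map] turns the inclusion of word stabilizers into a map sending f to its i-neighbour.
    Conjugating words by the letter i gives the reverse inclusion, whose lifted map cancels the
    first. *)
Lemma refl_orbit f i : is_flag f ->
  (forall w, adjw w f = f -> adjw w (adj i f) = adj i f) -> same_orbit f (adj i f).
Proof.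
move=> ff H; have af := adj_flag hP i ff.
have H' w : adjw w (adj i f) = adj i f -> adjw w f = f.
  move=> e; have : adjw ([:: i] ++ w ++ [:: i]) f = f by rewrite !adjw_cat /= e adjK.
  move/H; rewrite !adjw_cat /= adjK // => /(congr1 (adj i)).
  by rewrite !adjK ?adjw_flag.
have ext (f1 f2 : flag) : is_flag f1 -> is_flag f2 -> (forall w, adjw w f1 = f1 -> adjw w f2 = f2) ->
    forall w w', adjw w f1 = adjw w' f1 -> adjw w f2 = adjw w' f2.
  move=> ff1 ff2 H12 w w' e.
  have : adjw (w ++ rev w') f1 = f1 by rewrite adjw_cat e adjw_rev.
  move/H12; rewrite adjw_cat => /(congr1 (adjw w')).
  by rewrite -{1}(revK w') adjw_rev // adjw_flag.
have [u [uw ul]] := lift_map hP hP ff af (ext _ _ ff af H).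
have [v [vw vl]] := lift_map hP hP af ff (ext _ _ af ff H').
have thru (f1 : flag) x : is_flag f1 -> exists w k, adjw w f1 k = x.
  move=> ff1; have [h [hf hx _]] := flag_thru hP (le_refl hP x).
  by have [w ew _] := flag_conn hP ff1 hf; exists w, (inord (rk x)); rewrite ew.
have uv : cancel u v by move=> x; have [w [k <-]] := thru f x ff; rewrite uw vw.
exists (perm (can_inj uv)); split.
  move=> x y; rewrite !permE; apply/idP/idP; last exact: ul.
  by move/vl; rewrite !uv.
by apply/ffunP=> k; rewrite ffunE permE; have := uw [::] k.
Qed.

End Automorphisms.

(** * Chiral polytopes and their rotations *)

Section Chiral.
Variables (P : Raw) (n : nat).
Local Notation T := (carrier P).
Local Notation le := (@rle P).
Local Notation rk := (@rrk P).
Local Notation flag := (flagT P n).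
Implicit Types (f h : flag) (x y : T) (i j : 'I_n) (w : seq 'I_n) (g : {perm T}).
Hypothesis hC : chiral P n.
Let hP : is_polytope P n. Proof. by case: hC. Qed.
Let G := autG P.

Lemma adj_not_orbit f i : is_flag f -> ~ same_orbit f (adj i f).
Proof. by move=> ff; case: hC => _ [H _]; apply: H; apply: adjP. Qed.

Lemma adj2_orbit f i j : is_flag f -> same_orbit f (adj j (adj i f)).
Proof.
move=> ff; have af := adj_flag hP i ff; have aaf := adj_flag hP j af.
case: hC => _ [_ H]; case: (H _ _ _ ff af aaf) => [/(adj_not_orbit ff) //|[//|]].
by move/(adj_not_orbit af).
Qed.

Lemma even_word_orbit f w : is_flag f -> ~~ odd (size w) -> same_orbit f (adjw w f).
Proof.
have [m] := ubnP (size w); elim: m w f => // m IH [|i [|j w]] f //=.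
  by move=> _ _ _; apply: same_orbit_refl.
rewrite negbK => sm ff ev; apply: same_orbit_trans (adj2_orbit i j ff) _.
by apply: IH => //; [move: sm; rewrite ltnS; apply: ltnW | rewrite !adj_flag].
Qed.

Lemma odd_word_orbit f w : is_flag f -> odd (size w) -> ~ same_orbit f (adjw w f).
Proof.
case/lastP: w => [|w i] //; rewrite size_rcons /= => ff ev.
rewrite -cats1 adjw_cat /= => fo; apply: (@adj_not_orbit (adjw w f) i).
  exact: adjw_flag.
by apply: same_orbit_trans fo; apply/same_orbit_sym/even_word_orbit.
Qed.

Lemma fix_word_even f w : is_flag f -> adjw w f = f -> ~~ odd (size w).
Proof.
by move=> ff e; apply/negP=> /(odd_word_orbit ff); rewrite e; apply; apply: same_orbit_refl.
Qed.

Lemma flag_orbits f h i : is_flag f -> is_flag h ->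
  same_orbit f h \/ same_orbit (adj i f) h.
Proof.
move=> ff hf; have [w <- _] := flag_conn hP ff hf.
have [o|/negbTE ev] := boolP (odd (size w)); last by left; apply: even_word_orbit; rewrite ?ev.
right; rewrite -{2}(adjK hP i ff) -[adjw w _]/(adjw (i :: w) (adj i f)).
by apply: even_word_orbit; rewrite ?adj_flag //= o.
Qed.

(** Otherwise f and its image would be adjacent flags in one orbit. *)
Lemma fix_all_but f g i : is_flag f -> g \in G ->
  (forall k, k != idx i -> g (f k) = f k) -> g = 1.
Proof.
move=> ff gG H; have gA : is_aut g by apply/autP.
have [e|ne] := eqVneq (f (idx i)) (g (f (idx i))).
  apply: (aut_free hP gA ff); apply/ffunP=> k; rewrite ffunE.
  by have [->|/H//] := eqVneq k (idx i).
case: hC => _ [nadj _]; case: (nadj (idx i) f (aut_flag g f)).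
  apply/and4P; split=> //; [exact: aut_is_flag | by rewrite ffunE |].
  by apply/forallP=> k; apply/implyP=> ki; rewrite ffunE H.
by apply/same_orbitP; exists g.
Qed.

Lemma fix_proper_but f g i : is_flag f -> g \in G ->
  (forall l, l != i -> g (f (idx l)) = f (idx l)) -> g = 1.
Proof.
move=> ff gG H; have gA : is_aut g by apply/autP.
apply: (fix_all_but (i := i) ff gG) => k ki.
have [k0|k0] := posnP k.
  by apply: (le_rk_eq hP); [apply: (rk0_le hP) |]; rewrite ?(aut_rk hP) ?flag_rk.
have [kn|kn] := leqP n.+1 k.
  have ek : nat_of_ord k = n.+1 by apply/eqP; rewrite eqn_leq kn -ltnS ltn_ord.
  by apply: (le_rk_eq hP); [apply: (rkn_le hP) |]; rewrite ?(aut_rk hP) ?flag_rk.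
have kn' : k.-1 < n by rewrite -ltnS prednK.
have ek : k = idx (Ordinal kn') by apply: ord_inj; rewrite val_idx /= prednK.
rewrite ek; apply: H; apply: contraNneq ki => <-; exact/eqP.
Qed.

Lemma num_flags_aut f i : is_flag f -> num_flags P n = (2 * #|G|)%N.
Proof.
move=> ff; have af := adj_flag hP i ff.
have cardO (h : flag) : is_flag h -> #|[set aut_flag g h | g in G]| = #|G|.
  by move=> hf; rewrite card_in_imset // => g g' gG gG'; apply: aut_inj.
have -> : num_flags P n = #|[set aut_flag g f | g in G] :|: [set aut_flag g (adj i f) | g in G]|.
  congr #|pred_of_set _|; apply/setP=> h; rewrite !inE; apply/idP/orP=> [hf|].
    case: (flag_orbits i ff hf) => /same_orbitP[g gG e]; [left|right];
      by apply/imsetP; exists g.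
  by case=> /imsetP[g /autP gA ->]; apply: aut_is_flag.
rewrite cardsU !cardO // disjoint_setI0 ?cards0 ?subn0 ?addnn ?mul2n //.
rewrite -setI_eq0; apply/eqP/setP=> h; rewrite !inE; apply/andP=> [] [/imsetP[g gG ->]].
case/imsetP=> g' gG' e; apply: (@adj_not_orbit f i) => //.
apply: (@same_orbit_trans _ _ _ (aut_flag g f)); first by apply/same_orbitP; exists g.
by rewrite e; apply/same_orbit_sym/same_orbitP; exists g'.
Qed.

(** Unique because automorphisms act freely on flags; on flags the default is never taken. *)
Definition rot f i j : {perm T} := odflt 1 [pick g in G | aut_flag g f == adj j (adj i f)].

Lemma rotP f i j : is_flag f ->
  rot f i j \in G /\ aut_flag (rot f i j) f = adj j (adj i f).
Proof.
move=> ff; rewrite /rot; case: pickP => [g /andP[gG /eqP e] //|H].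
have /same_orbitP[g gG e] := adj2_orbit i j ff.
by have := H g; rewrite gG e eqxx.
Qed.

Lemma rot_eq f i j g : is_flag f -> g \in G -> aut_flag g f = adj j (adj i f) ->
  g = rot f i j.
Proof.
move=> ff gG e; have [rG er] := rotP i j ff; apply: (aut_inj hP gG rG ff).
by rewrite e er.
Qed.

(** Automorphisms commute with adjacencies and permutations compose left to right, so the
    adjacencies of the second factor act first on the flag. *)
Lemma rot_mul f i j k : is_flag f -> rot f i j * rot f k i = rot f k j.
Proof.
move=> ff; have [rG er] := rotP i j ff; have [rG' er'] := rotP k i ff.
apply: rot_eq => //; first by rewrite groupM.
rewrite aut_flagM er !aut_adj //; try exact/autP; last exact: adj_flag.
by rewrite er' adjK // adj_flag.
Qed.

Lemma rot_inv f i j : is_flag f -> (rot f i j)^-1 = rot f j i.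
Proof.
move=> ff; apply: (mulgI (rot f i j)); rewrite mulgV rot_mul //.
apply: rot_eq => //; rewrite ?group1 // aut_flag1 adjK //.
Qed.

Lemma rot_invol f i j : is_flag f -> i.+1 < j -> rot f j i ^+ 2 = 1.
Proof.
move=> ff ij; suff e : rot f j i = rot f i j by rewrite expg2 {2}e -(rot_inv j i ff) mulgV.
by have [rG er] := rotP j i ff; apply: rot_eq => //; rewrite er adj_comm.
Qed.

Lemma rot_fix f i j (k : 'I_n.+2) : is_flag f -> k != idx i -> k != idx j ->
  rot f i j (f k) = f k.
Proof.
move=> ff ki kj; have [_ /ffunP/(_ k)] := rotP i j ff; rewrite ffunE => ->.
by rewrite !adj_out ?adj_flag.
Qed.

(* Orbits of flags under the dihedral group of two consecutive adjacencies. *)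
Lemma dihedral_word f i j w : is_flag f -> {subset w <= [:: i; j]} ->
  exists2 g, g \in <[rot f j i]> &
    adjw w f = aut_flag g f \/ adjw w f = aut_flag g (adj i f).
Proof.
move=> ff; have [rG er] := rotP j i ff.
have sG : {subset <[rot f j i]> <= G} by apply/subsetP; rewrite cycle_subG.
have af := adj_flag hP i ff.
elim/last_ind: w => [|w k IH] sw.
  by exists 1; rewrite ?group1 // aut_flag1; left.
have [|g gr gw] := IH; first by move=> l lw; apply: sw; rewrite mem_rcons inE lw orbT.
have gA : is_aut g by apply/autP/sG.
rewrite -cats1 adjw_cat /=.
have : k \in [:: i; j] by apply: sw; rewrite mem_rcons mem_head.
have sA : is_aut (rot f j i) by apply/autP.
have ej : adj j f = aut_flag (rot f j i) (adj i f) by rewrite aut_adj // er adjK ?adj_flag.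
have ej' : adj j (adj i f) = aut_flag (rot f j i)^-1 f.
  by rewrite rot_inv //; case: (rotP i j ff).
rewrite !inE => /orP[] /eqP->; case: gw => ->.
- by exists g => //; right; rewrite aut_adj.
- by exists g => //; left; rewrite -aut_adj // adjK.
- by exists (rot f j i * g); rewrite ?groupM ?cycle_id //; right; rewrite -aut_adj // ej aut_flagM.
exists ((rot f j i)^-1 * g); first by rewrite groupM ?groupV ?cycle_id.
by left; rewrite -aut_adj // ej' aut_flagM.
Qed.

(** The cyclic group of the rotation acts simply transitively on these faces of the polygon:
    transitively by [dihedral_word], freely by [fix_all_but]. *)
Lemma order_rot f i j : is_flag f -> j = i.+1 :> nat ->
  #|[set z | [&& le (fn f i) z, le z (fn f i.+3) & rk z == i.+2]]| = #[rot f j i].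
Proof.
move=> ff ij; have jn : i.+1 < n by rewrite -ij.
have [rG er] := rotP j i ff.
have sG : {subset <[rot f j i]> <= G} by apply/subsetP; rewrite cycle_subG.
have idij : idx j != idx i by rewrite -val_eqE /= !val_idx ij gtn_eqF.
have fixr g (k : 'I_n.+2) : g \in <[rot f j i]> -> k != idx i -> k != idx j -> g (f k) = f k.
  move=> /cycleP[m ->] ki kj; elim: m => [|m IH]; first by rewrite perm1.
  by rewrite expgSr permM IH rot_fix.
rewrite -[#[_]]/#|<[rot f j i]>|.
have <- : [set (g : {perm T}) (f (idx j)) | g in <[rot f j i]>] =
   [set z | [&& le (fn f i) z, le z (fn f i.+3) & rk z == i.+2]].
  apply/setP=> z; rewrite inE; apply/imsetP/and3P.
    case=> g gr ->; have gA : is_aut g by apply/autP/sG.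
    have fi : g (fn f i) = fn f i.
      by apply: fixr => //; rewrite -val_eqE /= val_idx inordK ?ij ?ltn_eqF // ltnS ltnW // ltnW // ltnW.
    have fi3 : g (fn f i.+3) = fn f i.+3.
      by apply: fixr => //; rewrite -val_eqE /= val_idx inordK ?ij ?gtn_eqF //.
    rewrite -{1}fi -{1}fi3 !gA (aut_rk hP _ gA) idx_fn ij.
    have i2n : i.+2 <= n.+1 by rewrite ltnW.
    by rewrite !fn_le ?fn_rk ?i2n ?eqxx ?leqnSn ?(leqW (leqnSn _)).
  case=> iz zi /eqP rz.
  have lt1 : rlt (fn f i) z.
    rewrite /rlt iz; apply/eqP=> /(congr1 rk); rewrite rz fn_rk //; last by rewrite ltnW // ltnS ltnW // ltnW.
    by move/eqP; rewrite ltn_eqF // ltnW.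
  have [y [iy yz ry]] := rank_succ hP lt1.
  rewrite fn_rk // in ry; last by rewrite ltnW // ltnS ltnW // ltnW.
  (* Replacing the two middle faces of f by y and z gives a flag differing from f only in ranks i
     and j. *)
  pose h k := if k == i.+1 then y else if k == i.+2 then z else fn f k.
  have [k kn|k kn|f' ff' fh] := @flag_intro P n hP h.
  - rewrite /h; case: eqP => [->//|_]; case: eqP => [->//|_]; exact: fn_rk.
  - rewrite /h !eqSS; have [->|k1] := eqVneq k i.
      by rewrite !ltn_eqF // ltnW.
    have [ek|k2] := eqVneq k i.+1; first by rewrite ?ek.
    have [ek|k3] := eqVneq k i.+2; first by rewrite ek.
    by apply: fn_le => //; rewrite leqnSn.
  have [w ew wi] := flag_conn hP ff ff'.
  have sw : {subset w <= [:: i; j]}.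
    move=> k /wi; rewrite !idx_fn fh; last by rewrite ltnS ltnW.
    rewrite /h !eqSS !inE -!val_eqE /= ij.
    case: (eqVneq (k : nat) i) => //= ki; case: (eqVneq (k : nat) i.+1) => //= kj.
    by rewrite eqxx.
  have [g gr gw] := dihedral_word ff sw; exists g => //.
  have zf : z = f' (idx j) by rewrite idx_fn ij fh ?ltnS ?(ltnW jn) // /h eqxx gtn_eqF.
  rewrite zf -ew; case: gw => ->; rewrite ffunE //.
  by rewrite adj_out.
rewrite card_in_imset // => g g' gr gr' e.
apply: (mulIg g'^-1); rewrite mulgV; apply: (@fix_all_but f _ i) => //.
  by rewrite groupM ?groupV ?sG.
move=> k ki; rewrite permM; have [->|kj] := eqVneq k (idx j); first by rewrite e permK.
by rewrite fixr // fixr ?groupV.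
Qed.

End Chiral.

(** * Polygonal sections and the entries of the type *)

Section Types.
Variables (P : Raw) (n : nat).
Local Notation T := (carrier P).
Local Notation le := (@rle P).
Local Notation rk := (@rrk P).
Local Notation flag := (flagT P n).
Implicit Types (f h : flag) (x y : T) (i j : 'I_n) (g : {perm T}).
Hypothesis hC : chiral P n.
Let hP : is_polytope P n. Proof. by case: hC. Qed.

Lemma card_polygon f i j x y : is_flag f -> j = i.+1 :> nat ->
  rk x = i -> rk y = i.+3 -> le x y ->
  #|[set z | [&& le x z, le z y & rk z == i.+2]]| = #[rot f j i].
Proof.
move=> ff ij rx ry lxy; have jn : i.+1 < n by rewrite -ij.
have [h [hf hx hy]] := flag_thru hP lxy.
rewrite rx in hx; rewrite ry in hy.
have i_le : i <= n.+1 by rewrite ltnW // ltnS ltnW.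
have [g gG [ex ey]] : exists2 g, g \in autG P & g (fn f i) = x /\ g (fn f i.+3) = y.
  case: (flag_orbits hC i ff hf) => /same_orbitP[g gG /ffunP e]; exists g => //.
    by rewrite -hx -hy /fn -!e !ffunE.
  rewrite -hx -hy /fn -!e !ffunE !(adj_out hP) // -val_eqE /= val_idx inordK //.
    by rewrite gtn_eqF.
  by rewrite ltn_eqF.
have gA : is_aut g by apply/autP.
rewrite -(order_rot hC ff ij) -[RHS](card_imset _ (@perm_inj _ g)); congr #|pred_of_set _|.
apply/setP=> z; rewrite inE; apply/idP/imsetP.
  case/and3P=> xz zy rz; exists (g^-1 z); last by rewrite permKV.
  rewrite inE -(aut_rk hP (g^-1 z) gA) permKV rz andbT.
  by rewrite -gA permKV ex xz -gA permKV ey zy.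
case=> u; rewrite inE => /and3P[xu uy ru] ->.
by rewrite -ex -ey !gA xu uy (aut_rk hP).
Qed.

Lemma has_type_rot f i j ps : is_flag f -> j = i.+1 :> nat -> has_type P n ps ->
  nth 0 ps i = #[rot f j i].
Proof.
move=> ff ij [_ H]; have jn : i.+1 < n by rewrite -ij.
have i_le : i <= n.+1 by rewrite ltnW // ltnS ltnW.
have n1 : 0 < i.+1 <= n.-1 by apply/andP; split=> //; rewrite -ltnS (ltn_predK jn).
rewrite -(order_rot hC ff ij) -(H i.+1 n1 (fn f i) (fn f i.+3)) ?fn_rk //.
by apply: fn_le => //; apply/andP; split; [rewrite !leqW | exact: jn].
Qed.

End Types.

(** * Words in adjacencies and words in rotations *)

Definition o0 : 'I_3 := @Ordinal 3 0 isT.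
Definition o1 : 'I_3 := @Ordinal 3 1 isT.
Definition o2 : 'I_3 := @Ordinal 3 2 isT.

Definition letter_adj (l : bool * bool) : seq 'I_3 :=
  match l with
  | (true, false) => [:: o1; o0] | (true, true) => [:: o0; o1]
  | (false, false) => [:: o2; o1] | (false, true) => [:: o1; o2]
  end.

(** The order is reversed: a product of rotations applies the adjacencies of its last factor first,
    as in [rot_mul]. *)
Fixpoint word_adj (w : seq (bool * bool)) : seq 'I_3 :=
  if w is l :: w' then word_adj w' ++ letter_adj l else [::].

Definition pair_rot (i j : nat) : seq (bool * bool) :=
  match i, j with
  | 1, 0 => [:: (true, false)] | 0, 1 => [:: (true, true)]
  | 2, 1 => [:: (false, false)] | 1, 2 => [:: (false, true)]
  | 2, 0 => [:: (true, false); (false, false)]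
  | 0, 2 => [:: (false, true); (true, true)]
  | _, _ => [::]
  end.

Fixpoint word_rot (u : seq 'I_3) : seq (bool * bool) :=
  if u is i :: j :: u' then word_rot u' ++ pair_rot i j else [::].

Section WordAction.
Variables (P : Raw) (n : nat) (f : flagT P n) (e : 'I_3 -> 'I_n).
Hypothesis hC : chiral P n.
Hypothesis ff : is_flag f.
Let hP : is_polytope P n. Proof. by case: hC. Qed.
Let a := rot f (e o1) (e o0).
Let b := rot f (e o2) (e o1).

Lemma ev_autG w : ev a b w \in autG P.
Proof.
have [aG _] := rotP hC (e o1) (e o0) ff; have [bG _] := rotP hC (e o2) (e o1) ff.
by elim: w => [|[[] []] w IH] /=; rewrite ?group1 // /letter_val /= groupM ?groupV.
Qed.

Lemma ev_word w : aut_flag (ev a b w) f = adjw (map e (word_adj w)) f.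
Proof.
elim: w => [|l w IH] /=; first by rewrite aut_flag1.
rewrite aut_flagM map_cat adjw_cat -IH.
have -> : aut_flag (letter_val a b l) f = adjw (map e (letter_adj l)) f.
  case: l => [[] []]; rewrite /letter_val /= /a /b ?rot_inv //=;
    by match goal with |- aut_flag (rot _ ?i ?j) _ = _ => case: (rotP hC i j ff) end.
by apply: aut_adjw => //; apply/autP; exact: ev_autG.
Qed.

(** An even word is read two letters at a time, and each pair of adjacencies is a rotation that
    [pair_rot] writes in [a] and [b]. *)
Lemma word_ev u : ~~ odd (size u) -> aut_flag (ev a b (word_rot u)) f = adjw (map e u) f.
Proof.
have [m] := ubnP (size u); elim: m u => // m IH [|i [|j u]] //=.
  by move=> _ _; rewrite aut_flag1.
rewrite negbK ltnS => sm ev_u; rewrite ev_cat.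
have [rG er] := rotP hC (e i) (e j) ff.
have -> : ev a b (pair_rot i j) = rot f (e i) (e j).
  have r1 (k : 'I_3) : rot f (e k) (e k) = 1.
    by apply/esym; apply: rot_eq; rewrite ?group1 ?aut_flag1 ?adjK.
  case: i j {er rG} => [[|[|[|//]]] hi] [[|[|[|//]]] hj] /=; rewrite /letter_val /= ?mulg1;
    rewrite ?(bool_irrelevance hi isT) ?(bool_irrelevance hj isT) -/o0 -/o1 -/o2 ?r1 //.
  - by rewrite /a rot_inv.
  - by rewrite /a /b !rot_inv // rot_mul.
  - by rewrite /b rot_inv.
  - by rewrite /a /b rot_mul.
rewrite aut_flagM IH //; last by rewrite ltnW.
by rewrite aut_adjw // ?er //; apply/autP.
Qed.

(** Seen from the flag adjacent to f in the middle rank, both generators are inverted; this is why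
    [reg] tests for a reflection. *)
Lemma rot_mirror (g := adj (e o1) f) :
  rot g (e o1) (e o0) = a^-1 /\ rot g (e o2) (e o1) = b^-1.
Proof.
have gf : is_flag g by apply: adj_flag.
have [aG ea] := rotP hC (e o0) (e o1) ff; have [bG eb] := rotP hC (e o1) (e o2) ff.
rewrite /a /b !rot_inv //; split; apply/esym; apply: rot_eq => //.
  by rewrite aut_adj ?ea ?adjK ?adj_flag //; apply/autP.
by rewrite aut_adj ?eb ?adjK ?adj_flag //; apply/autP.
Qed.

End WordAction.

(** If inversion were well defined, [rot_mirror] would show that each word fixing f fixes its
    neighbour, and [refl_orbit] would produce a reflection. *)
Lemma chiral_not_reg (Q : Raw) (f : flagT Q 3) : chiral Q 3 -> is_flag f ->
  ~ reg (rot f o1 o0) (rot f o2 o1) 1.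
Proof.
move=> hC ff rg; have hP : is_polytope Q 3 by case: hC.
apply: (adj_not_orbit hC (i := o1) ff); apply: refl_orbit => // u eu.
have evu := fix_word_even hC ff eu.
have := word_ev id hC ff evu; rewrite map_id eu => e1.
have w1 : ev (rot f o1 o0) (rot f o2 o1) (word_rot u) = 1.
  by apply: (aut_free hP _ ff e1); apply/autP; exact: (ev_autG id hC ff).
have af := adj_flag hP o1 ff.
have := word_ev id hC af evu; rewrite map_id => <-.
have [-> ->] := rot_mirror id hC ff.
have := rg (word_rot u); rewrite w1 group1 => /(_ isT)/set1gP->.
exact: aut_flag1.
Qed.

(** * The rotation group of a tight chiral 4-polytope *)

Definition l0 : 'I_4 := @Ordinal 4 0 isT.
Definition l1 : 'I_4 := @Ordinal 4 1 isT.
Definition l2 : 'I_4 := @Ordinal 4 2 isT.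
Definition l3 : 'I_4 := @Ordinal 4 3 isT.

Section Rank4.
Variables (P : Raw) (f : flagT P 4).
Hypothesis hC : chiral P 4.
Hypothesis hT : tight P 4.
Hypothesis ff : is_flag f.
Let hP : is_polytope P 4. Proof. by case: hC. Qed.
Let G := autG P.
Let a := rot f l1 l0.
Let b := rot f l2 l1.
Let c := rot f l3 l2.

Definition face_stab (i : 'I_4) : {set {perm carrier P}} :=
  [set g in G | g (f (idx i)) == f (idx i)].

Lemma face_stab_group i : group_set (face_stab i).
Proof.
apply/group_setP; split; first by apply/setIdP; rewrite group1 perm1.
move=> g h /setIdP[gG /eqP eg] /setIdP[hG /eqP eh].
by apply/setIdP; rewrite groupM // permM eg eh.
Qed.
Canonical face_stab_grp i := Group (face_stab_group i).

Lemma rot_stab i j k : k != i -> k != j -> rot f i j \in face_stab k.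
Proof.
move=> ki kj; have [rG _] := rotP hC i j ff; apply/setIdP; split=> //.
by rewrite rot_fix // (inj_eq (@idx_inj 4)).
Qed.

Lemma cycle_rot_fix i j k g : g \in <[rot f i j]> -> k != i -> k != j -> g \in face_stab k.
Proof. by move=> gr ki kj; apply: subsetP gr; rewrite cycle_subG rot_stab. Qed.

Lemma stab3_trivial i g : (forall k, k != i -> g \in face_stab k) -> g = 1.
Proof.
move=> H; have [k0 k0i] : exists k, k != i.
  by case: i {H} => [[|i] hi]; [exists l1 | exists l0].
have gG : g \in G by case/setIdP: (H k0 k0i).
by apply: (fix_proper_but hC (i := i) ff gG) => k /H /setIdP[_ /eqP].
Qed.

Lemma K_stab : <[a]> <*> <[b]> \subset face_stab l3.
Proof. by rewrite join_subG !cycle_subG !rot_stab. Qed.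

Lemma L_stab : <[b]> <*> <[c]> \subset face_stab l0.
Proof. by rewrite join_subG !cycle_subG !rot_stab. Qed.

(** Powers of c fix the base faces of ranks 0 and 1; fixing also the one of rank 3 leaves a single
    rank free, and chirality makes such an automorphism trivial. *)
Lemma stab_TIc : face_stab l3 :&: <[c]> = 1.
Proof.
apply/trivgP/subsetP=> g /setIP[g3 gc]; apply/set1gP/(stab3_trivial (i := l2)) => k.
by case: k => [[|[|[|[|//]]]] hk] k2 //; rewrite ?(cycle_rot_fix gc) // -[Ordinal _]/l3
   (bool_irrelevance hk isT).
Qed.

Lemma stab_TIa : <[a]> :&: face_stab l0 = 1.
Proof.
apply/trivgP/subsetP=> g /setIP[ga g0]; apply/set1gP/(stab3_trivial (i := l1)) => k.
by case: k => [[|[|[|[|//]]]] hk] k2 //; rewrite ?(cycle_rot_fix ga) // (bool_irrelevance hk isT).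
Qed.

Lemma tight_order : #|G| = (#[a] * #[b] * #[c])%N.
Proof.
have [_ [ps [hty nf]]] := hT; have [sz _] := hty.
apply/eqP; rewrite -(eqn_pmul2l (isT : 0 < 2)) -(num_flags_aut hC l0 ff) nf eqn_pmul2l //.
case: ps sz hty {nf} => [|p [|q [|r [|//]]]] // _ hty.
rewrite !big_cons big_nil muln1 mulnA.
rewrite -(has_type_rot hC (i := l0) (j := l1) ff erefl hty).
rewrite -(has_type_rot hC (i := l1) (j := l2) ff erefl hty).
by rewrite -(has_type_rot hC (i := l2) (j := l3) ff erefl hty).
Qed.

Lemma rots_sub : <[a]> <*> <[b]> <*> <[c]> \subset G.
Proof.
have rG i j : rot f i j \in G by case: (rotP hC i j ff).
by rewrite !join_subG !cycle_subG !rG.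
Qed.

Lemma rots_triple : tight_triple a b c.
Proof.
split.
  split; rewrite /a /b /c ?rot_mul //; exact: rot_invol.
split.
- by apply/trivgP; rewrite /= -stab_TIa setIS // L_stab.
- by apply/trivgP; rewrite /= -stab_TIc setSI // K_stab.
by rewrite -tight_order subset_leq_card ?rots_sub.
Qed.

Lemma rots_gen : <[a]> <*> <[b]> <*> <[c]> = G.
Proof.
by apply/eqP; rewrite eqEcard rots_sub tight_order (triple_card rots_triple) leqnn.
Qed.

(** The stabilizer meets <c> trivially, so its order is at most |G|/|c|; hence it is exactly <a,
    b>. *)
Lemma card_stab3 : #|face_stab l3| = (#[a] * #[b])%N.
Proof.
apply/eqP; rewrite eqn_leq; apply/andP; split.
  rewrite -(leq_pmul2r (order_gt0 c)) -tight_order -TI_cardMg ?stab_TIc //.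
  rewrite subset_leq_card // mulG_subG cycle_subG (proj1 (rotP hC _ _ ff)) andbT.
  by apply/subsetP=> g /setIdP[].
by rewrite -(triple_cardK rots_triple) subset_leq_card ?K_stab.
Qed.

Lemma card_stab0 : #|face_stab l0| = (#[b] * #[c])%N.
Proof.
apply/eqP; rewrite eqn_leq; apply/andP; split.
  rewrite -(leq_pmul2l (order_gt0 a)) mulnA -tight_order -TI_cardMg ?stab_TIa //.
  rewrite subset_leq_card // mulG_subG cycle_subG (proj1 (rotP hC _ _ ff)) /=.
  by apply/subsetP=> g /setIdP[].
by rewrite -(tight_card (triple_tpL rots_triple)) subset_leq_card ?L_stab.
Qed.

End Rank4.

(** * Facets and vertex-figures *)

(* Facets ([o = 0]) and vertex-figures ([o = 1]) are treated together: the section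
   between the faces of shifted rank [o] and [o + 4] of the base flag [f]. *)
Section FacetVertex.
Variables (P : Raw) (f : flagT P 4) (o : nat).
Hypothesis hC : chiral P 4.
Hypothesis ff : is_flag f.
Hypothesis ho : o <= 1.
Let hP : is_polytope P 4. Proof. by case: hC. Qed.
Local Notation S := (section (fn f o) (fn f (o + 4))).
Implicit Types (g : flagT S 3).

Definition eo (i : 'I_3) : 'I_4 := inord (o + i).

Let o4 : o + 4 <= 5. Proof. by rewrite addnC (leq_add2l 4 o 1). Qed.
Let o5 : o <= 5. Proof. exact: leq_trans ho _. Qed.

Lemma val_eo i : eo i = o + i :> nat.
Proof. by rewrite inordK //; case: i => i /= hi; rewrite -addnS (leq_add ho hi). Qed.

Definition inr k := o <= k <= o + 4.

Definition ext g : flagT P 4 :=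
  [ffun k : 'I_6 => if inr k then val (fn g (k - o)) else f k].

Lemma ext_fn g k : k <= 5 -> fn (ext g) k = if inr k then val (fn g (k - o)) else fn f k.
Proof. by move=> k5; rewrite /fn ffunE inordK. Qed.

Lemma sec_rk (x : carrier S) : rrk (val x) = (rrk x + o)%N.
Proof.
have /andP[ox _] := valP x; rewrite /rrk /= -[@rrk P (fn f o)]/(rrk (fn f o)).
by rewrite fn_rk // subnK // -[X in X <= _](fn_rk ff o5) (le_rk hP).
Qed.

Lemma ext_flag g : is_flag g -> is_flag (ext g).
Proof.
move=> gf; have [k k5|k k5|h hf eh] := @flag_intro P 4 hP (fn (ext g)).
- rewrite ext_fn //; case: ifP => [/andP[ok k4]|_]; last exact: fn_rk.
  by rewrite sec_rk fn_rk ?subnK // leq_subLR.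
- rewrite !ext_fn ?(ltnW k5) //.
  case: ifP => ik; case: ifP => ik1.
  + have /andP[ok _] := ik; have /andP[_ k4] := ik1.
    have := @fn_le _ _ g (k - o) (k.+1 - o) gf.
    by apply; rewrite leq_sub2r //= leq_subLR.
  + have /andP[ok k4] := ik; have /andP[_ xo] := valP (fn g (k - o)).
    have ek : k = (o + 4)%N.
      apply/eqP; rewrite eqn_leq k4 /=; move: ik1; rewrite /inr (leqW ok) /=.
      by move/negbT; rewrite -ltnNge ltnS.
    apply: (le_trans hP) xo _; rewrite -ek; apply: fn_le => //.
    by rewrite leqnSn.
  + have /andP[ok k4] := ik1; have /andP[xo _] := valP (fn g (k.+1 - o)).
    apply: (le_trans hP) _ xo; apply: fn_le => //; rewrite o5 andbT.
    rewrite leqNgt; apply/negP=> ok1; move: ik; rewrite /inr (ltnW ok1) /=.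
    by rewrite ltnW.
  by apply: fn_le => //; rewrite leqnSn.
suff -> : ext g = h by [].
by apply/ffunP=> k; rewrite -!fnE eh // -ltnS.
Qed.

Lemma ext_ends g k : is_flag g -> (k = o) \/ (k = o + 4)%N -> fn (ext g) k = fn f k.
Proof.
move=> gf ek; have ik : inr k by case: ek => ->; rewrite /inr ?leqnn ?leq_addr.
have k5 : k <= 5 by case: ek => ->.
have rg : rrk (fn (ext g) k) = rrk (fn f k) by rewrite !fn_rk // ext_flag.
rewrite ext_fn // ik in rg *; have /andP[le1 le2] := valP (fn g (k - o)).
case: ek rg => ek rg; first by apply/esym/(le_rk_eq hP); rewrite ?rg // {1}ek.
by apply: (le_rk_eq hP); rewrite ?rg // {2}ek.
Qed.

Lemma ext_inj : injective ext.
Proof.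
move=> g h e; apply/ffunP=> k; apply: val_inj.
have k5 : k + o <= 5 by rewrite addnC (leq_trans _ o4) // leq_add2l -ltnS.
have := congr1 (fun u => fn u (k + o)) e; rewrite !ext_fn // /inr leq_addl addnC leq_add2l.
by rewrite -ltnS ltn_ord /= addKn !fnE.
Qed.

Lemma ext_idx g i : ext g (idx (eo i)) = val (g (idx i)).
Proof.
have i5 : o + i.+1 <= 5 by rewrite (leq_trans _ o4) // leq_add2l ltnW // ltnS.
rewrite idx_fn val_eo -addnS ext_fn // /inr leq_addr leq_add2l addKn.
by rewrite (leq_trans (ltn_ord i)).
Qed.

Lemma ext_adjacent g h i : adjacent (idx i) g h -> adjacent (idx (eo i)) (ext g) (ext h).
Proof.
case/and4P=> gf hf gh /forallP H; apply/and4P; split; rewrite ?ext_flag //.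
  by rewrite !ext_idx (inj_eq val_inj).
apply/forallP=> k; apply/implyP=> ki; rewrite !ffunE; case: ifP => // /andP[ok k4].
rewrite /fn (eqP (implyP (H _) _)) // -val_eqE /= inordK ?ltnS ?leq_subLR // val_idx.
move: ki; rewrite -val_eqE /= val_idx val_eo -addnS; apply: contra => /eqP <-.
by rewrite subnKC.
Qed.

Lemma ext_surj (h : flagT P 4) : is_flag h ->
  (forall k, k <= 5 -> (k <= o) || (o + 4 <= k) -> fn h k = fn f k) ->
  exists2 g, is_flag g & ext g = h.
Proof.
move=> hf H.
have ho1 : fn h o = fn f o by apply: H; rewrite ?leqnn.
have ho2 : fn h (o + 4) = fn f (o + 4) by apply: H; rewrite ?leqnn ?orbT.
have inS k : inr k -> rle (fn f o) (fn h k) && rle (fn h k) (fn f (o + 4)).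
  move=> /andP[ok k4]; rewrite -ho1 -ho2 !fn_le ?ok ?k4 //.
  exact: leq_trans k4 o4.
(* Only the default of [insubd], which [gv] shows is never taken. *)
pose x0 : carrier S := exist _ (fn h o) (inS o (introT andP (conj (leqnn o) (leq_addr 4 o)))).
pose g : flagT S 3 := [ffun k : 'I_5 => insubd x0 (fn h (k + o))].
have gv (k : 'I_5) : val (g k) = fn h (k + o).
  rewrite ffunE insubdK // unfold_in; apply: (inS _).
  by rewrite /inr leq_addl addnC leq_add2l -ltnS ltn_ord.
have k5 (k : 'I_5) : k + o <= 5 by rewrite addnC (leq_trans _ o4) // leq_add2l -ltnS.
exists g.
  apply/andP; split; apply/forallP=> k.
    apply/eqP/(@addIn o); rewrite -sec_rk gv fn_rk //.
  apply/forallP=> l; apply/implyP=> kl; rewrite /rle /= !gv; apply: fn_le => //.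
  by rewrite leq_add2r kl k5.
apply/ffunP=> k; rewrite ffunE; case: ifP => [/andP[ok k4]|ik].
  by rewrite gv inordK ?subnK ?fnE // ltnS leq_subLR.
rewrite -!fnE H //; first by rewrite -ltnS.
move/negbT: ik; rewrite negb_and -!ltnNge => /orP[] ?; apply/orP; [left|right]; exact: ltnW.
Qed.

Section ChiralSection.
Hypothesis hS : chiral S 3.
Let hSP : is_polytope S 3. Proof. by case: hS. Qed.

Lemma ext_adj g i : is_flag g -> ext (adj i g) = adj (eo i) (ext g).
Proof. by move=> gf; apply/esym/(adj_eq hP)/ext_adjacent/adjP. Qed.

Lemma ext_adjw g w : is_flag g -> ext (adjw w g) = adjw (map eo w) (ext g).
Proof. by elim: w g => //= i w IH g gf; rewrite IH ?adj_flag // ext_adj. Qed.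

Lemma base_flag : exists2 g, is_flag g & ext g = f.
Proof. exact: ext_surj. Qed.

Let a := rot f (eo o1) (eo o0).
Let b := rot f (eo o2) (eo o1).

(* [Q] is an arbitrary chiral quotient of the section, possibly the section itself. *)
Lemma ev_cover (Q : Raw) (h : flagT Q 3) : chiral Q 3 -> is_flag h ->
  (forall w, adjw (map eo w) f = f -> adjw w h = h) ->
  forall w, ev a b w = 1 -> ev (rot h o1 o0) (rot h o2 o1) w = 1.
Proof.
move=> hQ hh H w w1; have hQP : is_polytope Q 3 by case: hQ.
apply: (aut_free hQP _ hh); first by apply/autP; exact: (ev_autG id hQ hh).
rewrite (ev_word id hQ hh) map_id; apply: H.
by rewrite -(ev_word eo hC ff) -/a -/b w1 aut_flag1.
Qed.

(** [ext] intertwines the word actions on flags of the section and of P, so the same words are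
    trivial in both groups, and [chiral_not_reg] for the section transfers. *)
Lemma sec_not_reg : ~ reg a b 1.
Proof.
have [g gf eg] := base_flag; move=> rg; apply: (chiral_not_reg hS gf) => w /set1gP w1.
pose iv := map (fun l : bool * bool => (l.1, ~~ l.2)).
have evV (rT : finGroupType) (x y : rT) u : ev x^-1 y^-1 u = ev x y (iv u).
  elim: u => //= -[i e] u ->; congr (_ * _).
  by case: i e => [] []; rewrite /letter_val //= invgK.
apply/set1gP; rewrite evV.
have Hg u : adjw (map eo u) f = f -> adjw u g = g.
  by move=> e; apply: ext_inj; rewrite ext_adjw // eg.
apply: (ev_cover hS gf Hg); rewrite -evV; apply/set1gP/rg/set1gP.
apply: (aut_free hP _ ff); first by apply/autP; exact: (ev_autG eo hC ff).
rewrite (ev_word eo hC ff) -{2}eg -eg -ext_adjw //; congr ext.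
by have := ev_word id hS gf w; rewrite map_id w1 aut_flag1.
Qed.

(** The proper rank of P in which all extended flags agree with f: the facet itself, or the
    vertex. *)
Let lo := if o == 0 then l3 else l0.

Lemma out_idx (k : 'I_6) : (k <= o) || (o + 4 <= k) ->
  [\/ nat_of_ord k = 0, k = idx lo | nat_of_ord k = 5].
Proof.
have o01 : (o == 0) || (o == 1%N) by case: o ho => [|[]].
rewrite /lo; case/orP: o01 => /eqP ->; case: k => [[|[|[|[|[|[|//]]]]]] hk] //= _;
  try (by constructor 1); try (by constructor 3); constructor 2; apply: ord_inj; by rewrite val_idx.
Qed.

(** Flags of the section are the flags of P through the face of rank [lo]; these form two regular
    orbits under its stabilizer. *)
Lemma num_flags_sec : num_flags S 3 = (2 * #|face_stab f lo|)%N.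
Proof.
pose H := face_stab f lo; pose m := eo o1.
have mlo : idx lo != idx m.
  rewrite (inj_eq (@idx_inj 4)) -val_eqE /= /m val_eo /lo.
  by case: o ho => [|[]].
have af := adj_flag hP m ff.
have cardO (h : flagT P 4) : is_flag h -> #|[set aut_flag g h | g in H]| = #|H|.
  move=> hf; rewrite card_in_imset // => g g' /setIdP[gG _] /setIdP[gG' _].
  exact: aut_inj.
have -> : num_flags S 3 = #|[set aut_flag g f | g in H] :|: [set aut_flag g (adj m f) | g in H]|.
  rewrite /num_flags -(card_imset _ ext_inj); congr #|pred_of_set _|.
  have inX (h : flagT P 4) : is_flag h -> h (idx lo) = f (idx lo) ->
      h \in [set ext x | x in [set f0 | is_flag f0]].
    move=> hf hl; have [k k5 ko|g gf eg] := ext_surj hf; last by apply/imsetP; exists g; rewrite ?inE.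
    pose k' : 'I_6 := inord k; have ek : k' = k :> nat by rewrite inordK.
    have := @out_idx k'; rewrite ek => /(_ ko) [k0|kl|k0].
    - apply: (le_rk_eq hP); last by rewrite !fn_rk.
      by apply: (rk0_le hP); rewrite fn_rk.
    - by rewrite /fn -/k' kl.
    apply: (le_rk_eq hP); last by rewrite !fn_rk.
    by apply: (rkn_le hP); rewrite fn_rk.
  apply/setP=> h; apply/idP/idP.
    case/imsetP=> g; rewrite inE => gf ->.
    have eg := ext_flag gf.
    have ego : ext g (idx lo) = f (idx lo).
      rewrite !idx_fn; apply: ext_ends => //.
      by rewrite /lo; case: o ho => [|[]] // _; [right|left].
    apply/setUP; case: (flag_orbits hC m ff eg) => /same_orbitP[x xG ex]; [left|right];
      apply/imsetP; exists x; rewrite ?ex //; apply/setIdP; split=> //; apply/eqP.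
      by move/ffunP/(_ (idx lo)): ex; rewrite ffunE ego.
    by move/ffunP/(_ (idx lo)): ex; rewrite ffunE ego adj_out.
  case/setUP=> /imsetP[g /setIdP[gG /eqP gl] ->]; apply: inX; rewrite ?aut_is_flag ?ffunE //; try exact/autP.
  by rewrite adj_out.
rewrite cardsU !cardO // disjoint_setI0 ?cards0 ?subn0 ?addnn ?mul2n //.
rewrite -setI_eq0; apply/eqP/setP=> h; rewrite in_set0 inE; apply/andP=> [] [/imsetP[g /setIdP[gG _] ->]].
case/imsetP=> g' /setIdP[gG' _] e; apply: (@adj_not_orbit _ _ hC f m) => //.
apply: (@same_orbit_trans _ _ _ (aut_flag g f)); first by apply/same_orbitP; exists g.
by rewrite e; apply/same_orbit_sym/same_orbitP; exists g'.
Qed.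

Lemma has_type_sec ps : has_type P 4 ps ->
  has_type S 3 [:: nth 0 ps o; nth 0 ps o.+1].
Proof.
case=> sz H; split=> // j /andP[j1 j2] x y rx ry lxy.
have rx' : rrk (val x) = (j + o).-1 by rewrite sec_rk rx; case: j j1 {j2 rx ry}.
have ry' : rrk (val y) = (j + o).+2 by rewrite sec_rk ry.
have jo : 0 < j + o <= 3 by rewrite addn_gt0 j1 /= (leq_add j2 ho).
have -> : nth 0 [:: nth 0 ps o; nth 0 ps o.+1] j.-1 = nth 0 ps (j + o).-1.
  by case: j j1 j2 {rx ry rx' ry' jo} => [|[|[|]]].
rewrite -(H _ jo _ _ rx' ry' lxy) -(card_imset _ val_inj); congr #|pred_of_set _|.
apply/setP=> z; apply/imsetP/idP.
  case=> u; rewrite !inE => /and3P[xu uy /eqP ru] ->; apply/and3P.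
  by split; rewrite ?sec_rk ?ru.
rewrite inE => /and3P[xz zy /eqP rz].
have zS : rle (fn f o) z && rle z (fn f (o + 4)).
  have /andP[h1 _] := valP x; have /andP[_ h2] := valP y.
  by rewrite (le_trans hP h1 xz) (le_trans hP zy h2).
exists (exist _ z zS) => //; rewrite inE.
apply/and3P; split=> //; apply/eqP/(@addIn o); rewrite -sec_rk /= rz.
by [].
Qed.

End ChiralSection.
End FacetVertex.

(** * Normal subgroups with a tight quotient *)

Section TripleQuotient.
Variable gT : finGroupType.
Variables a b c : gT.
Hypothesis tt : tight_triple a b c.

Lemma triple_uniq (u u' v v' w w' : gT) :
  u \in <[a]> -> u' \in <[a]> -> v \in <[b]> -> v' \in <[b]> ->
  w \in <[c]> -> w' \in <[c]> -> u * v * w = u' * v' * w' ->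
  [/\ u = u', v = v' & w = w'].
Proof.
move=> ua ua' vb vb' wc wc' e; have [_ [_ Kc _]] := tt.
have inK x y : x \in <[a]> -> y \in <[b]> -> x * y \in <[a]> <*> <[b]>.
  by move=> xa yb; rewrite groupM // mem_gen // inE ?xa ?yb ?orbT.
have ww : w * w'^-1 = (u * v)^-1 * (u' * v').
  by apply: (mulgI (u * v)); rewrite mulKVg mulgA e mulgK.
have w1 : w * w'^-1 = 1.
  apply/set1gP; rewrite -Kc; apply/setIP; split; last by rewrite groupM ?groupV.
  by rewrite ww groupM ?groupV ?inK.
have ew : w = w' by apply/eqP; rewrite eq_mulgV1 w1.
have uv : u * v = u' * v' by apply: (mulIg w); rewrite e ew.
have vv : v * v'^-1 = u^-1 * u'.
  by apply: (mulgI u); rewrite mulKVg mulgA uv mulgK.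
have v1 : v * v'^-1 = 1.
  apply/set1gP; rewrite -(triple_TIab tt); apply/setIP; split.
    by rewrite vv groupM ?groupV.
  by rewrite groupM ?groupV.
have ev' : v = v' by apply/eqP; rewrite eq_mulgV1 v1.
by split=> //; apply: (mulIg v); rewrite uv ev'.
Qed.

Variable J : {group gT}.
Hypothesis nJ : <[a]> <*> <[b]> <*> <[c]> \subset 'N(J).
Hypothesis sJ : [|| J \subset <[a]>, J \subset <[b]> | J \subset <[c]>].

(** For each of the two intersections, J lies inside one of the members, so triviality passes to the
    quotient; the order bound is that of a product set. *)
Lemma quo_triple : tight_triple (coset J a) (coset J b) (coset J c).
Proof.
move: nJ; rewrite !join_subG !cycle_subG => /andP[/andP[aN bN] cN].
have [[ab2 bc2 abc2] [aL Kc le]] := tt.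
have aNs : <[a]> \subset 'N(J) by rewrite cycle_subG.
have bNs : <[b]> \subset 'N(J) by rewrite cycle_subG.
have cNs : <[c]> \subset 'N(J) by rewrite cycle_subG.
have LN : <[b]> <*> <[c]> \subset 'N(J) by rewrite join_subG bNs.
have KN : <[a]> <*> <[b]> \subset 'N(J) by rewrite join_subG aNs.
split.
  by split; rewrite -?morphM ?groupM // -morphX ?groupM //= ?ab2 ?bc2 ?abc2 morph1.
rewrite -!quotient_cycle // -!quotientY //; split.
- have [Ja|nJa] := boolP (J \subset <[a]>); first by rewrite -quotientGI // aL quotient1.
  rewrite -quotientIG ?aL ?quotient1 //.
  by case/or3P: sJ nJa => [->//|sb|sc] _;
    [rewrite (subset_trans sb) ?joing_subl | rewrite (subset_trans sc) ?joing_subr].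
- have [Jc|nJc] := boolP (J \subset <[c]>); first by rewrite -quotientIG // Kc quotient1.
  rewrite -quotientGI ?Kc ?quotient1 //.
  by case/or3P: sJ nJc => [sa|sb|->//] _;
    [rewrite (subset_trans sa) ?joing_subl | rewrite (subset_trans sb) ?joing_subr].
rewrite (triple_GE tt) (tight_joinE (triple_tpK tt)) !quotientMl //; last first.
  by rewrite -(tight_joinE (triple_tpK tt)).
have lem (A B : {set coset_of J}) : #|A * B| <= #|A| * #|B|.
  rewrite -cardsX -/(mulg _ _); apply: leq_trans (leq_imset_card (fun p => p.1 * p.2) _).
  apply: subset_leq_card; apply/subsetP=> _ /mulsgP[x y xA yB ->].
  by apply/imsetP; exists (x, y); rewrite ?inE ?xA.
by apply: leq_trans (lem _ _) _; rewrite /order -!quotient_cycle // leq_mul2r lem orbT.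
Qed.

End TripleQuotient.

Lemma ord4_ind (R : 'I_4 -> Prop) : R l0 -> R l1 -> R l2 -> R l3 -> forall i, R i.
Proof.
by move=> R0 R1 R2 R3 [[|[|[|[|//]]]] hi]; rewrite (bool_irrelevance hi isT);
  [exact: R0 | exact: R1 | exact: R2 | exact: R3].
Qed.

(* Unique factorization in the quotient gives the intersection property of the
   images of the face stabilizers [st i], from which it is lifted. *)
Section StabLift.
Variable gT : finGroupType.
Variables (a b c : gT) (G J : {group gT}) (st : 'I_4 -> {group gT}).
Hypothesis nJ : G \subset 'N(J).
Hypothesis ttq : tight_triple (coset J a) (coset J b) (coset J c).
Hypotheses (aG : a \in G) (bG : b \in G) (cG : c \in G).
Hypotheses (aJ : a \notin J) (bJ : b \notin J) (cJ : c \notin J).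
Hypothesis st0 : st l0 = <[b]> * <[c]> :> {set gT}.
Hypothesis st1 : forall x, x \in st l1 ->
  exists2 w, w \in <[c]> & x = w \/ x = a * b * w.
Hypothesis st2 : forall x, x \in st l2 ->
  exists2 u, u \in <[a]> & x = u \/ x = u * (b * c).
Hypothesis st3 : st l3 = <[a]> * <[b]> :> {set gT}.
Hypothesis sta : forall k g, k != l1 -> k != l0 -> g \in <[a]> -> g \in st k.
Hypothesis stb : forall k g, k != l2 -> k != l1 -> g \in <[b]> -> g \in st k.
Hypothesis stc : forall k g, k != l3 -> k != l2 -> g \in <[c]> -> g \in st k.
Hypothesis stab_ab : forall k, k != l2 -> k != l0 -> a * b \in st k.
Hypothesis stab_bc : forall k, k != l3 -> k != l1 -> b * c \in st k.
Hypothesis stab_abc : forall k, k != l3 -> k != l0 -> a * b * c \in st k.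

Let cs := coset J.
Let inN x : x \in G -> x \in 'N(J). Proof. exact: subsetP nJ x. Qed.
Let cs_neq1 x : x \in G -> x \notin J -> cs x <> 1.
Proof. by move=> /inN xN xJ e; case/negP: xJ; apply: coset_idr. Qed.
Let cyG x g : x \in G -> g \in <[x]> -> g \in G.
Proof. by move=> xG; apply: subsetP; rewrite cycle_subG. Qed.
Let csM x y : x \in G -> y \in G -> cs (x * y) = cs x * cs y.
Proof. by move=> xG yG; rewrite /cs morphM ?inN. Qed.
Let cs_cy x g : x \in G -> g \in <[x]> -> cs g \in <[cs x]>.
Proof. by move=> xG /cycleP[i ->]; rewrite /cs morphX ?inN //= mem_cycle. Qed.

Let NF (X : coset_of J) u v w : Prop :=
  [/\ u \in <[a]>, v \in <[b]>, w \in <[c]> & X = cs u * cs v * cs w].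

Let NFu X u u' v v' w w' : NF X u v w -> NF X u' v' w' ->
  [/\ cs u = cs u', cs v = cs v' & cs w = cs w'].
Proof.
move=> [ua vb wc ->] [ua' vb' wc' e]; apply: (triple_uniq ttq) e; exact: cs_cy.
Qed.

Let NFE X u v w : NF X u v w -> X = cs (u * v * w) /\ u * v * w \in G.
Proof.
case=> ua vb wc ->; have uG := cyG aG ua; have vG := cyG bG vb; have wG := cyG cG wc.
by split; [rewrite (csM (groupM uG vG) wG) (csM uG vG) | rewrite !groupM].
Qed.

(** Each condition prescribes a shape for the normal form of [cs x] in the quotient. By uniqueness
    the shapes can be compared, and what they have in common is represented by an element lying in
    all the stabilizers concerned. *)
Lemma stab_lift (I : pred 'I_4) x : x \in G -> ~~ [forall i, I i] ->
  (forall i, I i -> exists2 g, g \in st i & cs x = cs g) ->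
  exists y, [/\ y \in G, cs y = cs x & forall i, I i -> y \in st i].
Proof.
move=> xG nI H.
have cs1 : cs 1 = 1 by rewrite /cs morph1.
have H0 : I l0 -> exists v w, NF (cs x) 1 v w.
  move=> /H[g]; rewrite st0 => /mulsgP[v w vb wc ->] ->; exists v, w.
  by split; rewrite ?group1 // cs1 mul1g (csM (cyG bG vb) (cyG cG wc)).
have H3 : I l3 -> exists u v, NF (cs x) u v 1.
  move=> /H[g]; rewrite st3 => /mulsgP[u v ua vb ->] ->; exists u, v.
  by split; rewrite ?group1 // cs1 mulg1 (csM (cyG aG ua) (cyG bG vb)).
have H1 : I l1 -> exists w, NF (cs x) 1 1 w \/ NF (cs x) a b w.
  move=> /H[g] /st1[w wc [->|->]] ->; exists w; [left|right]; split; rewrite ?group1 ?cycle_id //.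
    by rewrite cs1 !mul1g.
  by rewrite (csM (groupM aG bG) (cyG cG wc)) (csM aG bG).
have H2 : I l2 -> exists u, NF (cs x) u 1 1 \/ NF (cs x) u b c.
  move=> /H[g] /st2[u ua [->|->]] ->; exists u; [left|right]; split; rewrite ?group1 ?cycle_id //.
    by rewrite cs1 !mulg1.
  by rewrite (csM (cyG aG ua) (groupM bG cG)) (csM bG cG) mulgA.
(* Nontrivial images of the generators rule out mixed coincidences of shapes, such as a b w against
   1 v w. *)
have na := cs_neq1 aG aJ; have nb := cs_neq1 bG bJ; have nc := cs_neq1 cG cJ.
rewrite -cs1 in na nb nc.
have y1 : cs x = cs 1 -> exists y, [/\ y \in G, cs y = cs x & forall i, I i -> y \in st i].
  by move=> ->; exists 1; split; rewrite ?group1 // => i _; apply: group1.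
have fin y : cs x = cs y /\ y \in G -> (I l0 -> y \in st l0) ->
    (I l1 -> y \in st l1) -> (I l2 -> y \in st l2) ->
    (I l3 -> y \in st l3) ->
    exists y, [/\ y \in G, cs y = cs x & forall i, I i -> y \in st i].
  by move=> [e yG] *; exists y; split=> //; apply: ord4_ind.
have c1 u v w : NF (cs x) u v w -> cs u = cs 1 -> cs v = cs 1 -> cs w = cs 1 -> cs x = cs 1.
  by case=> _ _ _ -> -> -> ->; rewrite cs1 !mulg1.
have xw w : NF (cs x) 1 1 w -> cs x = cs w /\ w \in G.
  by move/NFE; rewrite !mul1g.
have xu u : NF (cs x) u 1 1 -> cs x = cs u /\ u \in G.
  by move/NFE; rewrite !mulg1.
have [I0|I0] := boolP (I l0).
  have [v [w nf0]] := H0 I0; have [_ vb wc _] := nf0.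
  have [I1|I1] := boolP (I l1).
    have [w1 [nf1|nf1]] := H1 I1; last by have [h _ _] := NFu nf1 nf0; case: (na h).
    have [_ _ wc1 _] := nf1.
    have [I2|I2] := boolP (I l2).
      have [u [nf2|nf2]] := H2 I2; last by have [_ h _] := NFu nf2 nf1; case: (nb h).
      by have [h1 _ h3] := NFu nf1 nf2; apply: y1; apply: (c1 _ _ _ nf1).
    have [I3|I3] := boolP (I l3).
      by have [u [v' nf3]] := H3 I3; have [_ _ h3] := NFu nf1 nf3; apply: y1; apply: (c1 _ _ _ nf1).
    by apply: (fin w1 (xw _ nf1)) => // h; rewrite ?(negPf I2) ?(negPf I3) // in h; apply: stc.
  have [I2|I2] := boolP (I l2).
    have [u [nf2|nf2]] := H2 I2; have [h1 h2 h3] := NFu nf2 nf0.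
      by apply: y1; apply: (c1 _ _ _ nf2).
    have [I3|I3] := boolP (I l3).
      by have [u' [v' nf3]] := H3 I3; have [_ _ h] := NFu nf2 nf3; case: (nc h).
    have e : cs x = cs (b * c) /\ b * c \in G.
      have [_ _ _ ->] := nf2; rewrite (csM bG cG) h1 cs1 mul1g; split=> //; exact: (groupM bG cG).
    by apply: (fin _ e) => // h; rewrite ?(negPf I1) ?(negPf I3) // in h; apply: stab_bc.
  have [I3|I3] := boolP (I l3).
    have [u [v' nf3]] := H3 I3; have [h1 _ _] := NFu nf3 nf0; have [_ vb' _ e] := nf3.
    have e' : cs x = cs v' /\ v' \in G.
      by rewrite e h1 cs1 mul1g mulg1 (cyG bG vb').
    by apply: (fin _ e') => // h; rewrite ?(negPf I1) ?(negPf I2) // in h; apply: stb.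
  apply: (fin _ (NFE nf0)) => // h; rewrite ?(negPf I1) ?(negPf I2) ?(negPf I3) // in h.
  by rewrite mul1g; apply: groupM; [apply: stb | apply: stc].
have [I1|I1] := boolP (I l1).
  have [w nf1] := H1 I1.
  have [I2|I2] := boolP (I l2).
    have [u nf2] := H2 I2; case: nf1 => nf1; case: nf2 => nf2; have [h1 h2 h3] := NFu nf1 nf2.
    - by apply: y1; apply: (c1 _ _ _ nf1).
    - by case: nb; rewrite -h2.
    - by case: nb.
    have [I3|I3] := boolP (I l3).
      by have [u' [v' nf3]] := H3 I3; have [_ _ h] := NFu nf2 nf3; case: (nc h).
    have e : cs x = cs (a * b * c) /\ a * b * c \in G.
      have [_ _ _ ->] := nf2; rewrite (csM (groupM aG bG) cG) (csM aG bG) -h1; split=> //.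
      exact: (groupM (groupM aG bG) cG).
    by apply: (fin _ e) => // h; rewrite ?(negPf I0) ?(negPf I3) // in h; apply: stab_abc.
  have [I3|I3] := boolP (I l3).
    have [u [v nf3]] := H3 I3; case: nf1 => nf1; have [h1 h2 h3] := NFu nf1 nf3.
      by apply: y1; apply: (c1 _ _ _ nf1).
    have e : cs x = cs (a * b) /\ a * b \in G.
      by have [_ _ _ ->] := nf1; rewrite (csM aG bG) h3 cs1 mulg1; split=> //; exact: (groupM aG bG).
    by apply: (fin _ e) => // h; rewrite ?(negPf I0) ?(negPf I2) // in h; apply: stab_ab.
  case: nf1 => nf1; have [_ _ wc _] := nf1.
    by apply: (fin _ (xw _ nf1)) => // h; rewrite ?(negPf I0) ?(negPf I2) ?(negPf I3) // in h; apply: stc.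
  apply: (fin _ (NFE nf1)) => // h; rewrite ?(negPf I0) ?(negPf I2) ?(negPf I3) // in h.
  by apply: groupM; [apply: stab_ab | apply: stc].
have [I2|I2] := boolP (I l2).
  have [u nf2] := H2 I2.
  have [I3|I3] := boolP (I l3).
    have [u' [v nf3]] := H3 I3; case: nf2 => nf2; have [h1 h2 h3] := NFu nf2 nf3; last by case: nc.
    have [ua _ _ _] := nf2.
    by apply: (fin _ (xu _ nf2)) => // h; rewrite ?(negPf I0) ?(negPf I1) // in h; apply: sta.
  case: nf2 => nf2; have [ua _ _ _] := nf2.
    by apply: (fin _ (xu _ nf2)) => // h; rewrite ?(negPf I0) ?(negPf I1) ?(negPf I3) // in h; apply: sta.
  apply: (fin _ (NFE nf2)) => // h; rewrite ?(negPf I0) ?(negPf I1) ?(negPf I3) // in h.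
  by rewrite -mulgA; apply: groupM; [apply: sta | apply: stab_bc].
have [I3|I3] := boolP (I l3).
  have [u [v nf3]] := H3 I3; have [ua vb _ _] := nf3.
  apply: (fin _ (NFE nf3)) => // h; rewrite ?(negPf I0) ?(negPf I1) ?(negPf I2) // in h.
  by rewrite mulg1; apply: groupM; [apply: sta | apply: stb].
by exists x; split=> //; apply: ord4_ind => h; rewrite ?(negPf I0) ?(negPf I1) ?(negPf I2) ?(negPf I3) in h.
Qed.

End StabLift.

(** * Stabilizers of the faces of the base flag *)

Section Lifting.
Variables (P : Raw) (f : flagT P 4).
Hypothesis hC : chiral P 4.
Hypothesis hT : tight P 4.
Hypothesis ff : is_flag f.
Let hP : is_polytope P 4. Proof. by case: hC. Qed.
Let G := autG P.
Let a := rot f l1 l0.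
Let b := rot f l2 l1.
Let c := rot f l3 l2.
Let tt : tight_triple a b c := rots_triple hC hT ff.

Let rG i j : rot f i j \in G. Proof. by case: (rotP hC i j ff). Qed.

Lemma stab3E : face_stab f l3 = <[a]> * <[b]>.
Proof.
apply/esym/eqP; rewrite -(tight_joinE (triple_tpK tt)) eqEcard (K_stab hC ff).
by rewrite (card_stab3 hC hT ff) (triple_cardK tt) leqnn.
Qed.

Lemma stab0E : face_stab f l0 = <[b]> * <[c]>.
Proof.
apply/esym/eqP; rewrite -(tight_joinE (triple_tpL tt)) eqEcard (L_stab hC ff).
by rewrite (card_stab0 hC hT ff) (tight_card (triple_tpL tt)) leqnn.
Qed.

(* A word avoiding the letter of the middle face splits into a dihedral word and
   powers of the remaining, commuting letter. *)
Lemma split_word (i j k : 'I_4) w : ((i.+1 < k) && (j.+1 < k)) || ((k.+1 < i) && (k.+1 < j)) ->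
  {subset w <= [:: i; j; k]} -> exists2 u, {subset u <= [:: i; j]} &
    adjw w f = adjw u f \/ adjw w f = adj k (adjw u f).
Proof.
move=> ijk; elim/last_ind: w => [|w l IH] sw; first by exists [::] => //; left.
have [|u su eu] := IH; first by move=> x xw; apply: sw; rewrite mem_rcons inE xw orbT.
have uf := adjw_flag hP u ff.
have cl : l \in [:: i; j] -> adj l (adj k (adjw u f)) = adj k (adj l (adjw u f)).
  rewrite !inE => /orP[] /eqP->; case/orP: ijk => /andP[h1 h2];
    by [apply: adj_comm | apply/esym/adj_comm].
rewrite -cats1 adjw_cat /=.
have : l \in [:: i; j; k] by apply: sw; rewrite mem_rcons mem_head.
have [lij _|nlij] := boolP (l \in [:: i; j]).
  exists (rcons u l).
    by move=> x; rewrite mem_rcons inE => /orP[/eqP->|/su].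
  rewrite -cats1 adjw_cat /=; case: eu => ->; [by left | by right; apply: cl].
move: nlij; rewrite !inE negb_or => /andP[/negPf-> /negPf->] /= /eqP->.
exists u => //; case: eu => ->; [by right | by left; rewrite adjK].
Qed.

(** A word from f to its image avoids rank m, so it is a dihedral word with at most one letter k
    added. An automorphism has even parity, which leaves two of the four cases. *)
Lemma stab_mid (i j k m : 'I_4) x : ((i.+1 < k) && (j.+1 < k)) || ((k.+1 < i) && (k.+1 < j)) ->
  (forall l, l != m -> l \in [:: i; j; k]) -> x \in face_stab f m ->
  exists2 g, g \in <[rot f j i]> & x = g \/ x = rot f i k * g.
Proof.
move=> ijk lm /setIdP[xG /eqP xm]; have xA : is_aut x by apply/autP.
have [w ew wi] := flag_conn hP ff (aut_is_flag hP xA ff).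
have sw : {subset w <= [:: i; j; k]}.
  move=> l /wi; rewrite ffunE => nl; apply: lm; apply: contraNneq nl => ->.
  by rewrite xm.
have [u su eu] := split_word ijk sw.
have [g gr gu] := dihedral_word hC ff su; exists g => //.
have gG : g \in G by apply: subsetP gr; rewrite cycle_subG.
have gA : is_aut g by apply/autP.
have xf : same_orbit f (aut_flag x f) by apply/same_orbitP; exists x.
have gf : same_orbit (aut_flag g f) f by apply/same_orbit_sym/same_orbitP; exists g.
have af := aut_is_flag hP gA ff.
rewrite -ew in xf; case: eu => eu; case: gu => gu; rewrite eu gu in xf.
- by left; apply: (aut_inj hP xG gG ff); rewrite -ew eu gu.
- have := same_orbit_trans gf xf; rewrite aut_adj // => /(adj_not_orbit hC) //.
- by have := same_orbit_trans gf xf => /(adj_not_orbit hC).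
right; apply: (aut_inj hP xG _ ff); first by rewrite groupM.
by rewrite -ew eu gu aut_flagM (proj2 (rotP hC i k ff)) !(aut_adj hP) ?adj_flag.
Qed.

Lemma stab2E x : x \in face_stab f l2 ->
  exists2 u, u \in <[a]> & x = u \/ x = u * (b * c).
Proof.
move=> x2.
have [||g gr gx] := @stab_mid l1 l0 l3 l2 x _ _ x2; first by [].
  by case=> [[|[|[|[|//]]]] hl].
have ea : <[rot f l0 l1]> = <[a]> by rewrite /a -(rot_inv hC l1 l0 ff) cycleV.
rewrite ea in gr; case: gx => ->; first by exists g => //; left.
have -> : rot f l1 l3 = b * c.
  by rewrite /b /c rot_mul // -(rot_inv hC l3 l1 ff) sqr1_inv // rot_invol.
have tN : b * c \in 'N(<[a]>) by rewrite inE -cycleJ (triple_invA tt) cycleV.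
exists (g ^ (b * c)^-1); first by rewrite memJ_norm ?groupV.
by right; rewrite -conjgCV.
Qed.

Lemma stab1E x : x \in face_stab f l1 ->
  exists2 w, w \in <[c]> & x = w \/ x = a * b * w.
Proof.
move=> x1.
have [||g gr gx] := @stab_mid l2 l3 l0 l1 x _ _ x1; first by [].
  by case=> [[|[|[|[|//]]]] hl].
by exists g => //; case: gx => ->; [left | right; rewrite /a /b rot_mul].
Qed.

End Lifting.

(** * The quotient of a polytope by a group of automorphisms *)

Section QuotientRaw.
Variables (P : Raw) (J : {group {perm carrier P}}).
Local Notation T := (carrier P).

Definition orb (x : T) : {set T} := [set (j : {perm T}) x | j in J].

(** The orbit poset: comparison by some pair of representatives, rank of any representative. Orbits
    are nonempty, so the default rank is never taken. *)
Definition quo : Raw :=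
  @MkRaw {X : {set T} | X \in [set orb x | x : T]}
    (fun X Y => [exists x in val X, exists y in val Y, rle x y])
    (fun X => if [pick x in val X] is Some x then rrk x else 0).

Lemma orb_mem (x : T) : orb x \in [set orb y | y : T].
Proof. exact: imset_f. Qed.

Definition pr (x : T) : carrier quo := exist _ (orb x) (orb_mem x).

Hypothesis sJG : J \subset autG P.
Variable n : nat.
Hypothesis hP : is_polytope P n.

Lemma mem_orb x : x \in orb x.
Proof. by apply/imsetP; exists 1; rewrite ?perm1 ?group1. Qed.

Lemma orb_eq x j : j \in J -> orb (j x) = orb x.
Proof.
move=> jJ; apply/setP=> y; apply/imsetP/imsetP=> [] [k kJ ->].
  by exists (j * k); rewrite ?groupM ?permM.
by exists (j^-1 * k); rewrite ?groupM ?groupV // permM permK.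
Qed.

Lemma pr_surj (X : carrier quo) : exists x, X = pr x.
Proof. by have /imsetP[x _ e] := valP X; exists x; apply: val_inj. Qed.

Lemma pr_act x j : j \in J -> pr (j x) = pr x.
Proof. by move=> jJ; apply: val_inj; apply: orb_eq. Qed.

Lemma pr_eqP x y : pr x = pr y -> exists2 j, j \in J & y = (j : {perm T}) x.
Proof.
move/(congr1 val) => /= e; have := mem_orb y; rewrite -e => /imsetP[j jJ ->].
by exists j.
Qed.

Lemma pr_leP x y : reflect (exists2 j, j \in J & rle x ((j : {perm T}) y))
  (rle (pr x) (pr y)).
Proof.
apply: (iffP idP) => [/exists_inP[u /imsetP[j jJ ->] /exists_inP[v /imsetP[k kJ ->] le]]|].
  have /autP jA : j^-1 \in autG P by rewrite groupV (subsetP sJG).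
  exists (k * j^-1); first by rewrite groupM ?groupV.
  by move: le; rewrite -jA permK permM.
case=> j jJ le; apply/exists_inP; exists x; first exact: mem_orb.
by apply/exists_inP; exists (j y) => //; apply/imsetP; exists j.
Qed.

Lemma pr_le x y : rle x y -> rle (pr x) (pr y).
Proof. by move=> le; apply/pr_leP; exists 1; rewrite ?group1 ?perm1. Qed.

Lemma pr_rk x : rrk (pr x) = rrk x.
Proof.
rewrite /rrk /=; case: pickP => [y /imsetP[j jJ ->]|/(_ x)]; last by rewrite mem_orb.
by apply: (aut_rk hP); apply/autP; apply: (subsetP sJG).
Qed.

Lemma pr_le_lift x (Y : carrier quo) : rle (pr x) Y -> exists2 y, Y = pr y & rle x y.
Proof.
have [y ->] := pr_surj Y => /pr_leP[j jJ le].
by exists (j y) => //; rewrite pr_act.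
Qed.

Lemma pr_neq x y : rle x y -> rrk x != rrk y -> rlt (pr x) (pr y).
Proof.
move=> le; rewrite /rlt pr_le // => nr; apply/eqP => /(congr1 (@rrk quo)).
by rewrite !pr_rk => e; rewrite e eqxx in nr.
Qed.

Definition prm (h : flagT P n) : flagT quo n := map_flag pr h.

Lemma prm_flag h : is_flag h -> is_flag (prm h).
Proof.
move=> hf; apply/andP; split; apply/forallP=> k; first by rewrite ffunE pr_rk flag_rk.
by apply/forallP=> l; apply/implyP=> kl; rewrite !ffunE; apply: pr_le; apply: flag_le.
Qed.

(** Faces are lifted from the bottom up, each new representative being moved by J until it lies
    above the previous one. *)
Lemma flag_lift (F : flagT quo n) : is_flag F -> exists2 h, is_flag h & prm h = F.
Proof.
move=> Ff.
have H m : m <= n.+1 -> exists h : nat -> T, (forall k, k <= m -> pr (h k) = fn F k) /\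
    (forall k, k < m -> rle (h k) (h k.+1)).
  elim: m => [|m IH] mn.
    have [x e] := pr_surj (fn F 0); exists (fun _ => x); split=> // k.
    by rewrite leqn0 => /eqP->.
  have [h [h1 h2]] := IH (ltnW mn).
  have : rle (pr (h m)) (fn F m.+1) by rewrite h1 //; apply: fn_le => //; rewrite leqnSn.
  case/pr_le_lift=> y ey le; exists (fun k => if k == m.+1 then y else h k); split=> k.
    rewrite leq_eqVlt; have [->//|_ /=] := eqVneq k m.+1; exact: h1.
  rewrite ltnS leq_eqVlt; have [->|km /= lkm] := eqVneq k m.
    by rewrite eqxx ltn_eqF.
  by rewrite eqSS (negPf km) ltn_eqF ?h2 // ltnS ltnW.
have [h [h1 h2]] := H n.+1 (leqnn _).
have [k kn|h' hf eh] := @flag_intro P n hP h _ h2.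
  by rewrite -pr_rk h1 // fn_rk.
exists h' => //; apply/ffunP=> k; have kn : k <= n.+1 by rewrite -ltnS.
by rewrite ffunE -[h' k]fnE eh // h1 // fnE.
Qed.

Lemma quo_refl X : @rle quo X X.
Proof. by have [x ->] := pr_surj X; apply: pr_le; apply: (le_refl hP). Qed.

Lemma quo_trans X Y Z : @rle quo X Y -> rle Y Z -> rle X Z.
Proof.
have [x ->] := pr_surj X; case/pr_le_lift=> y -> le1; case/pr_le_lift=> z -> le2.
by apply: pr_le; apply: (le_trans hP) le2.
Qed.

Lemma quo_le_rk X Y : @rle quo X Y -> rrk X <= rrk Y.
Proof.
have [x ->] := pr_surj X; case/pr_le_lift=> y -> le1; rewrite !pr_rk.
exact: (le_rk hP).
Qed.

Lemma quo_le_rk_eq X Y : @rle quo X Y -> rrk X = rrk Y -> X = Y.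
Proof.
have [x ->] := pr_surj X; case/pr_le_lift=> y -> le1; rewrite !pr_rk => e.
by rewrite (le_rk_eq hP le1 e).
Qed.

Lemma quo_rlt_rk X Y : @rlt quo X Y -> rrk X < rrk Y.
Proof.
case/andP=> le1 ne; rewrite ltn_neqAle quo_le_rk // andbT.
by apply: contra ne => /eqP /(quo_le_rk_eq le1)->.
Qed.

Lemma quo_cover X Y : @rlt quo X Y -> (forall Z, ~~ (rlt X Z && rlt Z Y)) ->
  rrk Y = (rrk X).+1.
Proof.
move=> lt; have := quo_rlt_rk lt; case/andP: lt; have [x ->] := pr_surj X.
case/pr_le_lift=> y -> le1 _; rewrite !pr_rk => rxy H.
have [|z [xz zy rz]] := @rank_succ _ _ hP x y.
  by rewrite /rlt le1; apply/eqP=> e; rewrite e ltnn in rxy.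
apply/eqP; rewrite -rz; apply/idPn=> ne.
have := H (pr z); rewrite !pr_neq //; first by rewrite eq_sym.
by rewrite rz ltn_eqF.
Qed.

Hypothesis nJ : autG P \subset 'N(J).

Lemma quo_aut g : g \in autG P ->
  exists2 q : {perm carrier quo}, q \in autG quo & forall x, q (pr x) = pr (g x).
Proof.
move=> gG; have gA : is_aut g by apply/autP.
have [rep erep] := fin_all_exists pr_surj.
have wd (k : {perm T}) x : k \in autG P -> pr (k (rep (pr x))) = pr (k x).
  move=> kG; have /pr_eqP[j jJ ->] := erep (pr x).
  have kN := subsetP nJ k kG.
  rewrite -permM (_ : j * k = k * j ^ k); last by rewrite conjgE mulKVg.
  by rewrite permM pr_act // memJ_norm.
have cK : cancel (fun X => pr (g (rep X))) (fun X => pr (g^-1 (rep X))).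
  by move=> X; rewrite wd ?groupV // permK -erep.
exists (perm (can_inj cK)); last by move=> x; rewrite permE wd.
have mono (k : {perm T}) x y : k \in autG P -> rle (pr x) (pr y) -> rle (pr (k x)) (pr (k y)).
  move=> kG /pr_leP[j jJ le]; apply/pr_leP; exists (j ^ k).
    by rewrite memJ_norm // (subsetP nJ).
  have -> : (j ^ k) (k y) = k (j y) by rewrite -!permM -conjgC.
  by have /autP -> := kG.
apply/autP=> X Y; have [x ->] := pr_surj X; have [y ->] := pr_surj Y.
rewrite !permE !wd //; apply/idP/idP; last exact: mono.
by move=> /(mono g^-1); rewrite groupV !permK => /(_ gG).
Qed.

Lemma quo_orbit h k : same_orbit h k -> same_orbit (prm h) (prm k).
Proof.
case/same_orbitP=> g gG <-; have [q qG eq] := quo_aut gG.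
by apply/same_orbitP; exists q => //; apply/ffunP=> i; rewrite !ffunE eq.
Qed.

End QuotientRaw.

Lemma far_cases (i j : 'I_4) : i.+2 = j :> nat -> (i = l0 /\ j = l2) \/ (i = l1 /\ j = l3).
Proof.
case: i j => [[|[|[|[|//]]]] hi] [[|[|[|[|//]]]] hj] //= _.
  by left; split; apply: ord_inj.
by right; split; apply: ord_inj.
Qed.

Lemma far_ex (i : 'I_4) :
  exists2 j : 'I_4, (i.+2 = j :> nat) \/ (j.+2 = i :> nat) & j != i.
Proof.
by case: i => [[|[|[|[|//]]]] hi]; [exists l2|exists l3|exists l0|exists l1] => //; by [left|right].
Qed.

(** * The quotient by J is a tight polytope, chiral unless it has a reflection *)

Section TightQuotient.
Variables (P : Raw) (f : flagT P 4) (J : {group {perm carrier P}}).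
Hypothesis hC : chiral P 4.
Hypothesis hT : tight P 4.
Hypothesis ff : is_flag f.
Local Notation T := (carrier P).
Let hP : is_polytope P 4. Proof. by case: hC. Qed.
Let G := autG P.
Let a := rot f l1 l0.
Let b := rot f l2 l1.
Let c := rot f l3 l2.
Hypothesis sJG : J \subset G.
Hypothesis nJ : G \subset 'N(J).
Hypothesis sJ : [|| J \subset <[a]>, J \subset <[b]> | J \subset <[c]>].
Hypotheses (aJ : a \notin J) (bJ : b \notin J) (cJ : c \notin J).
Local Notation Q := (quo J).
Local Notation prm := (@prm P J 4).
Implicit Types (h k : flagT P 4) (i : 'I_4).

Let tt : tight_triple a b c := rots_triple hC hT ff.
Let rG i j : rot f i j \in G. Proof. by case: (rotP hC i j ff). Qed.
Let ttq : tight_triple (coset J a) (coset J b) (coset J c).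
Proof. by apply: (quo_triple tt) => //; rewrite (rots_gen hC hT ff). Qed.

(** The hypothesis says that, modulo J, x lies in the stabilizer of each face in I. [stab_lift]
    finds y congruent to x in all these stabilizers at once, and y^-1 x is the required element of
    J. *)
Lemma stab_lift4 (I : pred 'I_4) x : x \in G -> ~~ [forall i, I i] ->
  (forall i, I i -> exists2 j, j \in J & x (f (idx i)) = j (f (idx i))) ->
  exists2 j, j \in J & forall i, I i -> x (f (idx i)) = j (f (idx i)).
Proof.
move=> xG nI H.
have abE : a * b = rot f l2 l0 by exact: rot_mul.
have bcE : b * c = rot f l3 l1 by exact: rot_mul.
have abcE : a * b * c = rot f l3 l0 by rewrite abE; exact: rot_mul.
have [||||||||||i /H[j jJ e]|y [yG ey ys]] :=
  @stab_lift _ a b c [group of G] J (face_stab_grp f) nJ ttq (rG _ _) (rG _ _) (rG _ _) aJ bJ cJ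
    _ _ _ _ _ _ _ _ _ _ I x xG nI.
- exact: stab0E.
- exact: stab1E.
- exact: stab2E.
- exact: stab3E.
- by move=> k g h1 h0 ga; exact: cycle_rot_fix ga h1 h0.
- by move=> k g h1 h0 ga; exact: cycle_rot_fix ga h1 h0.
- by move=> k g h1 h0 ga; exact: cycle_rot_fix ga h1 h0.
- by move=> k h1 h0; rewrite abE; exact: rot_stab.
- by move=> k h1 h0; rewrite bcE; exact: rot_stab.
- by move=> k h1 h0; rewrite abcE; exact: rot_stab.
- have jG := subsetP sJG j jJ.
  exists (x * j^-1).
    apply/setIdP; split; first by rewrite groupM ?groupV.
    by rewrite permM e permK.
  rewrite morphM ?(subsetP nJ) ?groupV //= ?(subsetP nJ) //.
  by rewrite [coset J j^-1]coset_id ?groupV // mulg1.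
exists (y^-1 * x).
  apply: coset_idr; first by rewrite (subsetP nJ) // groupM ?groupV.
  by rewrite morphM ?(subsetP nJ) ?groupV // morphV ?(subsetP nJ) //= ey mulVg.
move=> i /ys /setIdP[_ /eqP yi].
by rewrite permM -{2}yi permK.
Qed.

(** Up to changing the face of a rank i0 outside I, every flag is an image of f, which reduces the
    claim to [stab_lift4]. *)
Lemma quo_lift (I : pred 'I_4) h k : is_flag h -> is_flag k -> ~~ [forall i, I i] ->
  (forall i, I i -> pr J (h (idx i)) = pr J (k (idx i))) ->
  exists2 j, j \in J & forall i, I i -> j (h (idx i)) = k (idx i).
Proof.
move=> hf kf nI H.
have [i0 ni0] : exists i, ~~ I i by apply/existsP; rewrite -negb_forall.
have reduce (h' : flagT P 4) : is_flag h' -> exists2 x, x \in G &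
    forall i, I i -> h' (idx i) = x (f (idx i)).
  move=> hf'; case: (flag_orbits hC i0 ff hf') => /same_orbitP[x xG <-].
    by exists x => // i _; rewrite ffunE.
  exists x => // i Ii; rewrite ffunE adj_out // (inj_eq (@idx_inj 4)).
  by apply: contraTneq Ii => ->.
have [y yG ey] := reduce h hf; have [z zG ez] := reduce k kf.
have [|//|i Ii|j jJ ej] := @stab_lift4 I (z * y^-1); first by rewrite groupM ?groupV.
  have := H i Ii; rewrite ey // ez // => /pr_eqP[j jJ e].
  exists (y * j * y^-1); last by rewrite !permM e.
  have -> : y * j * y^-1 = j ^ y^-1 by rewrite conjgE invgK mulgA.
  by rewrite memJ_norm // groupV (subsetP nJ).
exists (j ^ y); first by rewrite memJ_norm // (subsetP nJ).
move=> i Ii; rewrite ey // ez //; have := ej i Ii; rewrite permM => /(congr1 y).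
by rewrite permKV => ->; rewrite conjgE !permM permK.
Qed.

Let rot_notin (i j : 'I_4) : i.+2 = j :> nat -> rot f j i \notin J.
Proof.
move=> ij.
have [cA cB] : coset J a != 1 /\ coset J b != 1.
  by split; apply/eqP => /coset_idr; rewrite (subsetP nJ) ?rG // => /(_ isT); apply/negP.
have ab : a * b \notin J.
  apply/negP=> abJ; have := coset_id abJ; rewrite morphM ?(subsetP nJ) ?rG //= => e.
  have [] := @triple_uniq _ _ _ _ ttq (coset J a) 1 (coset J b) 1 1 1;
    rewrite ?cycle_id ?group1 ?mulg1 // => e1 _ _.
  by rewrite e1 eqxx in cA.
have bc : b * c \notin J.
  apply/negP=> bcJ; have := coset_id bcJ; rewrite morphM ?(subsetP nJ) ?rG //= => e.
  have [] := @triple_uniq _ _ _ _ ttq 1 1 (coset J b) 1 (coset J c) 1;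
    rewrite ?cycle_id ?group1 ?mulg1 ?mul1g // => _ e1 _.
  by rewrite e1 eqxx in cB.
have abE : a * b = rot f l2 l0 by exact: rot_mul.
have bcE : b * c = rot f l3 l1 by exact: rot_mul.
rewrite abE in ab; rewrite bcE in bc.
by case: (far_cases ij) => [] [-> ->].
Qed.

(** Were the two faces identified, with i' two ranks away from i, some j in J would carry k to its
    (i, i')-neighbour, because the two flags lie in one orbit. So j would be conjugate to a
    half-turn ab or bc or its inverse, and these are not in J by unique factorization. *)
Lemma quo_adj_neq k i : is_flag k -> pr J (adj i k (idx i)) <> pr J (k (idx i)).
Proof.
move=> kf e; have [i' far_i ni] := far_ex i.
pose k2 : flagT P 4 := adj i' (adj i k); have af := adj_flag hP i kf; have k2f : is_flag k2 by apply: adj_flag.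
have [//|l nl|j jJ ej] := @quo_lift (fun l => l != i') k k2 kf k2f.
- by rewrite negb_forall; apply/existsP; exists i'; rewrite eqxx.
- rewrite /k2 adj_out // ?(inj_eq (@idx_inj 4)) //.
  have [->|li] := eqVneq l i; first by rewrite e.
  by rewrite adj_out // (inj_eq (@idx_inj 4)).
have jG := subsetP sJG _ jJ; have jA : is_aut j by apply/autP.
have jf := aut_is_flag hP jA kf.
have [w ew wi] := flag_conn hP jf k2f.
have eo' l : l != i' -> aut_flag j k (idx l) = k2 (idx l) by move=> nl; rewrite ffunE ej.
(* They can differ only in rank i'; if they did, they would be adjacent flags of one orbit. *)
have jk2 : aut_flag j k = k2.
  have sj : same_orbit k (aut_flag j k) by apply/same_orbitP; exists j.
  have [e1|ne1] := eqVneq (aut_flag j k (idx i')) (k2 (idx i')).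
    have : w = [::] by case: w wi {ew} => // l w /(_ l (mem_head _ _)); have [->|/eo'->] := eqVneq l i';
       rewrite ?e1 eqxx.
    by move=> w0; rewrite w0 in ew.
  case: hC => _ [na _]; case: (na (idx i') (aut_flag j k) k2).
    apply/and4P; split=> //; apply/forallP=> m; apply/implyP=> mi.
    rewrite -ew (adjw_out hP) // => l /wi; apply: contra => /eqP em.
    by rewrite eo' // -(inj_eq (@idx_inj 4)) -em.
  by apply: same_orbit_trans (adj2_orbit hC i i' kf); apply: same_orbit_sym.
have ji : i'.+2 = i :> nat \/ i.+2 = i' :> nat by case: far_i; auto.
have rJ : rot f i i' \in J.
  case: (flag_orbits hC i ff kf) => /same_orbitP[x xG ex]; have xA : is_aut x by apply/autP.
    have -> : rot f i i' = j ^ x^-1; last by rewrite memJ_norm // groupV (subsetP nJ).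
    apply/esym/(rot_eq hC) => //; first by rewrite groupJ ?groupV.
    rewrite conjgE invgK !aut_flagM ex jk2 /k2 -ex -!(aut_adj hP) ?adj_flag //.
    by rewrite -aut_flagM mulgV aut_flag1.
  have xA' : x^-1 \in G by rewrite groupV.
  suff rJ : rot f i' i \in J by rewrite -groupV rot_inv.
  have -> : rot f i' i = j ^ x^-1; last by rewrite memJ_norm // groupV (subsetP nJ).
  apply/esym/(rot_eq hC) => //; first by rewrite groupJ.
  have ex' : aut_flag x f = adj i k.
    by rewrite -ex -(aut_adj hP _ xA (adj_flag hP i ff)) adjK.
  rewrite conjgE invgK !aut_flagM ex' aut_adj // jk2 /k2.
  have -> : adj i' (adj i k) = aut_flag x (adj i' f) by rewrite -ex' aut_adj.
  by rewrite -aut_adj ?adj_flag // -aut_flagM mulgV aut_flag1.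
case: ji => ji; first by case/negP: (rot_notin ji).
by case/negP: (rot_notin ji); rewrite -groupV rot_inv.
Qed.

Lemma prm_adj k i : is_flag k -> adjacent (idx i) (prm k) (prm (adj i k)).
Proof.
move=> kf; have af := adj_flag hP i kf.
apply/and4P; split; rewrite ?(prm_flag sJG hP) //.
  by rewrite !ffunE; apply/eqP=> e; apply: (@quo_adj_neq k i).
by apply/forallP=> l; apply/implyP=> li; rewrite !ffunE adj_out.
Qed.

(** [quo_lift] matches all ranks but 0; a mismatch there would give 0-adjacent flags with the same
    image, against [quo_adj_neq]. *)
Lemma prm_eqP h k : is_flag h -> is_flag k -> prm h = prm k ->
  exists2 j, j \in J & aut_flag j h = k.
Proof.
move=> hf kf /ffunP e.
have [//|l nl|j jJ ej] := @quo_lift (fun l => l != l0) h k hf kf.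
- by rewrite negb_forall; apply/existsP; exists l0.
- by have := e (idx l); rewrite !ffunE.
have jG := subsetP sJG _ jJ; have jA : is_aut j by apply/autP.
have jf := aut_is_flag hP jA hf.
exists j => //.
have [w ew wi] := flag_conn hP jf kf.
have wl l : l \in w -> l = l0.
  by move/wi; rewrite ffunE => nl; apply/eqP/idPn=> /ej el; rewrite el eqxx in nl.
have [e0|ne0] := eqVneq (aut_flag j h (idx l0)) (k (idx l0)).
  have : w = [::].
    by case: w wi wl {ew} => // l w /(_ l (mem_head _ _)) + /(_ l (mem_head _ _)) el; rewrite el e0 eqxx.
  by move=> w0; rewrite w0 in ew.
have adj0 : adj l0 (aut_flag j h) = k.
  apply: (adj_eq hP); apply/and4P; split=> //; apply/forallP=> m; apply/implyP=> mi.
  by rewrite -ew (adjw_out hP) // => l /wl->.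
case: (@quo_adj_neq (aut_flag j h) l0) => //; rewrite adj0 ffunE pr_act //.
by have := e (idx l0); rewrite !ffunE.
Qed.

Fixpoint trace (w : seq 'I_4) h : seq (flagT Q 4) :=
  if w is i :: w' then prm (adj i h) :: trace w' (adj i h) else [::].

Lemma trace_path w h : is_flag h ->
  path (@some_adjacent Q 4) (prm h) (trace w h) /\ last (prm h) (trace w h) = prm (adjw w h).
Proof.
elim: w h => //= i w IH h hf; have [h1 h2] := IH _ (adj_flag hP i hf); split=> //.
by rewrite h1 andbT; apply/existsP; exists (idx i); apply: prm_adj.
Qed.

Lemma trace_face (w : seq 'I_4) h (k : 'I_6) F : is_flag h -> (forall i, i \in w -> k != idx i) ->
  F \in trace w h -> F k = pr J (h k).
Proof.
elim: w h => //= i w IH h hf kw; have ki : k != idx i by apply: kw; rewrite mem_head.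
rewrite inE => /orP[/eqP->|]; first by rewrite ffunE adj_out.
move/IH => ->; rewrite ?adj_flag ?adj_out //.
by move=> l lw; apply: kw; rewrite inE lw orbT.
Qed.

Lemma quo_polytope : is_polytope Q 4.
Proof.
have qr := quo_refl sJG hP; split; first by move=> X; apply: qr.
split.
  move=> X Y XY YX; apply: (quo_le_rk_eq sJG hP XY); apply/eqP; rewrite eqn_leq.
  by rewrite !(quo_le_rk sJG hP).
split; first by move=> X Y Z; apply: (quo_trans sJG hP).
case: (hP) => _ [_ [_ [[m [rm lem]] [[M [rM leM]] _]]]].
split.
  exists (pr J m); rewrite (pr_rk sJG hP); split=> // X.
  by have [x ->] := pr_surj X; apply: pr_le.
split.
  exists (pr J M); rewrite (pr_rk sJG hP); split=> // X.
  by have [x ->] := pr_surj X; apply: pr_le.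
split; first by move=> X Y; apply: (quo_rlt_rk sJG hP).
split; first by move=> X Y; apply: (quo_cover sJG hP).
split.
  move=> F F' Ff Ff'.
  have [h hf eh] := flag_lift sJG hP Ff; have [k kf ek] := flag_lift sJG hP Ff'.
  (* I marks the ranks where F and F' agree. Lifts that agree there are joined by a word avoiding
     these ranks, and its path is projected. *)
  pose I l := pr J (h (idx l)) == pr J (k (idx l)).
  have [/forallP allI|nI] := boolP [forall i, I i].
    exists [::]; split=> //=; rewrite -eh -ek; apply/ffunP=> l; rewrite !ffunE.
    have rkeq : rrk (h l) = rrk (k l) by rewrite !flag_rk.
    have [l_0|l_0] := posnP l.
      by rewrite (le_rk_eq hP _ rkeq) // (rk0_le hP) // flag_rk.
    have [l_5|l_5] := leqP 5 l.
      have el : nat_of_ord l = 5 by apply/eqP; rewrite eqn_leq l_5 -ltnS ltn_ord.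
      by rewrite (le_rk_eq hP _ rkeq) // (rkn_le hP) // flag_rk.
    have ll : l.-1 < 4 by rewrite -ltnS prednK.
    have -> : l = idx (Ordinal ll) by apply: ord_inj; rewrite val_idx /= prednK.
    exact/eqP/allI.
  have [j jJ ej] := @quo_lift I h k hf kf nI (fun i => @eqP _ _ _).
  have jA : is_aut j by apply/autP/(subsetP sJG).
  have jf := aut_is_flag hP jA hf.
  have [w ew wi] := flag_conn hP jf kf.
  have ejh : prm (aut_flag j h) = F.
    by rewrite -eh; apply/ffunP=> l; rewrite !ffunE pr_act.
  have [tp tl] := trace_path w jf; rewrite ejh ew ek in tp tl.
  exists (trace w (aut_flag j h)); split=> //; apply/allP=> H Hs.
  apply/forallP=> l; apply/implyP=> /eqP FF'; apply/eqP.
  rewrite (trace_face jf _ Hs); first by rewrite -ejh [RHS]ffunE.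
  move=> i /wi; apply: contra => /eqP el; apply/eqP; rewrite ffunE; apply: ej.
  by rewrite /I -el; apply/eqP; move: FF'; rewrite -eh -ek !ffunE.
move=> X Y lt; have [x eX] := pr_surj X; rewrite eX in lt *.
have /andP[leXY _] := lt; have [y eY lxy] := pr_le_lift sJG leXY; rewrite eY in lt *.
rewrite !(pr_rk sJG hP) => ry.
have [h [hf hx hy]] := flag_thru hP lxy.
have xn : rrk x < 4 by have := rk_le hP y; rewrite ry !ltnS.
pose i := Ordinal xn.
have ii : idx i = (rrk x).+1 :> nat by rewrite val_idx.
have af := adj_flag hP i hf.
have fnidx (g : flagT P 4) : fn g (rrk x).+1 = g (idx i) by [].
have a0 : fn (adj i h) (rrk x) = x.
  rewrite -{2}hx; apply: adj_out => //; rewrite -val_eqE /= ii inordK ?ltn_eqF //.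
  by rewrite ltnS ltnW // ltnW.
have a2 : fn (adj i h) (rrk y) = y.
  rewrite -{2}hy; apply: adj_out => //; rewrite -val_eqE /= ii inordK ?ry ?gtn_eqF //.
(* A face Z between lifts to some z between x and a representative y' of Y. Some j in J fixes x and
   sends y' to y, so j z is one of the two faces of P between x and y. *)
have -> : [set Z | rlt (pr J x) Z && rlt Z (pr J y)] =
    [set pr J (h (idx i)); pr J (adj i h (idx i))].
  apply/setP=> Z; rewrite in_set in_set2; apply/andP/orP=> [[XZ ZY]|].
    have rZ : rrk Z = (rrk x).+1.
      have := quo_rlt_rk sJG hP XZ; have := quo_rlt_rk sJG hP ZY.
      by rewrite !(pr_rk sJG hP) ry ltnS => h1 h2; apply/eqP; rewrite eqn_leq h1.
    case/andP: XZ => XZ _; case/andP: ZY => ZY _.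
    have [z eZ xz] := pr_le_lift sJG XZ; rewrite eZ in ZY rZ *.
    have [y' eY' zy'] := pr_le_lift sJG ZY.
    rewrite (pr_rk sJG hP) in rZ.
    have ry' : rrk y' = (rrk x).+2 by rewrite -(pr_rk sJG hP y') -eY' (pr_rk sJG hP) ry.
    have [k0 [k0f k0x k0y]] := flag_thru hP (le_trans hP xz zy').
    pose k := [ffun l => if l == idx i then z else k0 l] : flagT P 4.
    have kf : is_flag k by apply: (flag_set hP) => //=; rewrite ?k0x // -ry' k0y.
    pose I (l : 'I_4) := (l.+1 == rrk x) || (l.+1 == (rrk x).+2).
    have kout (l : nat) : l <= 5 -> l != (rrk x).+1 -> fn k l = fn k0 l.
      by move=> l5 lx; rewrite /fn ffunE -val_eqE /= ii inordK // (negPf lx).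
    have kx : fn k (rrk x) = x by rewrite kout ?k0x ?ltn_eqF // ltnW // ltnW.
    have ky : fn k (rrk x).+2 = y' by rewrite kout -?ry' ?k0y // ?(rk_le hP) // ry' gtn_eqF.
    have hy2 : fn h (rrk x).+2 = y by rewrite -ry.
    have [|l /orP[] /eqP el|j jJ ej] := @quo_lift I k h kf hf.
    - rewrite negb_forall; apply/existsP; exists i; rewrite /I /=.
      by rewrite gtn_eqF // ltn_eqF.
    - by rewrite !idx_fn el kx hx.
    - by rewrite !idx_fn el ky hy2 eY'.
    have jA : is_aut j by apply/autP/(subsetP sJG).
    have jx : j x = x.
      have [x0|x0] := posnP (rrk x).
        by apply/esym/(le_rk_eq hP); [apply: (rk0_le hP) | rewrite (aut_rk hP)].
      have xl : (rrk x).-1 < 4 by rewrite (leq_ltn_trans (leq_pred _)).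
      have := ej (Ordinal xl); rewrite /I /= prednK // eqxx !idx_fn /= prednK // kx hx.
      by apply.
    have jy : j y' = y.
      have [xl|xl] := ltnP (rrk x).+1 4.
        have := ej (Ordinal xl); rewrite /I /= eqxx orbT !idx_fn /= ky hy2.
        by apply.
      apply: (le_rk_eq hP); last by rewrite (aut_rk hP) // ry' ry.
      apply: (rkn_le hP); rewrite ry; congr _.+2; apply/eqP; by rewrite eqn_leq -ltnS xn.
    have rjz : rrk (j z) = i.+1 by rewrite (aut_rk hP).
    have le1 : rle (fn h i) (j z) by rewrite hx -{1}jx jA.
    have le2 : rle (j z) (fn h i.+2) by rewrite /= hy2 -jy jA.
    have gf := flag_set hP hf rjz le1 le2.
    rewrite -(pr_act z jJ).
    have [->|ne] := eqVneq (j z) (h (idx i)); first by left.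
    right; suff -> : adj i h = [ffun l => if l == idx i then j z else h l].
      by rewrite ffunE eqxx.
    apply: (adj_eq hP); apply/and4P; split=> //; first by rewrite ffunE eqxx eq_sym.
    by apply/forallP=> l; apply/implyP=> li; rewrite ffunE (negPf li).
  have betw (g : flagT P 4) : is_flag g -> fn g (rrk x) = x -> fn g (rrk y) = y ->
      rlt (pr J x) (pr J (g (idx i))) /\ rlt (pr J (g (idx i))) (pr J y).
    move=> gf gx gy; rewrite -fnidx.
    have i5 : (rrk x).+1 <= 5 by rewrite ltnW // ltnS.
    have y5 : rrk y <= 5 by apply: (rk_le hP).
    split; apply: (pr_neq sJG hP).
    - by rewrite -[X in rle X _]gx; apply: fn_le => //; rewrite leqnSn.
    - by rewrite fn_rk // ltn_eqF.
    - by rewrite -[X in rle _ X]gy; apply: fn_le => //; rewrite y5 ry leqnSn.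
    by rewrite fn_rk // ry ltn_eqF.
  by case=> /eqP->; apply: betw.
by rewrite cards2; case: eqP => // e; case: (@quo_adj_neq h i hf).
Qed.

Let hQ : is_polytope Q 4 := quo_polytope.

Lemma prm_adjE h i : is_flag h -> prm (adj i h) = adj i (prm h).
Proof. by move=> hf; apply/esym/(adj_eq hQ)/prm_adj. Qed.

Lemma prm_adjw h w : is_flag h -> prm (adjw w h) = adjw w (prm h).
Proof. by elim: w h => //= i w IH h hf; rewrite IH ?adj_flag // prm_adjE. Qed.

Lemma prm_autP h x : is_flag h -> x \in G -> (prm (aut_flag x h) == prm h) = (x \in J).
Proof.
move=> hf xG; have xA : is_aut x by apply/autP.
apply/eqP/idP=> [e|xJ]; last by apply/ffunP=> l; rewrite !ffunE pr_act.
have [j jJ ej] := prm_eqP (aut_is_flag hP xA hf) hf e.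
suff -> : x = j^-1 by rewrite groupV.
apply: (mulIg j); rewrite mulVg; apply: (aut_free hP _ hf); last by rewrite aut_flagM.
by apply/autP; rewrite groupM // (subsetP sJG).
Qed.

Lemma quo_covers : covers 4 P Q.
Proof.
exists (pr J); split; first by move=> x y; apply: pr_le.
split; first by move=> x; apply: (pr_rk sJG hP).
move=> k h h' hh'; have [i ek] := adjacent_idx hP hh'; rewrite ek in hh' *.
by rewrite -(adj_eq hP hh'); apply: prm_adj; case/and4P: hh'.
Qed.

(** Equal cardinalities would make the projection injective, yet it identifies x with its images
    under J. *)
Lemma quo_not_iso : J :!=: 1 -> ~ isomorphic P Q.
Proof.
move=> ntJ [gam [[gam' K1 K2] _]].
have cardE : #|carrier P| = #|carrier Q| by apply: bij_eq_card (Bijective K1 K2).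
have /image_injP inj : #|image (pr J) (carrier P)| == #|carrier P|.
  rewrite cardE; apply/eqP/eq_card => X; have [x ->] := pr_surj X.
  by rewrite [LHS]image_f.
case/negP: ntJ; apply/eqP/trivgP/subsetP=> j jJ; apply/set1gP/permP=> x.
by rewrite perm1; apply: inj; rewrite ?pr_act.
Qed.

(** Flags of the quotient are images of the two orbits of flags of P, so a single adjacent pair in
    one orbit merges everything. *)
Lemma quo_adj_orbit i : (exists (l : 'I_6) (F F' : flagT Q 4), adjacent l F F' /\ same_orbit F F') ->
  same_orbit (prm f) (prm (adj i f)).
Proof.
case=> k [H [H' [HH' so]]]; have [m ek] := adjacent_idx hQ HH'; rewrite ek in HH'.
have Hf : is_flag H by case/and4P: HH'.
have [h hf eh] := flag_lift sJG hP Hf.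
have qo := quo_orbit sJG nJ.
rewrite -(adj_eq hQ HH') -eh -prm_adjE // in so.
have mi : same_orbit (adj m f) (adj i f).
  have := adj2_orbit hC m i (adj_flag hP m ff); by rewrite adjK.
apply: same_orbit_trans (qo _ _ _ mi).
case: (flag_orbits hC m ff hf) => fh.
  apply: same_orbit_trans (qo _ _ _ fh) _; apply: same_orbit_trans so _.
  by apply/same_orbit_sym/qo/same_orbit_adj.
have fh' : same_orbit f (adj m h).
  by have := same_orbit_adj hP m (adj_flag hP m ff) fh; rewrite adjK.
apply: same_orbit_trans (qo _ _ _ fh') _; apply: same_orbit_trans (same_orbit_sym so) _.
exact/same_orbit_sym/qo.
Qed.

(* [e] selects three consecutive adjacencies: those of a facet or of a vertex-figure. *)
Lemma quo_reg (e : 'I_3 -> 'I_4) :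
  (exists (l : 'I_6) (F F' : flagT Q 4), adjacent l F F' /\ same_orbit F F') ->
  reg (rot f (e o1) (e o0)) (rot f (e o2) (e o1)) J.
Proof.
move=> /(quo_adj_orbit (e o1)) /same_orbitP[q qG eq] w wJ.
have qA : is_aut q by apply/autP.
have af := adj_flag hP (e o1) ff.
have wG := ev_autG e hC ff w.
have fw : adjw (map e (word_adj w)) (prm f) = prm f.
  by rewrite -prm_adjw // -(ev_word e hC ff); apply/eqP; rewrite prm_autP.
have [<- <-] := rot_mirror e hC ff.
rewrite -(prm_autP af) ?(ev_autG e hC af) // (ev_word e hC af) prm_adjw // -eq.
by rewrite -aut_adjw ?fw ?(prm_flag sJG hP).
Qed.

Lemma quo_chiral : ~ (exists (l : 'I_6) (F F' : flagT Q 4), adjacent l F F' /\ same_orbit F F') -> chiral Q 4.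
Proof.
move=> nE; split=> //; split.
  by move=> l F F' FF' so; apply: nE; exists l, F, F'.
move=> F1 F2 F3 Ff1 Ff2 Ff3.
have [h1 hf1 <-] := flag_lift sJG hP Ff1; have [h2 hf2 <-] := flag_lift sJG hP Ff2.
have [h3 hf3 <-] := flag_lift sJG hP Ff3.
have qo := quo_orbit sJG nJ.
by case: hC => _ [_ H]; case: (H _ _ _ hf1 hf2 hf3) => [so|[so|so]];
  [left | right; left | right; right]; apply: qo.
Qed.

Section QuotientTight.
Hypothesis qC : chiral Q 4.
Let Ff : is_flag (prm f) := prm_flag sJG hP ff.

Lemma rot_pow (R : Raw) (g : flagT R 4) i j m : chiral R 4 -> is_flag g ->
  aut_flag (rot g i j ^+ m) g = adjw (iter m (cat^~ [:: i; j]) [::]) g.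
Proof.
move=> hR gf; have hRP : is_polytope R 4 by case: hR.
have [rR er] := rotP hR i j gf; elim: m => [|m IH]; first exact: aut_flag1.
rewrite expgS aut_flagM er iterS adjw_cat -IH !aut_adj ?adj_flag //;
  by apply/autP; rewrite groupX.
Qed.

Lemma order_quo_rot i j : #[rot (prm f) i j] = #[coset J (rot f i j)].
Proof.
have [qG _] := rotP qC i j Ff; have rN := subsetP nJ _ (rG i j).
have H m : (rot (prm f) i j ^+ m == 1) = (coset J (rot f i j) ^+ m == 1).
  rewrite -morphX //=; have -> : (coset J (rot f i j ^+ m) == 1) = (rot f i j ^+ m \in J).
    by apply/eqP/idP=> [/coset_idr|/coset_id//]; apply; rewrite groupX.
  rewrite -(prm_autP ff) ?groupX // rot_pow // prm_adjw // -(rot_pow _ _ _ qC Ff).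
  apply/eqP/eqP=> [->|]; first exact: aut_flag1.
  by apply: (aut_free hQ) => //; apply/autP; rewrite groupX.
by apply/eqP; rewrite eqn_dvd !order_dvdn H expg_order -H expg_order !eqxx.
Qed.

(** Both sides count the images of the flags in the orbit of f. Chirality of the quotient stops its
    automorphisms from reaching the images of the other orbit. *)
Lemma card_quo_aut : #|autG Q| = #|G / J|.
Proof.
have -> : #|autG Q| = #|[set aut_flag q (prm f) | q in autG Q]|.
  by rewrite card_in_imset // => q q' qG qG'; apply: (aut_inj hQ).
pose phi (X : coset_of J) := prm (aut_flag (repr X) f).
have phiE x : x \in G -> phi (coset J x) = prm (aut_flag x f).
  move=> xG; have xN := subsetP nJ _ xG.
  have : repr (coset J x) \in J :* x by rewrite -val_coset // mem_repr_coset.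
  case/rcosetP=> j jJ; rewrite /phi => ->.
  have -> : j * x = x * j ^ x by rewrite conjgE mulKVg.
  by apply/ffunP=> l; rewrite aut_flagM !ffunE pr_act // memJ_norm.
have -> : [set aut_flag q (prm f) | q in autG Q] = phi @: (G / J).
  apply/setP=> F; apply/imsetP/imsetP=> [[q qG ->]|[X XG ->]].
    have qA : is_aut q by apply/autP.
    have [h hf eh] := flag_lift sJG hP (aut_is_flag hQ qA Ff).
    case: (flag_orbits hC l0 ff hf) => /same_orbitP[x xG ex].
      exists (coset J x); first by rewrite mem_quotient.
      by rewrite phiE // ex.
    case: (adj_not_orbit qC (i := l0) Ff); rewrite -prm_adjE //.
    apply: (@same_orbit_trans _ _ _ (prm h)).
      by apply/same_orbitP; exists q; rewrite ?eh.
    by apply/same_orbit_sym/(quo_orbit sJG nJ)/same_orbitP; exists x.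
  case/morphimP: XG => x xN xG ->; rewrite phiE //.
  have [q qG eq] := quo_aut sJG nJ xG; exists q => //.
  by apply/ffunP=> l; rewrite !ffunE eq.
rewrite card_in_imset // => X Y /morphimP[x xN xG ->] /morphimP[y yN yG ->].
rewrite !phiE // => e; have xA : is_aut x by apply/autP.
have yA : is_aut y by apply/autP.
have [j jJ ej] := prm_eqP (aut_is_flag hP xA ff) (aut_is_flag hP yA ff) e.
have <- : x * j = y.
  by apply: (aut_inj hP _ yG ff); rewrite ?aut_flagM // groupM // (subsetP sJG).
have jN := subsetP (normG J) _ jJ.
by rewrite morphM //= (coset_id jJ) mulg1.
Qed.

Lemma quo_tight : tight Q 4.
Proof.
split=> //; exists [:: #[coset J a]; #[coset J b]; #[coset J c]]; split.
  split=> // j /andP[j1 j3] x y rx ry lxy.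
  have cp (i i' : 'I_4) := @card_polygon Q 4 qC (prm f) i i' x y Ff.
  case: j j1 j3 rx ry => [|[|[|[|//]]]] // _ _ rx ry.
  - by rewrite /= -(order_quo_rot l1 l0) -(cp l0 l1).
  - by rewrite /= -(order_quo_rot l2 l1) -(cp l1 l2).
  by rewrite /= -(order_quo_rot l3 l2) -(cp l2 l3).
have N i j : rot f i j \in 'N(J) by apply: (subsetP nJ).
have e : #|G / J| = (#[coset J a] * #[coset J b] * #[coset J c])%N.
  rewrite -(triple_card ttq) -!quotient_cycle ?N // -!quotientY ?cycle_subG ?N //.
    by rewrite (rots_gen hC hT ff).
  by rewrite join_subG !cycle_subG !N.
have prod3 p q r : (2 * (p * q * r) = 2 * \prod_(x <- [:: p; q; r]) x)%N.
  by rewrite !big_cons big_nil muln1 !mulnA.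
by rewrite (num_flags_aut qC l0 Ff) card_quo_aut e; exact: prod3.
Qed.

End QuotientTight.

End TightQuotient.

(** * Kernels of covers *)

Definition word_inv := map (fun l : bool * bool => (l.1, ~~ l.2)).

Lemma ev_word_inv (gT : finGroupType) (a b : gT) w : ev a^-1 b^-1 w = ev a b (word_inv w).
Proof.
elim: w => //= -[i e] w ->; congr (_ * _).
by case: i e => [] []; rewrite /letter_val //= invgK.
Qed.

Lemma ev_rev_inv (gT : finGroupType) (a b : gT) w :
  ev a b (rev (word_inv w)) = (ev a b w)^-1.
Proof.
elim: w => [|[i e] w IH] /=; first by rewrite invg1.
rewrite rev_cons -cats1 ev_cat IH invMg /= mulg1; congr (_ * _).
by case: i e => [] []; rewrite /letter_val //= invgK.
Qed.

Lemma mem_join_ev (gT : finGroupType) (a b x : gT) :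
  x \in <[a]> <*> <[b]> -> exists w, x = ev a b w.
Proof.
case/gen_prodgP=> n [c cab ->] {x}; elim: n c cab => [|n IH] c cab.
  by exists [::]; rewrite big_ord0.
have [w ew] := IH (fun i => c (lift ord0 i)) (fun i => cab _).
have [v ev0] : exists v, c ord0 = ev a b v.
  have := cab ord0; rewrite inE => /orP[] /cycleP[m ->].
    by exists (nseq m (true, false)); rewrite ev_nseq.
  by exists (nseq m (false, false)); rewrite ev_nseq.
by exists (v ++ w); rewrite big_ord_recl ev_cat -ew ev0.
Qed.

Lemma ev_pair (gT hT : finGroupType) (a b : gT) (a' b' : hT) w :
  ev ((a, a') : gT * hT) (b, b') w = (ev a b w, ev a' b' w).
Proof. by elim: w => [|[[] []] w IH] //=; rewrite IH. Qed.

(** The homomorphism is encoded by its graph, the subgroup of the product generated by (a, a') and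
    (b, b'); its elements of the form (x, 1) give the kernel. *)
Lemma cover_kernel (gT hT : finGroupType) (a b : gT) (a' b' : hT) :
  (forall w, ev a b w = 1 -> ev a' b' w = 1) ->
  exists N : {group gT}, [/\ N \subset <[a]> <*> <[b]>, <[a]> <*> <[b]> \subset 'N(N) &
    forall w, (ev a b w \in N) = (ev a' b' w == 1)].
Proof.
move=> H; pose A : gT * hT := (a, a'); pose B : gT * hT := (b, b').
pose D := (<[A]> <*> <[B]>)%G.
pose N := [set x : gT | (x, 1 : hT) \in D].
have gN : group_set N.
  apply/group_setP; split; first by rewrite inE; apply: (group1 D).
  move=> x y; rewrite !inE => xD yD.
  have -> : (x * y, 1 : hT) = ((x, 1) : gT * hT) * (y, 1) by congr pair; rewrite mulg1.
  exact: groupM.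
have evD w : (ev a b w, ev a' b' w) \in D by rewrite -ev_pair; apply: ev_mem.
have NP w : (ev a b w \in N) = (ev a' b' w == 1).
  rewrite inE; apply/idP/eqP=> [|e]; last by rewrite -e.
  case/mem_join_ev=> v; rewrite ev_pair => -[e e'].
  have : ev a b (w ++ rev (word_inv v)) = 1 by rewrite ev_cat ev_rev_inv -e mulgV.
  by move/H; rewrite ev_cat ev_rev_inv -e' invg1 mulg1.
have NK : N \subset <[a]> <*> <[b]>.
  apply/subsetP=> x; rewrite inE => /mem_join_ev[v]; rewrite ev_pair => -[-> _].
  exact: ev_mem.
exists (Group gN); split=> //; apply/subsetP=> y /mem_join_ev[v ->].
rewrite inE; apply/subsetP=> _ /imsetP[x xN ->].
have /mem_join_ev[w ew] := subsetP NK _ xN; rewrite ew in xN *.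
have -> : ev a b w ^ ev a b v = ev a b (rev (word_inv v) ++ w ++ v).
  by rewrite !ev_cat ev_rev_inv conjgE.
move: xN; rewrite !NP => /eqP e.
by rewrite !ev_cat ev_rev_inv e mul1g mulVg.
Qed.

Section Kernel.
Variables (gT hT : finGroupType) (a b : gT) (a' b' : hT) (N : {group gT}).
Hypothesis tp : tight_pair a b.
Hypothesis tI : <[a']> :&: <[b']> = 1.
Hypothesis sN : N \subset <[a]> <*> <[b]>.
Hypothesis NP : forall w, (ev a b w \in N) = (ev a' b' w == 1).

Lemma kernel_word i j : (a ^+ i * b ^+ j \in N) = (a' ^+ i * b' ^+ j == 1).
Proof.
have := NP (nseq i (true, false) ++ nseq j (false, false)).
by rewrite !ev_cat !ev_nseq.
Qed.

(** An element a^i b^j of N maps to a'^i b'^j = 1, and trivial intersection separates the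
    factors. *)
Lemma kernel_split x : x \in N -> exists i j,
  [/\ x = a ^+ i * b ^+ j, a' ^+ i = 1 & b' ^+ j = 1].
Proof.
move=> xN; have := subsetP sN _ xN; rewrite tight_joinE //.
case/mulsgP=> _ _ /cycleP[i ->] /cycleP[j ->] ex; exists i, j.
rewrite ex kernel_word in xN.
have bj : b' ^+ j = 1.
  apply/set1gP; rewrite -tI; apply/setIP; split; last exact: mem_cycle.
  have -> : b' ^+ j = (a' ^+ i)^-1.
    by apply/eqP; rewrite eq_sym eq_invg_mul.
  by rewrite groupV mem_cycle.
by split=> //; move/eqP: xN; rewrite bj mulg1.
Qed.

Lemma kernel_sub_a : #[b'] = #[b] -> N \subset <[a]>.
Proof.
move=> ob; apply/subsetP=> x /kernel_split[i [j [-> _ /eqP]]].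
rewrite -order_dvdn ob order_dvdn => /eqP->; rewrite mulg1; exact: mem_cycle.
Qed.

Lemma kernel_sub_b : #[a'] = #[a] -> N \subset <[b]>.
Proof.
move=> oa; apply/subsetP=> x /kernel_split[i [j [-> /eqP + _]]].
rewrite -order_dvdn oa order_dvdn => /eqP->; rewrite mul1g; exact: mem_cycle.
Qed.

Lemma proper_divisor_order m (x : gT) : proper_divisor m #[x] -> x ^+ m <> 1.
Proof.
case=> dm nm /eqP; rewrite -order_dvdn => md; apply: nm.
by apply/eqP; rewrite eqn_dvd dm md.
Qed.

Lemma kernel_neq1_a : proper_divisor #[a'] #[a] -> N :!=: 1.
Proof.
move=> /proper_divisor_order na; apply/eqP=> N1; apply: na; apply/set1gP; rewrite -N1.
by have := kernel_word #[a'] 0; rewrite !mulg1 expg_order eqxx.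
Qed.

Lemma kernel_neq1_b : proper_divisor #[b'] #[b] -> N :!=: 1.
Proof.
move=> /proper_divisor_order nb; apply/eqP=> N1; apply: nb; apply/set1gP; rewrite -N1.
by have := kernel_word 0 #[b']; rewrite !mul1g expg_order eqxx.
Qed.

Lemma kernel_not_reg : ~ reg a' b' 1 -> ~ reg a b N.
Proof.
move=> nr r; apply: nr => w /set1gP w1; apply/set1gP.
have := r w; rewrite NP w1 eqxx => /(_ isT); rewrite ev_word_inv NP => /eqP.
by rewrite -ev_word_inv.
Qed.

End Kernel.

Lemma rot_TI3 (Q : Raw) (h : flagT Q 3) : chiral Q 3 -> is_flag h ->
  <[rot h o1 o0]> :&: <[rot h o2 o1]> = 1.
Proof.
move=> hQ hf; apply/trivgP/subsetP=> g /setIP[ga gb]; apply/set1gP.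
have [aG _] := rotP hQ o1 o0 hf.
have fixc (i j k : 'I_3) x : x \in <[rot h i j]> -> k != i -> k != j ->
    x (h (idx k)) = h (idx k).
  move=> /cycleP[m ->] ki kj; elim: m => [|m IH]; first by rewrite perm1.
  by rewrite expgSr permM IH rot_fix // (inj_eq (@idx_inj 3)).
apply: (fix_proper_but hQ (i := o1) hf); first by apply: subsetP ga; rewrite cycle_subG.
move=> l l1; have [e|l0] := eqVneq l o0; first by apply: (fixc _ _ _ _ gb); rewrite e.
exact: (fixc _ _ _ _ ga).
Qed.

(** * Covers acting on flags *)

Section MapFlag.
Variables (P Q : Raw) (n : nat) (gam : carrier P -> carrier Q).
Hypotheses (hP : is_polytope P n) (hQ : is_polytope Q n).
Hypothesis gle : forall x y, rle x y -> rle (gam x) (gam y).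
Hypothesis grk : forall x, rrk (gam x) = rrk x.
Hypothesis gadj : forall (k : 'I_n.+2) (g h : flagT P n), adjacent k g h ->
  adjacent k (map_flag gam g) (map_flag gam h).

Lemma map_flag_flag (g : flagT P n) : is_flag g -> is_flag (map_flag gam g).
Proof.
move=> gf; apply/andP; split; apply/forallP=> k; first by rewrite ffunE grk flag_rk.
by apply/forallP=> l; apply/implyP=> kl; rewrite !ffunE; apply: gle; apply: flag_le.
Qed.

Lemma map_flag_adjw w (g : flagT P n) : is_flag g ->
  map_flag gam (adjw w g) = adjw w (map_flag gam g).
Proof.
elim: w g => //= i w IH g gf; rewrite IH ?adj_flag //; congr adjw.
by apply/esym/(adj_eq hQ)/gadj/adjP.
Qed.

End MapFlag.

(** * Atomic 4-polytopes *)

Lemma eo0E : [/\ eo 0 o0 = l0, eo 0 o1 = l1 & eo 0 o2 = l2].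
Proof. by split; apply: ord_inj; rewrite val_eo. Qed.

Lemma eo1E : [/\ eo 1 o0 = l1, eo 1 o1 = l2 & eo 1 o2 = l3].
Proof. by split; apply: ord_inj; rewrite val_eo. Qed.

Section Atomic.
Variables (P : Raw) (f : flagT P 4).
Hypothesis hA : atomic_chiral4 P.
Hypothesis hF : facet_sections P (fun Q => chiral Q 3).
Hypothesis hV : vertex_figures P (fun Q => chiral Q 3).
Hypothesis ff : is_flag f.
Let hT : tight P 4. Proof. by case: hA. Qed.
Let hC : chiral P 4. Proof. by case: hA => _ []. Qed.
Let hP : is_polytope P 4. Proof. by case: hC. Qed.
Let a := rot f l1 l0.
Let b := rot f l2 l1.
Let c := rot f l3 l2.

Lemma chiral_facet : chiral (section (fn f 0) (fn f (0 + 4))) 3.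
Proof. by apply: hF; rewrite fn_rk. Qed.

Lemma chiral_vfig : chiral (section (fn f 1) (fn f (1 + 4))) 3.
Proof. by apply: hV; rewrite fn_rk. Qed.

(** A failure of regularity means, by [quo_reg], that the quotient has no reflection; it would then
    be a tight chiral polytope properly covered by P. *)
Lemma atomic_quo_reg (U : {group {perm carrier P}}) (e : 'I_3 -> 'I_4) :
  U :!=: 1 -> <[a]> <*> <[b]> <*> <[c]> \subset 'N(U) ->
  [|| U \subset <[a]>, U \subset <[b]> | U \subset <[c]>] ->
  a \notin U -> b \notin U -> c \notin U ->
  reg (rot f (e o1) (e o0)) (rot f (e o2) (e o1)) U.
Proof.
move=> ntU; rewrite (rots_gen hC hT ff) => nU sU aU bU cU w wU; apply/idPn=> nw.
have sUG : U \subset autG P.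
  have rs i j : <[rot f i j]> \subset autG P.
    by rewrite cycle_subG; case: (rotP hC i j ff).
  by case/or3P: sU => s; apply: subset_trans s (rs _ _).
have qC : chiral (quo U) 4.
  apply: (quo_chiral hC hT ff sUG nU sU aU bU cU) => E.
  by move/negP: nw; apply; apply: (quo_reg hC hT ff sUG nU sU aU bU cU E).
case: hA => _ [_ /(_ (quo U))]; apply=> //.
  exact: (quo_tight hC hT ff sUG nU sU aU bU cU).
split; first exact: (quo_covers hC hT ff sUG nU sU aU bU cU).
exact: quo_not_iso.
Qed.

Lemma rots_atomic : atomic_triple a b c.
Proof.
have [e00 e01 e02] := eo0E; have [e10 e11 e12] := eo1E.
split; first exact: rots_triple.
- by have := sec_not_reg hC ff (isT : 0 <= 1) chiral_facet; rewrite e00 e01 e02.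
- by have := sec_not_reg hC ff (isT : 1 <= 1) chiral_vfig; rewrite e10 e11 e12.
move=> U ntU nU sU aU bU cU.
have := atomic_quo_reg (e := eo 0) ntU nU sU aU bU cU.
have := atomic_quo_reg (e := eo 1) ntU nU sU aU bU cU.
by rewrite e00 e01 e02 e10 e11 e12.
Qed.

(** Turns a cover of the section into the kernel of a map of rotation groups; equal or properly
    dividing entries of the type locate the kernel and make it nontrivial. *)
Lemma sec_kernel (o : nat) (Q : Raw) : o <= 1 ->
  chiral (section (fn f o) (fn f (o + 4))) 3 -> chiral Q 3 ->
  covers 3 (section (fn f o) (fn f (o + 4))) Q ->
  tight_pair (rot f (eo o o1) (eo o o0)) (rot f (eo o o2) (eo o o1)) ->
  exists (a' b' : {perm carrier Q}) (N : {group {perm carrier P}}),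
  [/\ <[a']> :&: <[b']> = 1,
      forall p q, has_type Q 3 [:: p; q] -> p = #[a'] /\ q = #[b'],
      ~ reg (rot f (eo o o1) (eo o o0)) (rot f (eo o o2) (eo o o1)) N,
      <[rot f (eo o o1) (eo o o0)]> <*> <[rot f (eo o o2) (eo o o1)]> \subset 'N(N) &
      [/\ #[b'] = #[rot f (eo o o2) (eo o o1)] -> N \subset <[rot f (eo o o1) (eo o o0)]>,
          #[a'] = #[rot f (eo o o1) (eo o o0)] -> N \subset <[rot f (eo o o2) (eo o o1)]>,
          proper_divisor #[a'] #[rot f (eo o o1) (eo o o0)] -> N :!=: 1 &
          proper_divisor #[b'] #[rot f (eo o o2) (eo o o1)] -> N :!=: 1]].
Proof.
move=> ho hS hQ [gam [gle [grk gadj]]] tp.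
have hSP : is_polytope (section (fn f o) (fn f (o + 4))) 3 by case: hS.
have hQP : is_polytope Q 3 by case: hQ.
have [g gf eg] := base_flag hC ff ho.
have hf := map_flag_flag gle grk gf; set h := map_flag gam g in hf.
have star w : adjw (map (eo o) w) f = f -> adjw w h = h.
  move=> e; rewrite /h -(map_flag_adjw hSP hQP gadj) //; congr map_flag.
  by apply: (ext_inj ho); rewrite (ext_adjw hC ff ho hS) // eg.
have [N [sN nN NP]] := cover_kernel (ev_cover hC ff hQ hf star).
exists (rot h o1 o0), (rot h o2 o1), N; split=> //.
- exact: rot_TI3.
- move=> p q hty; split.
    by rewrite -(has_type_rot hQ (i := o0) (j := o1) hf erefl hty).
  by rewrite -(has_type_rot hQ (i := o1) (j := o2) hf erefl hty).
- exact: kernel_not_reg NP (chiral_not_reg hQ hf).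
have tI := rot_TI3 hQ hf.
split; [exact: kernel_sub_a NP|exact: kernel_sub_b NP|exact: kernel_neq1_a NP|exact: kernel_neq1_b NP].
Qed.

Lemma facet_atomic : atomic_chiral_polyhedron (section (fn f 0) (fn f (0 + 4))).
Proof.
have [e00 e01 e02] := eo0E; have tt := rots_triple hC hT ff.
have [_ [ps [hty _]]] := hT.
have hS := chiral_facet; have hts := has_type_sec hC ff (isT : 0 <= 1) hty.
have pa := has_type_rot hC (i := l0) (j := l1) ff erefl hty.
have qb := has_type_rot hC (i := l1) (j := l2) ff erefl hty.
split.
  split; first by case: hS.
  exists [:: nth 0 ps 0; nth 0 ps 1]; split=> //.
  rewrite (num_flags_sec hC ff (isT : 0 <= 1)) // (card_stab3 hC hT ff).
  by rewrite !big_cons big_nil muln1 pa qb.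
split=> //; exists (nth 0 ps 0), (nth 0 ps 1); split=> // Q hQ cov.
have := sec_kernel (isT : 0 <= 1) hS hQ cov; rewrite e00 e01 e02.
case/(_ (triple_tpK tt)) => a' [b' [N [tI ty nr nN [s1 s2 n1 n2]]]].
have [aN bN] : a \in 'N(N) /\ b \in 'N(N).
  by move: nN; rewrite join_subG !cycle_subG => /andP[].
(* Shrinking the first entry puts N in <a>, where [core_a] kills it; shrinking the second puts it in
   <b>, where it would be regular. *)
split=> [] [m [dm hm]]; have [em ek] := ty _ _ hm.
  have N1 := core_a rots_atomic (s1 (etrans (esym ek) qb)) bN.
  by have/eqP[] : N :!=: 1 by apply: n1; rewrite -em -pa.
apply: nr; apply: (atomic_triple_reg rots_atomic) => //; first by apply: s2; rewrite -em pa.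
by apply: n2; rewrite -ek -qb.
Qed.

Lemma vfig_atomic : atomic_chiral_polyhedron (section (fn f 1) (fn f (1 + 4))).
Proof.
have [e10 e11 e12] := eo1E; have tt := rots_triple hC hT ff.
have [_ [ps [hty _]]] := hT.
have hS := chiral_vfig; have hts := has_type_sec hC ff (isT : 1 <= 1) hty.
have pb := has_type_rot hC (i := l1) (j := l2) ff erefl hty.
have qc := has_type_rot hC (i := l2) (j := l3) ff erefl hty.
split.
  split; first by case: hS.
  exists [:: nth 0 ps 1; nth 0 ps 2]; split=> //.
  rewrite (num_flags_sec hC ff (isT : 1 <= 1)) // (card_stab0 hC hT ff).
  by rewrite !big_cons big_nil muln1 pb qc.
split=> //; exists (nth 0 ps 1), (nth 0 ps 2); split=> // Q hQ cov.
have := sec_kernel (isT : 1 <= 1) hS hQ cov; rewrite e10 e11 e12.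
case/(_ (triple_tpL tt)) => a' [b' [N [tI ty nr nN [s1 s2 n1 n2]]]].
have [bN cN] : b \in 'N(N) /\ c \in 'N(N).
  by move: nN; rewrite join_subG !cycle_subG => /andP[].
split=> [] [m [dm hm]]; have [em ek] := ty _ _ hm; last first.
  have N1 := core_c rots_atomic (s2 (etrans (esym em) pb)) bN.
  by have/eqP[] : N :!=: 1 by apply: n2; rewrite -ek -qc.
(* The subgroup lies in <b> and is normalized by c, the dual of the facet case; so the reversed
   triple is used. *)
apply: nr; apply: reg_flip.
apply: (atomic_triple_reg (atomic_triple_sym rots_atomic)); rewrite ?cycleV ?groupV //.
  by apply: s1; rewrite -ek qc.
by apply: n1; rewrite -em -pb.
Qed.

End Atomic.

Theorem theorem4p4 (P : Raw) :
  atomic_chiral4 P ->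
  facet_sections P (fun Q => chiral Q 3) ->
  vertex_figures P (fun Q => chiral Q 3) ->
  facet_sections P atomic_chiral_polyhedron /\
  vertex_figures P atomic_chiral_polyhedron.
Proof.
move=> hA hF hV; have hP : is_polytope P 4 by case: hA => _ [[]].
split=> x y rx ry.
  have [f [ff fx fy]] := flag_thru hP (rk0_le hP y rx).
  rewrite rx ry in fx fy; rewrite -fx -fy; exact: facet_atomic.
have [f [ff fx fy]] := flag_thru hP (rkn_le hP x ry).
rewrite rx ry in fx fy; rewrite -fx -fy; exact: vfig_atomic.
Qed.
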